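(* As $m\to\infty$ through the positive integers, $$\mathrm m_{\mathbb D}(P_m)=\frac{\sigma}{\sqrt{2\pi}}\sqrt m-\frac14+\frac1{\sqrt{2\pi m}}\left(\frac1{4\sigma}-\frac{\kappa_4}{24\sigma^3}\right)+o\!\left(m^{-1/2}\right).$$
   Context: Let $\mathbb D=\{z\in\mathbb C:|z|<1\}$, $\mathrm dA$ planar Lebesgue measure. For a nonzero polynomial $F\in\mathbb C[z_1,\ldots,z_n]$, the areal Mahler measure is $\mathrm m_{\mathbb D}(F)=\pi^{-n}\int_{\mathbb D^n}\log|F(z_1,\ldots,z_n)|\,\mathrm dA(z_1)\cdots\mathrm dA(z_n)$. For $m\ge1$, $$P_m(x_1,\ldots,x_m,u)=\prod_{j=1}^m(1+x_j)+u\prod_{j=1}^m(1-x_j).$$ With $\zeta$ the Riemann zeta function, put $$\sigma=\left(\frac{\pi^2}{4}-2\log2\right)^{1/2}>0,\qquad \kappa_4=\frac{\pi^4}{8}-12(\log2)^2-\frac92\zeta(3).$$ *)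

(* Defs.v *)
From HB Require Import structures.
From mathcomp Require Import all_boot all_order all_algebra.
From mathcomp Require Import all_classical all_reals all_analysis.
From mathcomp Require Import complex.
(* The notations of [mpoly] clash with those of the analysis library. *)
From mathcomp Require Import -(notations) mpoly.

Set Implicit Arguments.
Unset Strict Implicit.
Unset Printing Implicit Defensive.

Import Order.TTheory GRing.Theory Num.Theory.
Import numFieldNormedType.Exports.

Local Open Scope classical_set_scope.
Local Open Scope ring_scope.

(* n-fold product of a (sigma-finite) measure with itself, on n-tuples. *)
Fixpoint tuple_measure d (T : measurableType d) (R : realType)
    (mu : set T -> \bar R) (n : nat) : set (n.-tuple T) -> \bar R :=
  match n return set (n.-tuple T) -> \bar R with
  | 0 => dirac (nil_tuple T)
  | k.+1 => pushforward (mu \x tuple_measure mu (n := k))%E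
              (fun p : T * k.-tuple T => [tuple of p.1 :: p.2])
  end.

(* The complex plane as a measurable space; [R[i]] has no sigma-algebra. *)
Notation plane R := (measurableTypeR R * measurableTypeR R)%type.

Definition to_complex (R : realType) (z : plane R) : R[i] := Complex z.1 z.2.

Definition planar_measure (R : realType) : set (plane R) -> \bar R :=
  (lebesgue_measure \x lebesgue_measure)%E.

Definition unit_disc (R : realType) : set (plane R) :=
  [set z | Normc.normc (to_complex z) < 1].

Definition unit_polydisc (R : realType) (n : nat) : set (n.-tuple (plane R)) :=
  [set z | forall i, unit_disc (tnth z i)].

(* [lne 0 = -oo], so the integrand is -oo on the zero set of [F]. *)
Definition areal_mahler (R : realType) (n : nat) (F : mpoly n R[i]) : \bar R :=
  (((pi ^+ n)^-1)%:E *
   \int[tuple_measure (@planar_measure R) (n := n)]_(z in @unit_polydisc R n)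
     lne (Normc.normc (meval (fun i => to_complex (tnth z i)) F))%:E)%E.

(* The variables are [x_1, ..., x_m, u] in this order: [u] is the last one. *)
Definition mahler_poly (R : realType) (m : nat) : mpoly m.+1 R[i] :=
  let x (j : 'I_m) := mpolyX _ (mnm1 (widen_ord (leqnSn m) j)) in
  let u := mpolyX _ (mnm1 ord_max) in
  \prod_(j < m) (1 + x j) + u * \prod_(j < m) (1 - x j).

(* The Dirichlet series of the Riemann zeta function, for real [s > 1]. *)
Definition zeta (R : realType) (s : R) : R :=
  limn (series (fun k : nat => (k.+1%:R `^ s)^-1)).

Definition sigma (R : realType) : R := Num.sqrt (pi ^+ 2 / 4 - 2 * ln 2).

Definition kappa4 (R : realType) : R :=
  pi ^+ 4 / 8 - 12 * (ln 2) ^+ 2 - 9 / 2 * zeta 3.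

(* Main.v *)
(** Write [Y(x) = ln |1 + x| - ln |1 - x|] and [W(u) = - ln |u|].  Averaging
    [ln |a + b u|] over the disc gives [ln (max |a| |b u|)] (Jensen), and
    [ln |1 + x|] has mean [0], so the Mahler measure is [-1/4 + E|S + W| / 2]
    with [S] a sum of [m] independent copies of [Y].  Since
    [|s| = (2 / pi) int_0^oo (1 - cos (t s)) / t^2 dt], it equals
    [-1/4 + (1 / pi) int_0^oo (1 - phi(t)^m psi(t)) / t^2 dt], where [phi] is the
    characteristic function of [Y] and [psi(t) = 4 / (4 + t^2)] that of [W].
    Replacing [phi^m psi] by its two-term Edgeworth approximation costs [O(1/m)],
    and what remains is a sum of Gaussian integrals.

    The moments of [Y] come from its distribution function, an area of a
    circular lens.  They reduce to [int_0^oo a^k sin b / (cosh a + cos b) da],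
    which are polynomials in [b] because the kernel is harmonic, and to the
    integrals of [b cot b] and [b^3 cot b] over [[0, pi/2]], where the Dirichlet
    kernel produces [ln 2] and [zeta 3]. *)

Require Import Defs.
From HB Require Import structures.
From mathcomp Require Import all_boot all_order all_algebra.
From mathcomp Require Import all_classical all_reals all_analysis.
From mathcomp Require Import measurable_realfun.
From mathcomp Require Import complex ring lra zify.

Set Implicit Arguments.
Unset Strict Implicit.
Unset Printing Implicit Defensive.

Import Order.TTheory GRing.Theory Num.Theory.
Import numFieldNormedType.Exports.

Local Open Scope classical_set_scope.
Local Open Scope ring_scope.

(** * Product measures on tuples *)

(** The difficulty is to control [phi^m] against the weight [1 / t^2] on the whole half-line. Since
    [Y] is symmetric, only even moments enter, and the first correction to the Gaussian is [k t^4]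
    per factor, with [k = kappa4 / 24]; the factor [psi] contributes [- t^2 / 4]. The remainder is
    bounded by [C / m * t^2 / (1 + t^2)], so that dividing by [t^2] leaves an integrable function
    with the factor [1 / m]. Near 0 this rests on Taylor's formula up to order 6. Away from 0 it
    rests on a bound [|phi| <= q < 1] valid up to infinity, obtained by integrating over slices on
    which [Y] has a bounded derivative; the same bound yields [sigma > 0].

    A device recurs throughout. Tonelli's theorem, rotation invariance and the layer-cake formula
    are used for nonnegative integrands, while logarithms and trigonometric functions have no sign.
    A function of known integral is therefore added first ([c - ln], [1 + sin], [1 + cos],
    [K / (1 + t^2)]) and subtracted at the end.

    The term [-1/4] is [- E W / 2], as [E W = 1/2]. *)

Section product_integral.
Local Open Scope ereal_scope.
Context d1 d2 (T1 : measurableType d1) (T2 : measurableType d2) (R : realType).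
Variables (m1 : {sigma_finite_measure set T1 -> \bar R})
  (m2 : {sigma_finite_measure set T2 -> \bar R}).
Variables (A : set T1) (B : set T2) (f : T1 * T2 -> \bar R).
Hypotheses (mA : measurable A) (mB : measurable B)
  (mf : measurable_fun (A `*` B) f)
  (f0 : forall x y, A x -> B y -> 0 <= f (x, y)).

Let mAB : measurable (A `*` B). Proof. exact: measurableX. Qed.

Let mfAB : measurable_fun setT (f \_ (A `*` B)).
Proof. exact/(measurable_restrictT _ mAB). Qed.

Let fAB0 z : 0 <= (f \_ (A `*` B)) z.
Proof.
rewrite patchE; case: ifPn => // /set_mem; case: z => x y [/= ? ?]; exact: f0.
Qed.

Lemma ge0_integral_prod1 :
  \int[m1 \x m2]_(z in A `*` B) f z =
  \int[m1]_(x in A) \int[m2]_(y in B) f (x, y).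
Proof.
rewrite integral_mkcond fubini_tonelli1// [RHS]integral_mkcond.
apply: eq_integral => x _; rewrite /fubini_F [RHS]patchE.
case: ifPn => [/set_mem Ax|xA].
  rewrite [RHS]integral_mkcond; apply: eq_integral => y _.
  rewrite !patchE; congr (if _ then _ else _).
  by apply/idP/idP => /set_mem yB; apply/mem_set => //; case: yB.
by apply: integral0_eq => y _; rewrite patchE; case: ifPn => // /set_mem[/= /mem_set]; rewrite (negbTE xA).
Qed.

Lemma ge0_integral_prod2 :
  \int[m1 \x m2]_(z in A `*` B) f z =
  \int[m2]_(y in B) \int[m1]_(x in A) f (x, y).
Proof.
rewrite integral_mkcond fubini_tonelli1// fubini_tonelli// [RHS]integral_mkcond.
apply: eq_integral => y _; rewrite /fubini_G [RHS]patchE.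
case: ifPn => [/set_mem By|yB].
  rewrite [RHS]integral_mkcond; apply: eq_integral => x _.
  rewrite !patchE; congr (if _ then _ else _).
  by apply/idP/idP => /set_mem xA; apply/mem_set => //; case: xA.
by apply: integral0_eq => x _; rewrite patchE; case: ifPn => // /set_mem[/= _ /mem_set]; rewrite (negbTE yB).
Qed.

Lemma ge0_integral_swap :
  \int[m1]_(x in A) \int[m2]_(y in B) f (x, y) =
  \int[m2]_(y in B) \int[m1]_(x in A) f (x, y).
Proof. by rewrite -ge0_integral_prod1 ge0_integral_prod2. Qed.

Lemma measurable_integral_prod1 :
  measurable_fun A (fun x => \int[m2]_(y in B) f (x, y)).
Proof.
apply: (eq_measurable_fun (fubini_F m2 (f \_ (A `*` B)))).
  move=> x /set_mem Ax; rewrite /fubini_F [RHS]integral_mkcond.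
  apply: eq_integral => y _; rewrite !patchE; congr (if _ then _ else _).
  by apply/idP/idP => /set_mem yB; apply/mem_set => //; case: yB.
by apply: measurable_funTS; exact: measurable_fun_fubini_tonelli_F.
Qed.

End product_integral.

Lemma product_measure_sigma_finite d1 d2 (T1 : measurableType d1)
    (T2 : measurableType d2) (R : realType)
    (m1 : {sigma_finite_measure set T1 -> \bar R})
    (m2 : {sigma_finite_measure set T2 -> \bar R}) :
  sigma_finite setT (m1 \x m2)%E.
Proof.
have [F TF Foo] := sigma_finiteT m1; have [G TG Goo] := sigma_finiteT m2.
(* Integers that code no pair contribute the empty set. *)
pose H (u : option (nat * nat)) := if u is Some p then F p.1 `*` G p.2 else set0.
exists (H \o unpickle).
  apply/seteqP; split=> // -[x y] _.
  have [i _ Fx] : (\bigcup_i F i) x by rewrite -TF.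
  have [j _ Gy] : (\bigcup_j G j) y by rewrite -TG.
  by exists (pickle (i, j)) => //=; rewrite pickleK.
move=> n /=; case: unpickle => [[i j]|]; last by split; [exact: measurable0|rewrite measure0 ltry].
have [mF F_oo] := Foo i; have [mG G_oo] := Goo j.
by split; [exact: measurableX|rewrite product_measure1E// lte_mul_pinfty// ge0_fin_numE].
Qed.

Section tuple_measure_theory.
Local Open Scope ereal_scope.
Context d (T : measurableType d) (R : realType).
Variable mu : {sigma_finite_measure set T -> \bar R}.

Let tcons n (p : T * n.-tuple T) : n.+1.-tuple T := [tuple of p.1 :: p.2].

Let measurable_tcons n : measurable_fun setT (@tcons n).
Proof. exact: measurable_cons. Qed.

(** Forming the product at one stage needs a sigma-finite measure from the stage before, so the
    induction produces a packed measure equal to the raw set function. The instances declared below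
    are read off it. *)
Let tuple_measure_ex n : exists m : {sigma_finite_measure set (n.-tuple T) -> \bar R},
  (m : set _ -> \bar R) = tuple_measure mu (n := n).
Proof.
elim: n => [|n [m mE]].
  by exists (dirac (nil_tuple T) : {sigma_finite_measure set _ -> \bar R}).
pose p0 : {measure set (T * n.-tuple T) -> \bar R} := (mu \x m).
pose M0 : {measure set (n.+1.-tuple T) -> \bar R} :=
  pushforward p0 (@tcons n).
pose M := M0 (@measurable_tcons n).
have ME : (M : set _ -> _) = tuple_measure mu (n := n.+1).
  by rewrite /= -mE.
have sM : sigma_finite setT M.
  have [F FT Foo] : sigma_finite setT (mu \x m) by exact: product_measure_sigma_finite.
  (* A measurable inverse of consing: it pulls the exhaustion of the product back to the tuples. *)
  pose dec (z : n.+1.-tuple T) := (thead z, [tuple of behead z]).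
  have mdec : measurable_fun setT dec.
    apply/measurable_fun_pair => /=; first exact: measurable_tnth.
    exact: measurable_behead.
  exists (fun k => dec @^-1` F k).
    by rewrite -preimage_bigcup -FT preimage_setT.
  move=> k; have [mFk Fkoo] := Foo k; split.
    by rewrite -[X in measurable X]setTI; exact: mdec.
  rewrite /M /= /pushforward /=.
  rewrite [X in _ X < _](_ : _ = F k)//.
  have decK (p : T * n.-tuple T) : dec (tcons p) = p.
    by case: p => x z; congr (_, _); exact: val_inj.
  by apply/seteqP; split => p /=; rewrite decK.
pose M' := HB.pack_for {sigma_finite_measure set (n.+1.-tuple T) -> \bar R}
  (M : set _ -> \bar R) (Measure.on (M : set _ -> \bar R))
  (@Measure_isSigmaFinite.Build _ _ _ M sM).
by exists M'.
Qed.

Let tm n : set (n.-tuple T) -> \bar R := tuple_measure mu (n := n).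

Let tm0 n : tm (n := n) set0 = 0.
Proof. by rewrite /tm; have [m <-] := tuple_measure_ex n. Qed.
Let tm_ge0 n A : 0 <= tm (n := n) A.
Proof. by rewrite /tm; have [m <-] := tuple_measure_ex n. Qed.
Let tm_sigma n : semi_sigma_additive (tm (n := n)).
Proof. by rewrite /tm; have [m <-] := tuple_measure_ex n; exact: measure_semi_sigma_additive. Qed.

HB.instance Definition _ n :=
  isMeasure.Build _ _ _ (@tuple_measure d T R mu n) (@tm0 n) (@tm_ge0 n) (@tm_sigma n).

Let tm_sigma_finite n : sigma_finite setT (@tuple_measure d T R mu n).
Proof. by have [m <-] := tuple_measure_ex n; exact: sigma_finiteT. Qed.

HB.instance Definition _ n :=
  Measure_isSigmaFinite.Build _ _ _ (@tuple_measure d T R mu n) (@tm_sigma_finite n).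

Variable D : set T.
Hypothesis mD : measurable D.

Definition tuple_power n : set (n.-tuple T) := [set z | forall i, D (tnth z i)].

Lemma measurable_tuple_power n : measurable (@tuple_power n).
Proof.
have -> : @tuple_power n = \bigcap_(i in [set: 'I_n]) ((@tnth n T)^~ i @^-1` D).
  by apply/seteqP; split => z zD i; [move=> _; exact: zD|exact: zD].
apply: fin_bigcap_measurable; first exact: finite_finset.
by move=> i _; rewrite -[X in measurable X]setTI; exact: measurable_tnth.
Qed.

Lemma tuple_power_cons n x (z : n.-tuple T) :
  tuple_power [tuple of x :: z] <-> D x /\ tuple_power z.
Proof.
split=> [xz|[Dx Dz] i].
  split; first by have := xz ord0.
  by move=> i; have := xz (lift ord0 i); rewrite tnthS.
by have [j ->|->] := unliftP ord0 i; rewrite ?tnthS//; exact: Dz.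
Qed.

Lemma integral_tuple0 (f : 0.-tuple T -> \bar R) :
  measurable_fun setT f ->
  \int[tuple_measure mu (n := 0)]_(z in @tuple_power 0) f z = f (nil_tuple T).
Proof.
move=> mf; have -> : @tuple_power 0 = setT.
  by apply/seteqP; split => // z _ [].
rewrite /= integral_dirac//; by rewrite diracT mul1e.
Qed.

Lemma ge0_integral_tupleS n (f : n.+1.-tuple T -> \bar R) :
  measurable_fun (@tuple_power n.+1) f ->
  (forall z, tuple_power z -> 0 <= f z) ->
  \int[tuple_measure mu (n := n.+1)]_(z in @tuple_power n.+1) f z =
  \int[mu]_(x in D) \int[tuple_measure mu (n := n)]_(z in @tuple_power n)
     f [tuple of x :: z].
Proof.
move=> mf f0.
rewrite (@ge0_integral_pushforward _ _ _ _ _ _ (@measurable_tcons n) (mu \x tuple_measure mu (n := n))) //; last 2 first.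
  exact: measurable_tuple_power.
  by move=> z /set_mem; exact: f0.
have -> : @tcons n @^-1` @tuple_power n.+1 = D `*` @tuple_power n.
  by apply/seteqP; split => -[x z] /tuple_power_cons.
rewrite ge0_integral_prod1//.
- exact: measurable_tuple_power.
- apply: measurable_comp mf _ => //.
  + exact: measurable_tuple_power.
  + by move=> _ [[x z] [/= ? ?] <-]; apply/tuple_power_cons.
  + by apply: measurable_funTS; exact: measurable_tcons.
- by move=> x z Dx Dz; apply: f0; apply/tuple_power_cons.
Qed.

End tuple_measure_theory.

(** * Calculus *)

Section derivation_rules.
Context {R : realType}.
Implicit Types (f g : R -> R) (x a b : R).

Lemma der_cst a x : is_derive x (1 : R) (fun _ => a) 0.
Proof. exact: is_derive_cst. Qed.

Lemma der_id x : is_derive x (1 : R) (fun y => y) 1.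
Proof. exact: is_derive_id. Qed.

Lemma der_add f g x a b : is_derive x (1 : R) f a -> is_derive x (1 : R) g b ->
  is_derive x (1 : R) (fun y => f y + g y) (a + b).
Proof. by move=> df dg; exact: is_deriveD. Qed.

Lemma der_opp f x a : is_derive x (1 : R) f a ->
  is_derive x (1 : R) (fun y => - f y) (- a).
Proof. by move=> df; exact: is_deriveN. Qed.

Lemma der_mul f g x a b : is_derive x (1 : R) f a -> is_derive x (1 : R) g b ->
  is_derive x (1 : R) (fun y => f y * g y) (a * g x + f x * b).
Proof.
move=> df dg; apply: (is_derive_eq (is_deriveM df dg)).
by rewrite /GRing.scale/= addrC mulrC.
Qed.

Lemma der_inv f x a : f x != 0 -> is_derive x (1 : R) f a ->
  is_derive x (1 : R) (fun y => (f y)^-1) (- (f x ^- 2 * a)).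
Proof.
by move=> f0 df; apply: (is_derive_eq (is_deriveV f0 df)); rewrite scaleNr.
Qed.

Lemma der_exp n f x a : is_derive x (1 : R) f a ->
  is_derive x (1 : R) (fun y => f y ^+ n) (n%:R * f x ^+ n.-1 * a).
Proof.
move=> df; have := @is_deriveX R R f n x 1 a df.
by congr (is_derive _ _ _ _); apply/funext => y; rewrite exprfctE.
Qed.

Lemma der_comp h f x a b : is_derive (f x) (1 : R) h b -> is_derive x (1 : R) f a ->
  is_derive x (1 : R) (fun y => h (f y)) (b * a).
Proof. by move=> dh df; exact: is_derive1_comp. Qed.

Lemma der_expR f x a : is_derive x (1 : R) f a ->
  is_derive x (1 : R) (fun y => expR (f y)) (expR (f x) * a).
Proof. by apply: der_comp; exact: is_derive_expR. Qed.

Lemma der_sin f x a : is_derive x (1 : R) f a ->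
  is_derive x (1 : R) (fun y => sin (f y)) (cos (f x) * a).
Proof. by apply: der_comp; exact: is_derive_sin. Qed.

Lemma der_cos f x a : is_derive x (1 : R) f a ->
  is_derive x (1 : R) (fun y => cos (f y)) (- sin (f x) * a).
Proof. by apply: der_comp; exact: is_derive_cos. Qed.

Lemma der_atan f x a : is_derive x (1 : R) f a ->
  is_derive x (1 : R) (fun y => atan (f y)) ((1 + f x ^+ 2)^-1 * a).
Proof. by apply: der_comp; exact: is_derive1_atan. Qed.

Lemma der_ln f x a : 0 < f x -> is_derive x (1 : R) f a ->
  is_derive x (1 : R) (fun y => ln (f y)) ((f x)^-1 * a).
Proof. by move=> f0; apply: der_comp; exact: is_derive1_ln. Qed.

Lemma der_sqrt f x a : 0 < f x -> is_derive x (1 : R) f a ->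
  is_derive x (1 : R) (fun y => Num.sqrt (f y)) ((2 * Num.sqrt (f x))^-1 * a).
Proof. by move=> f0; apply: der_comp; exact: is_derive1_sqrt. Qed.

Lemma der_eq f x a b : is_derive x (1 : R) f a -> a = b -> is_derive x (1 : R) f b.
Proof. by move=> ? <-. Qed.

End derivation_rules.

(** The rule is chosen by the head symbol of the function body. Hypotheses come first, so that a
    function whose derivative is known in the context is not unfolded. [der_by] computes the
    derivative into an existential variable and leaves its equality with the intended one. *)
Ltac der_step := cbv beta; first [ eassumption | lazymatch goal with
  | |- is_derive _ _ (fun _ => ?c) _ => apply: der_cst
  | |- is_derive _ _ (fun y => y) _ => apply: der_id
  | |- is_derive _ _ (fun y => (@?f y + @?g y)%R) _ => eapply (@der_add _ f g)
  | |- is_derive _ _ (fun y => (- @?f y)%R) _ => eapply (@der_opp _ f)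
  | |- is_derive _ _ (fun y => (@?f y * @?g y)%R) _ => eapply (@der_mul _ f g)
  | |- is_derive _ _ (fun y => (@?f y ^+ ?n)%R) _ => eapply (@der_exp _ n f)
  | |- is_derive _ _ (fun y => (@?f y)^-1%R) _ => eapply (@der_inv _ f)
  | |- is_derive _ _ (fun y => expR (@?f y)) _ => eapply (@der_expR _ f)
  | |- is_derive _ _ (fun y => sin (@?f y)) _ => eapply (@der_sin _ f)
  | |- is_derive _ _ (fun y => cos (@?f y)) _ => eapply (@der_cos _ f)
  | |- is_derive _ _ (fun y => atan (@?f y)) _ => eapply (@der_atan _ f)
  | |- is_derive _ _ (fun y => ln (@?f y)) _ => eapply (@der_ln _ f)
  | |- is_derive _ _ (fun y => Num.sqrt (@?f y)) _ => eapply (@der_sqrt _ f)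
  end ].
Ltac der := repeat der_step; cbv beta.
Ltac der_by := eapply der_eq; [der|cbv beta].

Section calculus.
Context {R : realType}.
Notation leb := (@lebesgue_measure R).
Implicit Types (f F : R -> R) (a b : R).

Lemma is_derive_continuous F (x l : R) : is_derive x 1 F l -> {for x, continuous F}.
Proof.
move=> [dF _]; exact/differentiable_continuous/derivable1_diffP.
Qed.

Lemma integral_FTC f F a b : a <= b ->
  {within `[a, b], continuous f} -> {within `[a, b], continuous F} ->
  (forall x, a < x < b -> is_derive x 1 F (f x)) ->
  (\int[leb]_(x in `[a, b]) (f x)%:E)%E = (F b - F a)%:E.
Proof.
rewrite le_eqVlt => /predU1P[->|ab] cf cF dF.
  by rewrite set_itv1 integral_set1 subrr.
have /(continuous_within_itvP _ ab)[_ Fa Fb] := cF.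
rewrite (@continuous_FTC2 _ f F)//.
  split => //x /[!in_itv]/= xab; by have [] := dF _ xab.
by move=> x /[!in_itv]/= xab; rewrite derive1E; have [_ ->] := dF _ xab.
Qed.

Lemma integral_FTC_for f F a b : a <= b ->
  (forall x, a <= x <= b -> {for x, continuous f}) ->
  (forall x, a <= x <= b -> is_derive x 1 F (f x)) ->
  (\int[leb]_(x in `[a, b]) (f x)%:E)%E = (F b - F a)%:E.
Proof.
move=> ab cf dF; apply: integral_FTC => //.
- apply: continuous_in_subspaceT => x /[!inE]/=; rewrite in_itv/=; exact: cf.
- apply: continuous_in_subspaceT => x /[!inE]/=; rewrite in_itv/= => xab.
  exact: (is_derive_continuous (dF x xab)).
- by move=> x /andP[ax xb]; apply: dF; rewrite !ltW.
Qed.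

Lemma integral_FTCy f F a (l : R) :
  (forall x, a <= x -> 0 <= f x) ->
  (forall x, a <= x -> {for x, continuous f}) ->
  (forall x, a <= x -> is_derive x 1 F (f x)) ->
  F x @[x --> +oo] --> l ->
  (\int[leb]_(x in `[a, +oo[) (f x)%:E)%E = (l - F a)%:E.
Proof.
move=> f0 cf dF Fl; rewrite (@ge0_continuous_FTC2y _ f F _ l)//.
- apply: continuous_in_subspaceT => x /[!inE]/=; rewrite in_itv/= andbT; exact: cf.
- by move=> x /ltW ax; have [] := dF _ ax.
- have /= := is_derive_continuous (dF a (lexx a)).
  exact: cvg_at_right_filter.
- by move=> x /[!in_itv]/= /andP[/ltW ax _]; rewrite derive1E; have [_ ->] := dF _ ax.
Qed.

End calculus.

Section exponential_moments.
Context {R : realType}.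
Notation leb := (@lebesgue_measure R).

Lemma cvgy_le_inv (F : R -> R) (C : R) : (forall x, 1 <= x -> `|F x| <= C / x) ->
  F x @[x --> +oo] --> 0.
Proof.
move=> FC; apply: norm_cvg0.
apply: (@squeeze_cvgr _ _ _ _ (cst 0) (fun x => C * x^-1)); first last.
- rewrite -(mulr0 C); apply: cvgM; first exact: cvg_cst.
  apply/gtr0_cvgV0; last exact: cvg_id.
  exact: nbhs_pinfty_gt.
- exact: cvg_cst.
- near=> x; rewrite normr_ge0 /= FC//; near: x; exact: nbhs_pinfty_ge.
Unshelve. all: by end_near. Qed.

(** [(c x)^n / n!] is one term of the series of [exp (c x)]. Most dominations below go back to this
    bound. *)
Lemma exprM_expRN_le n (c x : R) : 0 < c -> 0 <= x ->
  x ^+ n * expR (- (c * x)) <= n`!%:R / c ^+ n.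
Proof.
move=> c0 x0; rewrite expRN ler_pdivrMr ?expR_gt0//.
rewrite mulrAC ler_pdivlMr ?exprn_gt0// mulrC -exprMn -ler_pdivrMl ?ltr0n ?fact_gt0//.
rewrite mulrC; case: n => [|n]; first by rewrite expr0 fact0 divr1 -expR0 ler_expR mulr_ge0// ltW.
apply: le_trans (expR_ge1Dxn n _); last by rewrite mulr_ge0// ltW.
by rewrite lerDr.
Qed.

Lemma cvgy_exprM_expRN n (c : R) : 0 < c ->
  (x ^+ n * expR (- (c * x))) @[x --> +oo] --> 0.
Proof.
move=> c0; apply: (@cvgy_le_inv _ (n.+1`!%:R / c ^+ n.+1)) => x x1.
have x0 : 0 < x by lra.
rewrite ger0_norm; last by rewrite mulr_ge0 ?expR_ge0 ?exprn_ge0// ltW.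
by rewrite ler_pdivlMr// mulrAC -exprSr exprM_expRN_le// ltW.
Qed.

(** The recursion is integration by parts. With this choice of constants the primitive tends to 0 at
    infinity, so the integral is minus its value at 0. *)
Fixpoint expRN_primitive (c : R) n (x : R) : R :=
  match n with
  | 0 => - (c^-1 * expR (- (c * x)))
  | k.+1 => (k.+1%:R / c) * expRN_primitive c k x - c^-1 * (x ^+ k.+1 * expR (- (c * x)))
  end.

Lemma is_derive_expRN_primitive (c : R) n x : c != 0 ->
  is_derive x (1 : R) (expRN_primitive c n) (x ^+ n * expR (- (c * x))).
Proof.
move=> c0; elim: n => [|n IHn] /=; first by der_by; field.
der_by.
by rewrite /= exprS; field.
Qed.

Lemma integral_exprM_expRN n (c : R) : 0 < c ->
  (\int[leb]_(x in `[0%R, +oo[) (x ^+ n * expR (- (c * x)))%:E =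
   (n`!%:R / c ^+ n.+1)%:E)%E.
Proof.
move=> c0; have cn0 : c != 0 by rewrite gt_eqF.
have lim0 m : expRN_primitive c m x @[x --> +oo] --> 0.
  elim: m => [|m IHm] /=.
    rewrite -oppr0 -[X in - X](mulr0 c^-1); apply: cvgN; apply: cvgM; first exact: cvg_cst.
    have := @cvgy_exprM_expRN 0 _ c0.
    by under eq_fun do rewrite expr0 mul1r.
  rewrite -[X in _ --> X]subr0 -[X in X - _](mulr0 (m.+1%:R / c)) -[X in _ - X](mulr0 c^-1).
  apply: cvgB; apply: cvgM => //; try exact: cvg_cst.
  exact: cvgy_exprM_expRN.
have f0 x : 0 <= x -> 0 <= x ^+ n * expR (- (c * x)).
  by move=> x0; rewrite mulr_ge0 ?exprn_ge0 ?expR_ge0.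
have cf (x : R) : {for x, continuous (fun x : R => x ^+ n * expR (- (c * x)))}.
  have : is_derive x (1 : R) (fun x => x ^+ n * expR (- (c * x)))
      (n%:R * x ^+ n.-1 * 1 * expR (- (c * x)) + x ^+ n * (expR (- (c * x)) * - (0 * x + c * 1))).
    by der.
  exact: is_derive_continuous.
rewrite (integral_FTCy f0 (fun x _ => cf x)
  (fun x _ => is_derive_expRN_primitive n x cn0) (lim0 n)).
congr (_%:E); rewrite sub0r; elim: {f0 cf} n => [|n IHn] /=.
  by rewrite mulr0 oppr0 expR0 mulr1 opprK fact0 expr1 mul1r.
rewrite expr0n/= mul0r mulr0 subr0 -mulrN IHn factS natrM !exprS.
by field; rewrite cn0 expf_neq0.
Qed.

End exponential_moments.

Lemma mem_itv_set (R : realType) (i : interval R) (x : R) :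
  (x \in [set` i]) =
  let: Interval l u := i in
  match l with
  | BSide b lb => lb < x ?<= if b | BInfty b => b end &&
  match u with
  | BSide b ub => x < ub ?<= if ~~ b | BInfty b => ~~ b end.
Proof. by rewrite -in_itv; apply/idP/idP => [/set_mem|?]//; exact: mem_set. Qed.

(* No measurability is needed: a nonnegative integral is a supremum over simple
   functions. *)
Lemma ge0_le_integral_nonmeasurable d (T : measurableType d) (R : realType)
    (mu : {measure set T -> \bar R}) (D : set T) (f1 f2 : T -> \bar R) :
  (forall x, D x -> 0 <= f1 x)%E -> (forall x, D x -> f1 x <= f2 x)%E ->
  (\int[mu]_(x in D) f1 x <= \int[mu]_(x in D) f2 x)%E.
Proof.
move=> f10 f12; rewrite integral_mkcond [leRHS]integral_mkcond.
have g1 x : (0 <= (f1 \_ D) x)%E.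
  by rewrite patchE; case: ifPn => // /set_mem; exact: f10.
have g12 x : ((f1 \_ D) x <= (f2 \_ D) x)%E.
  by rewrite !patchE; case: ifPn => // /set_mem; exact: f12.
rewrite !ge0_integralTE//; last by move=> x; exact: le_trans (g12 x).
apply: le_ereal_sup => _ [h hf1 <-].
by exists h => // x; exact: le_trans (hf1 x) (g12 x).
Qed.

Section layer_cake.
Context d (T : measurableType d) (R : realType).
Variable mu : {sigma_finite_measure set T -> \bar R}.
Notation leb := (@lebesgue_measure R).
Local Open Scope ereal_scope.

(** [K (V z)] is the integral of [k] over [[0, V z]], hence of [k v] times the indicator of
    [v < V z] over the half-line; Tonelli exchanges the two integrals. *)
Lemma layer_cake (D : set T) (V : T -> R) (k K : R -> R) : measurable D ->
  measurable_fun D V -> (forall z, D z -> (0 <= V z)%R) ->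
  (forall v, (0 <= v)%R -> (0 <= k v)%R) -> continuous k ->
  (forall v : R, is_derive v (1 : R)%R K (k v)) -> K 0%R = 0%R ->
  \int[mu]_(z in D) (K (V z))%:E =
  \int[leb]_(v in `[0%R, +oo[) ((k v)%:E * mu (D `&` [set z | (v < V z)%R])).
Proof.
move=> mD mV V0 k0 ck dK K0.
pose J : set R := `[0%R, +oo[%classic.
have mJ : measurable J by exact: measurable_itv.
pose A : set (T * R) := [set p | (p.2 < V p.1)%R].
pose g (p : T * R) := (k p.2 * \1_A p)%:E.
have mA : measurable ((D `*` J) `&` A).
  have : measurable_fun (D `*` J) (fun p : T * R => (p.2 < V p.1)%R).
    apply: measurable_fun_ltr; first exact: measurable_funTS.
    apply: (measurable_comp mD) => //; last exact: measurable_funTS.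
    by move=> _ [[x y] [? ?] <-].
  move=> /(_ (measurableX mD mJ) [set true] I).
  by congr measurable; apply/seteqP; split => p [Dp] /=.
have mg : measurable_fun (D `*` J) g.
  apply/measurable_EFinP; apply: measurable_funM.
    apply: measurable_funTS; apply: measurableT_comp => //.
    exact: continuous_measurable_fun.
  apply: (eq_measurable_fun (\1_((D `*` J) `&` A) : (T * R)%type -> R)).
    move=> p /set_mem Dp; rewrite !indicE; congr (_%:R); congr nat_of_bool.
    by apply/idP/idP => /set_mem h; apply/mem_set; [case: h|split].
  exact: measurable_funTS.
have g0 x y : D x -> J y -> 0 <= g (x, y).
  move=> _; rewrite /J/= in_itv/= andbT => y0.
  by rewrite lee_fin mulr_ge0//; exact: k0.
transitivity (\int[mu]_(z in D) \int[leb]_(v in J) g (z, v)).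
  apply: eq_integral => z /set_mem Dz; have Vz := V0 _ Dz.
  have -> : (K (V z))%:E = \int[leb]_(v in `[0%R, V z]) (k v)%:E.
    by rewrite (integral_FTC_for (F := K)) ?K0 ?subr0// => x /andP[x0 _]; exact: ck.
  (* The right end is dropped because the superlevel sets are strict. *)
  rewrite -integral_itv_bndo_bndc; last first.
    apply/measurable_EFinP; apply: measurable_funTS; exact: continuous_measurable_fun.
  rewrite integral_mkcond [RHS]integral_mkcond; apply: eq_integral => v _.
  rewrite !patchE /J !mem_itv_set/= andbT /g indicE.
  have [v0|] //= := leP 0%R v; case: ifPn => vV.
    by rewrite (_ : (z, v) \in A) ?mulr1//; exact: mem_set.
  by rewrite (_ : _ \in A = false) ?mulr0//; apply/negbTE/negP => /set_mem; exact/negP.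
rewrite ge0_integral_swap//.
apply: eq_integral => v; rewrite mem_itv_set/= andbT => v0.
have mDv : measurable (D `&` [set z | (v < V z)%R]).
  have := measurable_fun_ltr (measurable_cst v) mV.
  by move=> /(_ mD [set true] I); congr measurable.
rewrite [LHS](_ : _ = \int[mu]_(z in D) ((k v)%:E * (\1_(D `&` [set z | (v < V z)%R]) z)%:E)).
  rewrite ge0_integralZl_EFin//; last 2 first.
    by apply/measurable_EFinP; exact: measurable_funTS.
    exact: k0.
  by rewrite integral_indic// -setIA setIC -setIA setIid setIC.
apply: eq_integral => z /set_mem Dz; rewrite /g -EFinM !indicE; congr ((_ * _%:R)%:E).
by congr nat_of_bool; apply/idP/idP => /set_mem h; apply/mem_set; [split|case: h].
Qed.

End layer_cake.

(** * Areas in the plane *)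

Section planar.
Context {R : realType}.
Notation leb := (@lebesgue_measure R).
Notation plane := (measurableTypeR R * measurableTypeR R)%type.
Local Open Scope ereal_scope.

HB.instance Definition _ := Measure.on (@planar_measure R).
HB.instance Definition _ := Measure_isSigmaFinite.Build _ _ _ (@planar_measure R)
  (product_measure_sigma_finite (@lebesgue_measure R) (@lebesgue_measure R)).

Lemma ge0_integral_shift (c : R) (f : R -> \bar R) :
  measurable_fun setT f -> (forall x, 0 <= f x) ->
  \int[leb]_x f (x + c)%R = \int[leb]_x f x.
Proof.
move=> mf f0.
have mc : measurable_fun setT (fun x : measurableTypeR R => (x + c)%R : measurableTypeR R).
  exact: measurable_funD.
transitivity (\int[pushforward leb (fun x : measurableTypeR R => (x + c)%R : measurableTypeR R)]_x f x).
  by rewrite ge0_integral_pushforward// preimage_setT.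
apply: eq_measure_integral => A mA _; apply/esym.
pose M0 : {measure set (measurableTypeR R) -> \bar R} :=
  pushforward leb (fun x : measurableTypeR R => (x + c)%R : measurableTypeR R).
apply: (lebesgue_measure_unique (mu := M0 mc)) => //= _ [[a b]] _ <-.
rewrite /pushforward.
rewrite (_ : _ @^-1` _ = [set` `]a - c, b - c]%R]); last first.
  by apply/seteqP; split => x /=; rewrite !in_itv/= ltrBlDr lerBrDr.
by rewrite !lebesgue_measure_itv/= !lte_fin ltrD2r -!EFinD; congr (if _ then _%:E else _); ring.
Qed.

Lemma measurable_planar_linear (a b c d : R) :
  measurable_fun setT (fun z : plane => (a * z.1 + b * z.2, c * z.1 + d * z.2)%R : plane).
Proof.
by apply/measurable_fun_pair; apply: measurable_funD; apply: measurable_funM.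
Qed.

(** A shear translates each horizontal slice, so Tonelli reduces the claim to translation invariance
    on the line. *)
Lemma ge0_integral_shear1 (p : R) (f : plane -> \bar R) :
  measurable_fun setT f -> (forall z, 0 <= f z) ->
  \int[@planar_measure R]_z f (z.1 + p * z.2, z.2)%R = \int[@planar_measure R]_z f z.
Proof.
move=> mf f0.
have mg : measurable_fun setT (fun z : plane => f (z.1 + p * z.2, z.2)%R).
  apply: measurableT_comp => //.
  have := measurable_planar_linear 1 p 0 1.
  by congr measurable_fun; apply/funext => z; rewrite !mul1r mul0r add0r.
rewrite /planar_measure -!setXTT.
rewrite !ge0_integral_prod2 ?setXTT//.
apply: eq_integral => y _.
rewrite (ge0_integral_shift (p * y) (f := fun x => f (x, y)))//.
by apply: measurableT_comp => //; exact: measurable_pair2.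
Qed.

Lemma ge0_integral_shear2 (p : R) (f : plane -> \bar R) :
  measurable_fun setT f -> (forall z, 0 <= f z) ->
  \int[@planar_measure R]_z f (z.1, z.2 + p * z.1)%R = \int[@planar_measure R]_z f z.
Proof.
move=> mf f0.
have mg : measurable_fun setT (fun z : plane => f (z.1, z.2 + p * z.1)%R).
  apply: measurableT_comp => //.
  have := measurable_planar_linear 1 0 p 1.
  by congr measurable_fun; apply/funext => z; rewrite !mul1r mul0r addr0 addrC.
rewrite /planar_measure -!setXTT.
rewrite !ge0_integral_prod1 ?setXTT//.
apply: eq_integral => x _.
rewrite (ge0_integral_shift (p * x) (f := fun y => f (x, y)))//.
by apply: measurableT_comp => //; exact: measurable_pair1.
Qed.

Definition rotate (c s : R) (z : plane) : plane :=
  (c * z.1 + (- s) * z.2, s * z.1 + c * z.2)%R.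

Lemma measurable_rotate c s : measurable_fun setT (rotate c s).
Proof. exact: measurable_planar_linear. Qed.

(** A rotation with [s != 0] is a product of three shears. The half-turn, the nontrivial case of
    [s = 0], is the square of a quarter-turn. *)
Lemma ge0_integral_rotate (c s : R) (f : plane -> \bar R) :
  (c ^+ 2 + s ^+ 2 = 1)%R ->
  measurable_fun setT f -> (forall z, 0 <= f z) ->
  \int[@planar_measure R]_z f (rotate c s z) = \int[@planar_measure R]_z f z.
Proof.
wlog s0 : c s f / s != 0%R.
  move=> wlg cs mf f0; have [s0|] := eqVneq s 0%R; last by move=> s0; exact: wlg.
  have : (c == 1)%R || (c == -1)%R.
    by rewrite -eqf_sqr expr1n -cs s0 expr0n addr0.
  case/orP => /eqP ->.
    apply: eq_integral => -[x y] _; congr f.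
    by rewrite /rotate s0/=; congr (_, _); ring.
  have n10 : (1 : R)%R != 0%R by exact: oner_neq0.
  have e01 : (0 ^+ 2 + 1 ^+ 2 = 1 :> R)%R by rewrite expr0n expr1n add0r.
  rewrite -(wlg _ _ _ n10 e01 mf f0).
  rewrite -(wlg _ _ (fun z => f (rotate 0 1 z)) n10 e01)//; last first.
    exact: measurableT_comp (measurable_rotate _ _).
  apply: eq_integral => -[x y] _; congr f.
  by rewrite /rotate s0/=; congr (_, _); ring.
(* [p] is minus the tangent of half the angle: the horizontal shear of coefficient [p] is applied
   before and after the vertical one of coefficient [s]. *)
move=> cs mf f0; pose p := ((c - 1) / s)%R.
pose sh1 (z : plane) : plane := (z.1 + p * z.2, z.2)%R.
pose sh2 (z : plane) : plane := (z.1, z.2 + s * z.1)%R.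
have m1 : measurable_fun setT sh1.
  have := measurable_planar_linear 1 p 0 1.
  by congr measurable_fun; apply/funext => z; rewrite !mul1r mul0r add0r.
have m2 : measurable_fun setT sh2.
  have := measurable_planar_linear 1 0 s 1.
  by congr measurable_fun; apply/funext => z; rewrite !mul1r mul0r addr0 addrC.
rewrite -(ge0_integral_shear1 p mf f0).
rewrite -(ge0_integral_shear2 s (f := fun z => f (sh1 z)))//; last first.
  exact: measurableT_comp.
rewrite -(ge0_integral_shear1 p (f := fun z => f (sh1 (sh2 z))))//; last first.
  by do 2 apply: measurableT_comp => //.
apply: eq_integral => -[x y] _; congr f; rewrite /rotate /sh1 /sh2 /=.
have ps : (p * s = c - 1)%R by rewrite /p divfK.
have pcs : (p * c = - s - p)%R.
  apply: (mulfI s0); rewrite mulrA (mulrC s p) ps mulrBr mulrN (mulrC s p) ps.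
  by move: cs; rewrite !expr2 => cs; lra.
congr (_, _).
  rewrite (_ : x + p * y + p * (y + s * (x + p * y)) =
    x + 2 * (p * y) + (p * s) * x + (p * s) * (p * y))%R; last by ring.
  by rewrite ps; rewrite (_ : (c - 1) * (p * y) = (p * c) * y - p * y)%R; [rewrite pcs; ring|ring].
by rewrite (_ : y + s * (x + p * y) = y + s * x + (p * s) * y)%R; [rewrite ps; ring|ring].
Qed.

End planar.

Section planar_area.
Context {R : realType}.
Notation leb := (@lebesgue_measure R).
Notation plane := (measurableTypeR R * measurableTypeR R)%type.
Notation area := (@planar_measure R).
Implicit Types (h : R -> R) (c r x y : R).

Lemma sqr_ltr_sqrt x y : (x ^+ 2 < y) = (`|x| < Num.sqrt y).
Proof.
have [y0|y0] := leP y 0.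
  rewrite (ler0_sqrtr y0) (ltNge `|x|) normr_ge0 /=; apply/negbTE.
  by rewrite -leNgt (le_trans y0) ?sqr_ge0.
by rewrite -sqrtr_sqr ltr_sqrt.
Qed.

Lemma area_slices h : measurable_fun setT h ->
  (area [set z | (z.2 ^+ 2 < h z.1)%R] = \int[leb]_x (2 * Num.sqrt (h x))%:E)%E.
Proof.
move=> mh; rewrite /planar_measure /product_measure1.
apply: eq_integral => x _ /=.
rewrite (_ : xsection _ _ = `]- Num.sqrt (h x), Num.sqrt (h x)[%classic); last first.
  by apply/seteqP; split => y; rewrite /xsection/= inE/= in_itv/= sqr_ltr_sqrt ltr_norml.
rewrite lebesgue_measure_itv/= lte_fin.
case: ifPn => [_|]; first by rewrite -EFinD; congr (_%:E); ring.
rewrite -leNgt => h0; congr (_%:E); have := sqrtr_ge0 (h x); lra.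
Qed.

Definition circ c r x := Num.sqrt (r ^+ 2 - (x - c) ^+ 2).

(** With [w = circ c r x], this is the usual primitive [(x - c) w + r^2 arcsin ((x - c) / r)] of
    [2 w]. Writing the arcsine through the tangent of its half keeps it continuous at the endpoints,
    where [w] vanishes. *)
Definition circ_primitive c r x :=
  (x - c) * circ c r x + 2 * r ^+ 2 * atan ((x - c) / (r + circ c r x)).

Lemma continuous_circ c r : continuous (circ c r).
Proof.
move=> x; apply: (@continuous_comp _ _ _ (fun x => r ^+ 2 - (x - c) ^+ 2) Num.sqrt).
  by apply: cvgB; [exact: cvg_cst|apply: cvgM; apply: cvgB => //; exact: cvg_cst].
exact: sqrt_continuous.
Qed.

Lemma continuous_circ_primitive c r : 0 < r -> continuous (circ_primitive c r).
Proof.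
move=> r0 x.
have cs : {for x, continuous (fun x => x - c)} by apply: cvgB => //; exact: cvg_cst.
apply: cvgD.
  by apply: cvgM => //; exact: continuous_circ.
apply: cvgM; first exact: cvg_cst.
apply: (@continuous_comp _ _ _ (fun x => (x - c) / (r + circ c r x)) atan); last exact: continuous_atan.
apply: cvgM => //; apply: cvgV; last by apply: cvgD; [exact: cvg_cst|exact: continuous_circ].
by rewrite gt_eqF// ltr_wpDr// sqrtr_ge0.
Qed.

Lemma is_derive_circ_primitive c r x : 0 < r -> c - r < x < c + r ->
  is_derive x (1 : R) (circ_primitive c r) (2 * circ c r x).
Proof.
move=> r0 xr.
have w2 : 0 < r ^+ 2 - (x - c) ^+ 2 by nra.
have w0 : 0 < circ c r x by rewrite sqrtr_gt0.
have w2E : circ c r x ^+ 2 = r ^+ 2 - (x - c) ^+ 2 by rewrite sqr_sqrtr// ltW.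
have rw : r + circ c r x != 0 by rewrite gt_eqF// addr_gt0.
have dw : is_derive x (1 : R) (circ c r) (- (x - c) / circ c r x).
  by rewrite /circ; der_by => //=; field; rewrite gt_eqF.
rewrite /circ_primitive; der_by => //=.
by field: w2E; rewrite rw gt_eqF//= gt_eqF// ltr_wpDr ?sqr_ge0// exprn_gt0// addr_gt0.
Qed.

Lemma integral_circ c r p q : 0 < r -> c - r <= p -> p <= q -> q <= c + r ->
  (\int[leb]_(x in `[p, q]) (2 * circ c r x)%:E =
   (circ_primitive c r q - circ_primitive c r p)%:E)%E.
Proof.
move=> r0 cp pq qc; apply: integral_FTC => //.
- apply: continuous_subspaceT => x; apply: cvgM; first exact: cvg_cst.
  exact: continuous_circ.
- by apply: continuous_subspaceT; exact: continuous_circ_primitive.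
- by move=> x /andP[px xq]; apply: is_derive_circ_primitive => //; lra.
Qed.

Lemma integral_support (f : R -> \bar R) (A : set R) p q :
  [set` `[p, q]] `<=` A -> (forall x, A x -> ~~ (p <= x <= q) -> f x = 0%E) ->
  (\int[leb]_(x in A) f x = \int[leb]_(x in `[p, q]) f x)%E.
Proof.
move=> sub f0; rewrite integral_mkcond [RHS]integral_mkcond.
apply: eq_integral => x _; rewrite !patchE mem_itv_set/=.
case: ifPn => [/set_mem Ax|xA].
  by case: ifPn => // xpq; rewrite f0.
case: ifPn => // xpq; move: xA => /negP; case.
by apply/mem_set/sub; rewrite /= in_itv.
Qed.

Lemma circ_out c r x : 0 < r -> ~~ (c - r <= x <= c + r) -> circ c r x = 0.
Proof. move=> r0 xr; apply: ler0_sqrtr; move: xr; rewrite negb_and -!ltNge; nra. Qed.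

Lemma area_disc (s : R) : 0 < s ->
  area [set z | z.1 ^+ 2 + z.2 ^+ 2 < s ^+ 2] = (pi * s ^+ 2)%:E.
Proof.
move=> s0.
have -> : [set z : plane | z.1 ^+ 2 + z.2 ^+ 2 < s ^+ 2] =
          [set z : plane | z.2 ^+ 2 < (fun x => s ^+ 2 - (x - 0) ^+ 2) z.1].
  by apply/seteqP; split => z /=; rewrite subr0 ltrBrDl.
rewrite (area_slices (h := fun x => s ^+ 2 - (x - 0) ^+ 2)); last first.
  by apply: measurable_funB => //; apply: measurable_funX; exact: measurable_funB.
rewrite (@integral_support _ _ (0 - s) (0 + s))//; last first.
  by move=> x _ xs; rewrite -/(circ 0 s x) circ_out// mulr0.
rewrite integral_circ//; last by lra.
congr (_%:E); rewrite /circ_primitive /circ.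
have e (u : R) : u ^+ 2 = s ^+ 2 -> s ^+ 2 - u ^+ 2 = 0 by move=> ->; rewrite subrr.
rewrite !e ?sqrtr0 ?addr0; last 2 first.
  by ring.
  by ring.
have sN1 : - s / s = - 1 by rewrite mulNr divff// gt_eqF.
rewrite !add0r !subr0 sN1 divff ?gt_eqF// atanN atan1; by field.
Qed.

Lemma atan_onem (e : R) : 0 < e ->
  atan ((1 - e) / (1 + e)) = pi / 4 - atan e.
Proof.
move=> e0; have ce x : cos (atan x : R) != 0.
  by rewrite gt_eqF// cos_gt0_pihalf// atan_gtNpi2 atan_ltpi2.
have pi4 : pi / 4 = atan 1 :> R by rewrite atan1.
have -> : (1 - e) / (1 + e) = tan (pi / 4 - atan e).
  rewrite tanD ?pi4 -?atanN// !atanK; congr (_ / _); ring.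
rewrite tanK// in_itv/=; apply/andP; split.
  by have := atan_ltpi2 e; have := pi_gt0 R; lra.
have : 0 < atan e by rewrite -atan0 lt_atan.
by have := pi_gt0 R; lra.
Qed.

(* [c = coth a], [r = 1 / sinh a] for [e = exp (- a)]: the inequality on [z]
   says that [ln (|1 + z| / |1 - z|) > a], a disc orthogonal to the unit one. *)
Lemma area_lens (e : R) : 0 < e < 1 ->
  let r := 2 * e / (1 - e ^+ 2) in
  area [set z | z.1 ^+ 2 + z.2 ^+ 2 < 1 /\
    (1 - z.1) ^+ 2 + z.2 ^+ 2 < e ^+ 2 * ((1 + z.1) ^+ 2 + z.2 ^+ 2)] =
  (2 * atan e + (pi / 2 - 2 * atan e) * r ^+ 2 - r)%:E.
Proof.
move=> /andP[e0 e1] r; pose c := (1 + e ^+ 2) / (1 - e ^+ 2).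
have d0 : 0 < 1 - e ^+ 2 by nra.
have r0 : 0 < r by rewrite divr_gt0//; lra.
have c1 : 1 < c by rewrite /c ltr_pdivlMr//; nra.
have rc : r ^+ 2 = c ^+ 2 - 1 by rewrite /r /c; field; rewrite gt_eqF.
(* The circles cross at abscissa [t]: as [r^2 = c^2 - 1], the equation [1 - x^2 = r^2 - (x - c)^2]
   reduces to [c x = 1]. The circle of centre [c] bounds the lens to the left of [t], the unit
   circle to its right. *)
pose t := c^-1; have t0 : 0 < t by rewrite invr_gt0; lra.
have ct : c * t = 1 by rewrite divff// gt_eqF//; lra.
pose h (x : R) := Num.min (1 - x ^+ 2) (r ^+ 2 - (x - c) ^+ 2).
have -> : [set z : plane | z.1 ^+ 2 + z.2 ^+ 2 < 1 /\
    (1 - z.1) ^+ 2 + z.2 ^+ 2 < e ^+ 2 * ((1 + z.1) ^+ 2 + z.2 ^+ 2)] =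
    [set z : plane | z.2 ^+ 2 < h z.1].
  have key (x y : R) : ((1 - x) ^+ 2 + y ^+ 2 < e ^+ 2 * ((1 + x) ^+ 2 + y ^+ 2)) =
      (y ^+ 2 < r ^+ 2 - (x - c) ^+ 2).
    rewrite -subr_gt0 -[in RHS]subr_gt0 rc.
    rewrite (_ : _ - y ^+ 2 = (e ^+ 2 * ((1 + x) ^+ 2 + y ^+ 2) - ((1 - x) ^+ 2 + y ^+ 2)) / (1 - e ^+ 2)).
      by rewrite pmulr_lgt0// invr_gt0.
    by rewrite /c; field; rewrite gt_eqF.
  have key1 (x y : R) : (x ^+ 2 + y ^+ 2 < 1) = (y ^+ 2 < 1 - x ^+ 2).
    by rewrite ltrBrDl.
  apply/seteqP; split => z /=; rewrite key key1 /h lt_min.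
    by move=> [-> ->].
  by move=> /andP[].
have mh : measurable_fun setT h.
  by apply: measurable_minr; apply: measurable_funB => //; apply: measurable_funX => //;
    exact: measurable_funB.
rewrite (area_slices (h := h))//.
have hlt x : x <= t -> Num.sqrt (h x) = circ c r x.
  move=> xt; congr Num.sqrt; apply/min_idPr; rewrite rc; nra.
have hgt x : t <= x -> Num.sqrt (h x) = circ 0 1 x.
  move=> xt; congr Num.sqrt; rewrite subr0 expr1n; apply/min_idPl; rewrite rc; nra.
have tc : c - r <= t.
  rewrite /t /c /r invf_div -mulrBl ler_pdivrMr// mulrAC ler_pdivlMr; last by nra.
  have : 0 <= 2 * e * (1 - e) ^+ 2 by rewrite mulr_ge0 ?sqr_ge0//; lra.
  lra.
have t1 : t < 1 by nra.
have mf : measurable_fun [set: R] (fun x => (2 * Num.sqrt (h x))%:E).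
  apply/measurable_EFinP; apply: measurable_funM => //.
  apply: measurableT_comp => //.
  by apply: continuous_measurable_fun; exact: sqrt_continuous.
rewrite (_ : [set: R] = `]-oo, t]%classic `|` `]t, +oo[%classic); last first.
  apply/seteqP; split => // x _ /=; rewrite !in_itv/= andbT.
  by case: (leP x t) => ?; [left|right].
rewrite ge0_integral_setU//; last 2 first.
- exact: measurable_funTS mf.
- rewrite disj_set2E; apply/eqP; rewrite -subset0 => x [] /=; rewrite !in_itv/= andbT; lra.
rewrite integral_itv_obnd_cbnd; last exact: measurable_funTS mf.
rewrite (@integral_support _ `]-oo, t] (c - r) t); last 2 first.
- by move=> x /=; rewrite !in_itv/= => /andP[].
- move=> x /=; rewrite !in_itv/= => xt xc; rewrite hlt// circ_out ?mulr0//.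
  by move: xc; rewrite xt andbT => /negbTE ->.
rewrite (@integral_support _ `[t, +oo[ t 1); last 2 first.
- by move=> x /=; rewrite !in_itv/= andbT => /andP[].
- move=> x /=; rewrite !in_itv/= andbT => xt xc; rewrite hgt// circ_out ?mulr0//.
  by move: xc; rewrite xt/= => /negbTE x1; rewrite !add0r x1 andbF.
have -> : (\int[leb]_(x in `[(c - r)%R, t]) (2 * Num.sqrt (h x))%:E =
    \int[leb]_(x in `[(c - r)%R, t]) (2 * circ c r x)%:E)%E.
  by apply: eq_integral => x; rewrite mem_itv_set/= => /andP[_ ?]; rewrite hlt.
have -> : (\int[leb]_(x in `[t, 1%R]) (2 * Num.sqrt (h x))%:E =
    \int[leb]_(x in `[t, 1%R]) (2 * circ 0 1 x)%:E)%E.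
  by apply: eq_integral => x; rewrite mem_itv_set/= => /andP[? _]; rewrite hgt.
rewrite (@integral_circ c r)//; last by lra.
rewrite (@integral_circ 0 1)//; [|by lra|by lra|by lra].
rewrite -EFinD; congr (_%:E).
have s0 : 0 < 1 + e ^+ 2 by nra.
have n1 : 1 - e ^+ 2 != 0 by rewrite gt_eqF.
have n2 : 1 + e ^+ 2 != 0 by rewrite gt_eqF.
have n3 : 1 + e != 0 by rewrite gt_eqF// addr_gt0.
pose w := 2 * e / (1 + e ^+ 2).
have w0 : 0 < w by rewrite divr_gt0//; lra.
have tE : t = (1 - e ^+ 2) / (1 + e ^+ 2) by rewrite /t /c invf_div.
have circ1 : circ c r t = w.
  rewrite /circ (_ : _ - _ = w ^+ 2) ?sqrtr_sqr ?gtr0_norm//.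
  by rewrite tE /c /r /w; field; rewrite n1 n2.
have circ2 : circ 0 1 t = w.
  rewrite /circ (_ : _ - _ = w ^+ 2) ?sqrtr_sqr ?gtr0_norm//.
  by rewrite tE /w; field.
have circ3 : circ c r (c - r) = 0.
  by rewrite /circ (_ : _ - _ = 0) ?sqrtr0//; ring.
have circ4 : circ 0 1 1 = 0 :> R.
  by rewrite /circ (_ : _ - _ = 0) ?sqrtr0//; ring.
rewrite /circ_primitive circ1 circ2 circ3 circ4.
have -> : (t - c) / (r + w) = - e.
  rewrite tE /c /r /w; field; rewrite n1 n2 /=.
  rewrite (_ : _ + _ = 4 * e); last by ring.
  by rewrite mulf_neq0// gt_eqF.
have -> : (c - r - c) / (r + 0) = -1.
  by rewrite addr0 addrAC subrr add0r mulNr divff// gt_eqF.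
have -> : (1 - 0) / (1 + 0) = 1 :> R by rewrite subr0 addr0 divr1.
have -> : (t - 0) / (1 + w) = (1 - e) / (1 + e).
  rewrite tE /w; field; rewrite n3 n2 /=.
  rewrite (_ : _ + _ = (1 + e) ^+ 2); last by ring.
  by rewrite expf_neq0.
rewrite atan_onem ?e0// !atanN atan1.
by rewrite tE /c /r /w; field; rewrite n1 n2.
Qed.

End planar_area.

(** * Measurability through real and imaginary parts *)

Section complex_measurability.
Context d (T : measurableType d) {R : realType}.
Implicit Types (D : set T) (f g : T -> R[i]).

Definition measurable_complex D f :=
  measurable_fun D (fun x => complex.Re (f x)) /\ measurable_fun D (fun x => complex.Im (f x)).

Lemma measurable_complex_cst D (c : R[i]) : measurable_complex D (fun=> c).
Proof. by split; exact: measurable_cst. Qed.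

Lemma measurable_complexD D f g : measurable_complex D f -> measurable_complex D g ->
  measurable_complex D (fun x => f x + g x).
Proof.
move=> [mf1 mf2] [mg1 mg2]; split.
- rewrite (_ : (fun x => _) = (fun x => complex.Re (f x)) \+ (fun x => complex.Re (g x))).
    exact: measurable_funD.
  by apply/funext => x /=; case: (f x) => ? ?; case: (g x).
- rewrite (_ : (fun x => _) = (fun x => complex.Im (f x)) \+ (fun x => complex.Im (g x))).
    exact: measurable_funD.
  by apply/funext => x /=; case: (f x) => ? ?; case: (g x).
Qed.

Lemma measurable_complexM D f g : measurable_complex D f -> measurable_complex D g ->
  measurable_complex D (fun x => f x * g x).
Proof.
move=> [mf1 mf2] [mg1 mg2]; split.
- rewrite (_ : (fun x => _) = (fun x => complex.Re (f x)) \* (fun x => complex.Re (g x))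
      \- (fun x => complex.Im (f x)) \* (fun x => complex.Im (g x))).
    by apply: measurable_funB; exact: measurable_funM.
  by apply/funext => x /=; case: (f x) => ? ?; case: (g x).
- rewrite (_ : (fun x => _) = (fun x => complex.Re (f x)) \* (fun x => complex.Im (g x))
      \+ (fun x => complex.Im (f x)) \* (fun x => complex.Re (g x))).
    by apply: measurable_funD; exact: measurable_funM.
  by apply/funext => x /=; case: (f x) => ? ?; case: (g x).
Qed.

Lemma measurable_complexX D f n : measurable_complex D f ->
  measurable_complex D (fun x => f x ^+ n).
Proof.
move=> mf; elim: n => [|n IHn]; first exact: measurable_complex_cst.
rewrite (_ : (fun x => _) = (fun x => f x * f x ^+ n)).
  exact: measurable_complexM.
by apply/funext => x; rewrite exprS.
Qed.

Lemma measurable_complexN D f : measurable_complex D f ->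
  measurable_complex D (fun x => - f x).
Proof.
move=> mf; rewrite (_ : (fun x => _) = (fun x => -1 * f x)).
  by apply: measurable_complexM => //; exact: measurable_complex_cst.
by apply/funext => x; rewrite mulN1r.
Qed.

Lemma measurable_normc D f : measurable_complex D f ->
  measurable_fun D (fun x => Normc.normc (f x)).
Proof.
move=> [mf1 mf2].
rewrite (_ : (fun x => _) = Num.sqrt \o (fun x => complex.Re (f x) ^+ 2 + complex.Im (f x) ^+ 2)).
  apply: measurableT_comp.
    by apply: continuous_measurable_fun; exact: sqrt_continuous.
  by apply: measurable_funD; exact: measurable_funX.
by apply/funext => x /=; case: (f x).
Qed.

End complex_measurability.

Section normc_theory.
Context {R : realType}.
Implicit Types x y : R[i].
Local Notation normc := (@Normc.normc R).

Lemma normc_ge0 x : 0 <= normc x.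
Proof. by case: x => a b; exact: sqrtr_ge0. Qed.

Lemma normc_gt0 x : (0 < normc x) = (x != 0).
Proof.
rewrite lt_def normc_ge0 andbT; congr negb; apply/eqP/eqP => [/Normc.eq0_normc//|->].
exact: Normc.normc0.
Qed.

Lemma normcX x n : normc (x ^+ n) = normc x ^+ n.
Proof.
by elim: n => [|n IHn]; rewrite ?expr0 ?Normc.normc1// !exprS Normc.normcM IHn.
Qed.

Lemma ler_normc_sub x y : normc x - normc y <= normc (x - y).
Proof. by rewrite lerBlDr -{1}[x](subrK y) complex.le_normcD. Qed.

Lemma normc_sub_sym x y : normc (x - y) = normc (y - x).
Proof. by rewrite -(normcN (x - y)) opprB. Qed.

End normc_theory.

Section unit_disc.
Context {R : realType}.
Notation leb := (@lebesgue_measure R).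
Notation plane := (measurableTypeR R * measurableTypeR R)%type.
Notation area := (@planar_measure R).
Notation disc := (@unit_disc R).
Local Notation normc := (@Normc.normc R).

Definition modulus (z : plane) : R := normc (to_complex z).

Lemma modulusE (z : plane) : modulus z = Num.sqrt (z.1 ^+ 2 + z.2 ^+ 2).
Proof. by []. Qed.

Lemma modulus_ge0 (z : plane) : 0 <= modulus z. Proof. exact: normc_ge0. Qed.

Lemma measurable_to_complex : measurable_complex setT (@to_complex R).
Proof. by split; [exact: measurable_fst|exact: measurable_snd]. Qed.

Lemma measurable_modulus : measurable_fun setT modulus.
Proof. exact: (measurable_normc measurable_to_complex). Qed.

Lemma modulus_lt (s : R) (z : plane) : 0 < s ->
  (modulus z < s) = (z.1 ^+ 2 + z.2 ^+ 2 < s ^+ 2).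
Proof.
move=> s0; rewrite modulusE -[s in LHS]gtr0_norm// -sqrtr_sqr ltr_sqrt//.
by rewrite exprn_gt0.
Qed.

Lemma measurable_modulus_lt (s : R) : measurable [set z : plane | modulus z < s].
Proof.
have := measurable_fun_ltr measurable_modulus (measurable_cst s).
by move=> /(_ measurableT [set true] I); rewrite setTI; congr measurable.
Qed.

Lemma unit_discE (z : plane) : disc z = (modulus z < 1) :> Prop.
Proof. by []. Qed.

Lemma measurable_unit_disc : measurable (disc : set plane).
Proof. exact: (measurable_modulus_lt 1). Qed.

Lemma area_modulus_lt (s : R) : 0 < s ->
  area [set z | modulus z < s] = (pi * s ^+ 2)%:E.
Proof.
move=> s0; rewrite -area_disc//; congr (area _).
by apply/seteqP; split => z /=; rewrite modulus_lt.
Qed.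

Lemma area_unit_disc : area disc = (pi : R)%:E.
Proof. by have := @area_modulus_lt 1 ltr01; rewrite expr1n mulr1. Qed.

(** Linearity in [s] is the point: it makes the logarithm of the distance to a circle integrable.
    For [s < rho] the annulus has area [4 pi rho s]; otherwise it lies in a disc of radius at most
    [2 s], and [s <= 1] turns [s^2] into [s]. *)
Lemma area_annulus (rho s : R) : 0 < rho -> 0 < s <= 1 ->
  (area [set z | (`|rho - modulus z| < s)%R] <= (4 * pi * (rho + 1) * s)%:E)%E.
Proof.
move=> rho0 /andP[s0 s1]; have p0 := pi_gt0 R.
have mA : measurable [set z : plane | `|rho - modulus z| < s].
  have : measurable_fun setT (fun z : plane => `|rho - modulus z| < s).
    apply: measurable_fun_ltr => //; apply: measurableT_comp => //.
    by apply: measurable_funB => //; exact: measurable_modulus.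
  by move=> /(_ measurableT [set true] I); rewrite setTI; congr measurable.
have [srho|rhos] := ltP s rho; last first.
  apply: (@le_trans _ _ (area [set z | (modulus z < rho + s)%R])).
    apply: le_measure; rewrite ?inE//; first exact: measurable_modulus_lt.
    by move=> z /=; rewrite ltr_norml; lra.
  rewrite area_modulus_lt ?addr_gt0// lee_fin.
  have : (rho + s) ^+ 2 <= 4 * (rho + 1) * s by nra.
  by move=> /(ler_wpM2l (ltW p0)) h; apply: le_trans h _; lra.
have Bsub : [set z : plane | modulus z < rho - s] `<=` [set z | modulus z < rho + s].
  by move=> z /=; lra.
apply: (@le_trans _ _ (area ([set z | (modulus z < rho + s)%R] `\`
    [set z | (modulus z < rho - s)%R]))).
  apply: le_measure; rewrite ?inE//.
    by apply: measurableD; exact: measurable_modulus_lt.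
  by move=> z /=; rewrite ltr_norml => /andP[h1 h2]; split; [lra|apply/negP; rewrite -leNgt; lra].
rewrite measureD ?setIidr//; try exact: measurable_modulus_lt.
  change (area [set z | (modulus z < rho + s)%R] -
    area [set z | (modulus z < rho - s)%R] <= (4 * pi * (rho + 1) * s)%:E)%E.
  have ps : 0 <= pi * s by rewrite mulr_ge0 // ltW.
  by rewrite !area_modulus_lt; [rewrite -EFinB lee_fin; lra|lra|lra].
change (area [set z | (modulus z < rho + s)%R] < +oo)%E.
by rewrite area_modulus_lt ?addr_gt0// ltry.
Qed.

Lemma negligible_circle (rho : R) : 0 < rho ->
  area.-negligible [set z | modulus z = rho].
Proof.
move=> rho0.
have mA : measurable [set z : plane | modulus z = rho].
  by have := measurable_modulus measurableT (measurable_set1 rho); rewrite setTI.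
exists [set z | modulus z = rho]; split => //; apply/eqP.
rewrite eq_le measure_ge0 andbT; apply/lee_addgt0Pr => e e0; rewrite add0e.
have p0 := pi_gt0 R.
pose s := Num.min 1 (e / (4 * pi * (rho + 1))).
have c0 : 0 < 4 * pi * (rho + 1) by rewrite !mulr_gt0// addr_gt0.
have s0 : 0 < s by rewrite lt_min ltr01 divr_gt0.
apply: (@le_trans _ _ (area [set z | (`|rho - modulus z| < s)%R])).
  apply: le_measure; rewrite ?inE//.
    have : measurable_fun setT (fun z : plane => `|rho - modulus z| < s).
      apply: measurable_fun_ltr => //; apply: measurableT_comp => //.
      by apply: measurable_funB => //; exact: measurable_modulus.
    by move=> /(_ measurableT [set true] I); rewrite setTI; congr measurable.
  by move=> z /= ->; rewrite subrr normr0.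
apply: (le_trans (area_annulus rho0 _)); first by rewrite s0 ge_min lexx.
by rewrite lee_fin mulrC -ler_pdivlMr// ge_min lexx orbT.
Qed.

Lemma negligible_origin : area.-negligible [set z | modulus z = 0].
Proof.
have mA : measurable [set z : plane | modulus z = 0].
  by have := measurable_modulus measurableT (measurable_set1 0); rewrite setTI.
exists [set z | modulus z = 0]; split => //; apply/eqP.
rewrite eq_le measure_ge0 andbT; apply/lee_addgt0Pr => e e0; rewrite add0e.
have p0 := pi_gt0 R.
have s0 : 0 < Num.sqrt (e / pi) by rewrite sqrtr_gt0 divr_gt0.
apply: (@le_trans _ _ (area [set z | (modulus z < Num.sqrt (e / pi))%R])).
  apply: le_measure; rewrite ?inE//; first exact: measurable_modulus_lt.
  by move=> z /= ->.
rewrite area_modulus_lt// sqr_sqrtr; last by rewrite ltW// divr_gt0.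
by rewrite mulrCA divff ?mulr1// gt_eqF.
Qed.

End unit_disc.

(** * Jensen's formula on the disc *)

Section jensen.
Context {R : realType}.
Notation leb := (@lebesgue_measure R).
Notation plane := (measurableTypeR R * measurableTypeR R)%type.
Notation area := (@planar_measure R).
Notation disc := (@unit_disc R).
Local Notation normc := (@Normc.normc R).

(** The integrand exceeds [v] only within distance [exp (- v)] of the circle, a set of area
    [O(exp (- v))]; the layer-cake formula concludes. *)
Lemma integrable_ln_distance (rho : R) : 0 < rho ->
  area.-integrable disc (EFin \o (fun u => Num.max 0 (- ln `|rho - modulus u|))).
Proof.
move=> rho0; pose V (u : plane) := Num.max 0 (- ln `|rho - modulus u|).
have mV : measurable_fun setT V.
  apply: measurable_maxr => //; apply: measurable_funN.
  apply: measurableT_comp => //; apply: measurableT_comp => //.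
  by apply: measurable_funB => //; exact: measurable_modulus.
have mVD := measurable_funTS (D := disc) mV.
have V0 u : 0 <= V u by rewrite le_max lexx.
apply/integrableP; split; first exact/measurable_EFinP.
rewrite [ltLHS](_ : _ = \int[area]_(u in disc) (V u)%:E)%E; last first.
  by apply: eq_integral => u _; rewrite /= -/(V u) ger0_norm.
have -> : (\int[area]_(u in disc) (V u)%:E)%E =
    (\int[leb]_(v in `[0%R, +oo[) ((1%:E) * area (disc `&` [set u | (v < V u)%R])))%E.
  apply: (@layer_cake _ _ _ area disc V (fun=> 1) (fun v => v)) => //.
  - exact: measurable_unit_disc.
  - by move=> v; exact: cvg_cst.
have p0 := pi_gt0 R.
apply: (@le_lt_trans _ _ (\int[leb]_(v in `[0%R, +oo[)
    (4 * pi * (rho + 1) * (v ^+ 0 * expR (- (1 * v))))%:E)%E).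
  apply: ge0_le_integral_nonmeasurable => [v _|]; first by rewrite mul1e.
  move=> v; rewrite /= in_itv/= andbT => v0.
  rewrite mul1e expr0 !mul1r.
  apply: le_trans (area_annulus (s := expR (- v)) rho0 _); last first.
    by rewrite expR_gt0/= -expR0 ler_expR oppr_le0.
  apply: le_measure; rewrite ?inE.
  - have := measurable_fun_ltr (measurable_cst v) mVD.
    by move=> /(_ measurable_unit_disc [set true] I); congr measurable.
  - have : measurable_fun setT (fun z : plane => `|rho - modulus z| < expR (- v)).
      apply: measurable_fun_ltr => //; apply: measurableT_comp => //.
      by apply: measurable_funB => //; exact: measurable_modulus.
    by move=> /(_ measurableT [set true] I); rewrite setTI; congr measurable.
  - move=> u [_ /=]; rewrite /V lt_max ltNge v0/= ltrNr => lnv.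
    have [->|d0] := eqVneq `|rho - modulus u| 0; first exact: expR_gt0.
    by rewrite -[ltLHS]lnK ?ltr_expR// posrE lt_def d0 normr_ge0.
under eq_integral do rewrite EFinM.
rewrite ge0_integralZl_EFin//; last 3 first.
- by move=> v; rewrite /= in_itv/= andbT => v0; rewrite lee_fin expr0 mul1r expR_ge0.
- apply/measurable_EFinP; apply: measurable_funM => //.
  by apply: measurable_funTS; apply: measurableT_comp => //; apply: measurable_funN; exact: measurable_funM.
- by rewrite !mulr_ge0// ?ltW// addr_gt0.
by rewrite integral_exprM_expRN// -EFinM ltry.
Qed.

(** For [c] above [ln n] this is nonnegative and takes the value [+oo] at the zeros, so Tonelli and
    rotation invariance apply before any integrability is known. *)
Definition hlog (c n : R) : \bar R := if n == 0 then +oo%E else (c - ln n)%:E.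

Lemma hlogE (c n : R) : 0 <= n -> hlog c n = (c%:E - lne n%:E)%E.
Proof.
rewrite le_eqVlt /hlog => /predU1P[<-|n0]; first by rewrite eqxx le0_lneNy.
by rewrite gt_eqF// lne_EFin.
Qed.

Lemma measurable_hlog c : measurable_fun setT (hlog c).
Proof.
apply: measurable_fun_ifT => //=.
  exact: measurable_fun_eqr.
by apply/measurable_EFinP; apply: measurable_funB => //; exact: measurable_ln.
Qed.

Lemma hlog_ge0 (c n : R) : 0 <= n -> n <= expR c -> (0 <= hlog c n)%E.
Proof.
rewrite /hlog le_eqVlt => /predU1P[<-|n0] nc; first by rewrite eqxx.
by rewrite gt_eqF// lee_fin subr_ge0 -(expRK c) ler_ln ?posrE ?expR_gt0.
Qed.

Lemma hlogM (c m n : R) : 0 <= m -> 0 <= n ->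
  (hlog (c + c) (m * n) = hlog c m + hlog c n)%E.
Proof.
rewrite /hlog le_eqVlt => /predU1P[<-|m0].
  by rewrite mul0r eqxx; case: ifPn.
rewrite le_eqVlt => /predU1P[<-|n0]; first by rewrite mulr0 eqxx (gt_eqF m0).
by rewrite !gt_eqF ?mulr_gt0// lnM// -EFinD; congr (_%:E); ring.
Qed.

Lemma ge0_integral_disc_rotate (c s : R) (f : plane -> \bar R) :
  c ^+ 2 + s ^+ 2 = 1 -> measurable_fun disc f -> (forall z, disc z -> (0 <= f z)%E) ->
  (\int[area]_(z in disc) f (rotate c s z) = \int[area]_(z in disc) f z)%E.
Proof.
move=> cs mf f0; rewrite integral_mkcond [RHS]integral_mkcond.
have mD := @measurable_unit_disc R.
rewrite -[RHS](ge0_integral_rotate cs); last 2 first.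
- exact/(measurable_restrictT _ mD).
- by move=> z; rewrite patchE; case: ifPn => // /set_mem; exact: f0.
apply: eq_integral => z _; rewrite !patchE; congr (if _ then _ else _).
have mE : modulus (rotate c s z) = modulus z.
  rewrite !modulusE /rotate /=; congr Num.sqrt.
  have s2 : s ^+ 2 = 1 - c ^+ 2 by lra.
  by ring: s2.
have E : disc (rotate c s z) <-> disc z.
  by rewrite !unit_discE mE.
by apply/idP/idP => /set_mem h; apply/mem_set/E.
Qed.

(** Repeated square roots of -1. Rotating [u] by such a [w] turns [a^n - (b u)^n] into
    [a^n + (b u)^n] for [n = 2^k]. *)
Lemma exists_root_N1 k : exists w : R[i], w ^+ (2 ^ k) = -1 /\ normc w = 1.
Proof.
elim: k => [|k [w [wk w1]]].
  by exists (-1); rewrite expr1 normcN Normc.normc1.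
exists (sqrtc w); rewrite expnS exprM sqr_sqrtc wk; split => //.
apply/eqP; rewrite -(@pexpr_eq1 _ _ 2) ?normc_ge0// -normcX sqr_sqrtc w1.
by [].
Qed.

Lemma to_complex_rotate (w : R[i]) (z : plane) :
  to_complex (rotate (complex.Re w) (complex.Im w) z) = w * to_complex z.
Proof.
case: w => a b; case: z => x y; rewrite /rotate /to_complex /=.
by apply/eqP; rewrite eq_complex/= mulNr (addrC (b * x)) !eqxx.
Qed.

(** As [(y / x)^n <= y / x], the hypotheses give [x^n (1 - y / x) <= N <= 2 x^n]; take logarithms
    and divide by [n]. *)
Lemma ln_exprn_bounds (x y N : R) n : 0 <= y -> y < x -> (0 < n)%N ->
  x ^+ n - y ^+ n <= N -> N <= x ^+ n + y ^+ n ->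
  0 < N /\ ln x + n%:R^-1 * ln (1 - y / x) <= n%:R^-1 * ln N <= ln x + n%:R^-1 * ln 2.
Proof.
move=> y0 yx n0 N1 N2; have x0 : 0 < x by exact: le_lt_trans yx.
have q0 : 0 <= y / x by rewrite divr_ge0// ltW.
have q1 : y / x < 1 by rewrite ltr_pdivrMr// mul1r.
have yE : y = x * (y / x) by rewrite mulrC divfK// gt_eqF.
have xn0 : 0 < x ^+ n by rewrite exprn_gt0.
have qn : (y / x) ^+ n <= y / x.
  by case: n n0 {N1 N2 xn0} => // n _; rewrite exprS ler_piMr// exprn_ile1// ltW.
have N1' : x ^+ n * (1 - y / x) <= N.
  apply: le_trans N1; rewrite [in leRHS]yE exprMn mulrBr mulr1 lerD2l lerN2.
  by rewrite ler_pM2l.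
have N2' : N <= x ^+ n * 2.
  apply: le_trans N2 _; rewrite mulr_natr mulr2n lerD2l.
  by rewrite lerXn2r ?nnegrE// ltW.
have l0 : 0 < x ^+ n * (1 - y / x) by rewrite mulr_gt0// subr_gt0.
have N0 : 0 < N by exact: lt_le_trans N1'.
have nR : 0 < n%:R :> R by rewrite ltr0n.
split=> //.
have e z : ln x + n%:R^-1 * z = n%:R^-1 * (n%:R * ln x + z).
  by rewrite mulrDr mulKf// gt_eqF.
have lnx : n%:R * ln x = ln (x ^+ n) by rewrite lnXn// mulr_natl.
rewrite !e !ler_pM2l ?invr_gt0// lnx -!lnM ?posrE ?subr_gt0//.
by rewrite !ler_ln ?posrE// ?N1'// mulr_gt0.
Qed.

Section radial_average.
Variables (a b : R[i]) (c : R).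
Hypotheses (a0 : a != 0) (b0 : b != 0) (abc : normc a + normc b <= expR c).

Let N k (u : plane) := normc (a ^+ (2 ^ k) - (b * to_complex u) ^+ (2 ^ k)).
Let H k (u : plane) := hlog (2 ^+ k * c) (N k u).

Let mN k : measurable_fun setT (N k).
Proof.
apply: measurable_normc; apply: measurable_complexD; first exact: measurable_complex_cst.
apply: measurable_complexN; apply: measurable_complexX.
apply: measurable_complexM; first exact: measurable_complex_cst.
exact: measurable_to_complex.
Qed.

Let mH k : measurable_fun setT (H k).
Proof. exact: (measurableT_comp (measurable_hlog _) (mN k)). Qed.

Lemma normc_expD_le (x y : R[i]) n : (0 < n)%N -> normc (x ^+ n) + normc (y ^+ n) <= (normc x + normc y) ^+ n.
Proof.
move=> n0; rewrite !normcX.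
elim: n n0 => // n IHn _; case: n IHn => [_|n IHn]; first by rewrite !expr1.
have := IHn isT; set p := normc x; set q := normc y => IH.
have p0 : 0 <= p := normc_ge0 _; have q0 : 0 <= q := normc_ge0 _.
apply: (@le_trans _ _ ((p + q) * (p ^+ n.+1 + q ^+ n.+1))).
  rewrite mulrDl !mulrDr -!exprS.
  have := mulr_ge0 p0 (exprn_ge0 n.+1 q0); have := mulr_ge0 q0 (exprn_ge0 n.+1 p0); lra.
by rewrite [leRHS]exprS ler_wpM2l// addr_ge0.
Qed.

Let N_le k u (y : R[i]) : disc u ->
  normc y = normc ((b * to_complex u) ^+ (2 ^ k)) ->
  normc (a ^+ (2 ^ k) + y) <= expR (2 ^+ k * c).
Proof.
move=> Du yE; apply: le_trans (le_normcD _ _) _; rewrite yE.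
apply: le_trans (normc_expD_le a (b * to_complex u) _) _; first by rewrite expn_gt0.
rewrite -natrX expRM_natl lerXn2r ?nnegrE ?expR_ge0 ?addr_ge0 ?normc_ge0//.
apply: le_trans abc; rewrite lerD2l Normc.normcM ler_piMr ?normc_ge0//.
exact: ltW.
Qed.

Let Hrot k : exists2 w : R[i], normc w = 1 & forall u,
  H k (rotate (complex.Re w) (complex.Im w) u) =
  hlog (2 ^+ k * c) (normc (a ^+ (2 ^ k) + (b * to_complex u) ^+ (2 ^ k))).
Proof.
have [w [wk w1]] := exists_root_N1 k; exists w => // u.
rewrite /H /N to_complex_rotate; congr (hlog _ (normc _)).
by rewrite mulrCA exprMn wk mulN1r opprK.
Qed.

Let unit_cs (w : R[i]) : normc w = 1 -> complex.Re w ^+ 2 + complex.Im w ^+ 2 = 1.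
Proof.
case: w => x y /= /(congr1 (fun t => t ^+ 2)).
by rewrite sqr_sqrtr ?addr_ge0 ?sqr_ge0// expr1n.
Qed.

Let Nrot_le k u : disc u -> N k u <= expR (2 ^+ k * c).
Proof. by move=> Du; apply: N_le Du _; rewrite normcN. Qed.

Let H0 k u : disc u -> (0 <= H k u)%E.
Proof. by move=> Du; apply: hlog_ge0; [exact: normc_ge0|exact: Nrot_le]. Qed.

Let HS k u : H k.+1 u =
  (H k u + hlog (2 ^+ k * c)%R (normc (a ^+ (2 ^ k) + (b * to_complex u) ^+ (2 ^ k))%R))%E.
Proof.
rewrite /H /N -hlogM ?normc_ge0// -Normc.normcM; congr (hlog _ (normc _)).
  by rewrite exprS; ring.
by rewrite expnS mulnC !exprM; ring.
Qed.

(** [a^(2n) - (b u)^(2n)] is the product of [a^n - (b u)^n] and [a^n + (b u)^n], and the second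
    factor is the first one rotated. *)
Let int_HS k : (\int[area]_(u in disc) H k.+1 u =
  \int[area]_(u in disc) H k u + \int[area]_(u in disc) H k u)%E.
Proof.
have [w w1 wE] := Hrot k.
under eq_integral do rewrite HS -wE.
have mD := @measurable_unit_disc R.
have wD u : disc u -> disc (rotate (complex.Re w) (complex.Im w) u).
  by rewrite !unit_discE /modulus to_complex_rotate Normc.normcM w1 mul1r.
have mHD := measurable_funTS (D := disc) (mH k).
have mHrot : measurable_fun disc
    (fun u => H k (rotate (complex.Re w) (complex.Im w) u)).
  by apply: measurable_funTS; exact: measurableT_comp (mH k) (measurable_rotate _ _).
rewrite (ge0_integralD area mD (fun u Du => H0 k Du) mHD
  (fun u Du => H0 k (wD u Du)) mHrot).
by rewrite (ge0_integral_disc_rotate (unit_cs w1) mHD (fun u Du => H0 k Du)).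
Qed.

Let int_HE k : (\int[area]_(u in disc) ((2 ^- k)%R%:E * H k u) =
  \int[area]_(u in disc) H 0 u)%E.
Proof.
have mD := @measurable_unit_disc R.
have mHD j := measurable_funTS (D := disc) (mH j).
elim: k => [|k <-]; first by under eq_integral do rewrite expr0 invr1 mul1e.
rewrite !ge0_integralZl_EFin ?invr_ge0 ?exprn_ge0//; try by move=> u; exact: H0.
have : (0 <= \int[area]_(u in disc) H k u)%E by apply: integral_ge0 => u; exact: H0.
(* Finiteness of this integral is not known yet, so the value [+oo] is treated as well. *)
rewrite int_HS; case: (\int[area]_(u in disc) H k u)%E => [B _| _|//].
  by rewrite -EFinD -!EFinM exprS; congr (_%:E); field; rewrite expf_neq0.
by rewrite addye// !gt0_muley ?lte_fin ?invr_gt0 ?exprn_gt0.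
Qed.

(* [ln (max |a| |b u|)], up to the null sets where the convergence is not proved. *)
Let L u := 2^-1 * (ln (normc a) + ln (normc b) + ln (modulus u)) +
  2^-1 * `|ln (normc a) - ln (normc b) - ln (modulus u)|.

Let N_lim u : modulus u != 0 -> normc a != normc b * modulus u ->
  (forall k, 0 < N k u /\
     ln `|normc a - normc b * modulus u| <= 2 ^- k * ln (N k u)) /\
  2 ^- k * ln (N k u) @[k --> \oo] --> L u.
Proof.
move=> u0 ne.
have na : 0 < normc a by rewrite normc_gt0.
have nb : 0 < normc b by rewrite normc_gt0.
have nu : 0 < modulus u by rewrite lt_def u0 modulus_ge0.
have nbu : 0 < normc b * modulus u by rewrite mulr_gt0.
(* The two moduli play symmetric roles: [x] stands for the larger one and [y] for the smaller. *)
suff main (x y : R) : 0 < y -> y < x -> (forall k, x ^+ (2 ^ k) - y ^+ (2 ^ k) <= N k u) ->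
    (forall k, N k u <= x ^+ (2 ^ k) + y ^+ (2 ^ k)) ->
    (forall k, 0 < N k u /\ ln (x - y) <= 2 ^- k * ln (N k u)) /\
    2 ^- k * ln (N k u) @[k --> \oo] --> ln x.
  have nN k : normc ((b * to_complex u) ^+ (2 ^ k)) = (normc b * modulus u) ^+ (2 ^ k).
    by rewrite normcX Normc.normcM.
  have Nup k : N k u <= normc a ^+ (2 ^ k) + (normc b * modulus u) ^+ (2 ^ k).
    by apply: le_trans (le_normcD _ _) _; rewrite normcN nN normcX.
  have [lt|gt|] := ltgtP (normc a) (normc b * modulus u); last by move/eqP; rewrite (negbTE ne).
  - have -> : L u = ln (normc b * modulus u).
      have : ln (normc a) < ln (normc b * modulus u) by rewrite ltr_ln ?posrE.
      rewrite /L lnM ?posrE// => h; rewrite ltr0_norm; lra.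
    rewrite ler0_norm ?subr_le0 1?ltW// opprB; apply: main => // k.
    + rewrite /N normc_sub_sym; apply: le_trans (ler_normc_sub _ _).
      by rewrite nN normcX.
    + by rewrite addrC.
  - have -> : L u = ln (normc a).
      have : ln (normc b * modulus u) < ln (normc a) by rewrite ltr_ln ?posrE.
      rewrite /L lnM ?posrE// => h; rewrite gtr0_norm; lra.
    rewrite gtr0_norm ?subr_gt0//; apply: main => // k.
    by apply: le_trans (ler_normc_sub _ _); rewrite nN normcX.
move=> y0 yx lo up.
have x0 : 0 < x by exact: lt_trans yx.
have q1 : 0 < 1 - y / x by rewrite subr_gt0 ltr_pdivrMr// mul1r.
have B k : 0 < N k u /\ ln x + 2 ^- k * ln (1 - y / x) <= 2 ^- k * ln (N k u) <= ln x + 2 ^- k * ln 2.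
  have k2 : (0 < 2 ^ k)%N by rewrite expn_gt0.
  by have := ln_exprn_bounds (ltW y0) yx k2 (lo k) (up k); rewrite natrX.
split=> [k|].
  (* [ln (1 - y / x)] is nonpositive, so dividing it by [2^k] only increases it. This lower bound is
     uniform in [k], as domination requires. *)
  have [N0 /andP[B1 _]] := B k; split=> //; apply: le_trans B1.
  have -> : x - y = x * (1 - y / x) by rewrite mulrBr mulr1 mulrCA divff ?mulr1// gt_eqF.
  rewrite lnM ?posrE// lerD2l.
  have l0 : ln (1 - y / x) <= 0.
    by apply: ln_le0; rewrite gerBl divr_ge0// ltW.
  have k1 : 2 ^- k <= 1 :> R by rewrite invf_le1 ?exprn_gt0// exprn_ege1// ler1n.
  nra.
have lim0 z : ln x + 2 ^- k * z @[k --> \oo] --> ln x.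
  rewrite -[X in _ --> X]addr0 -[X in _ --> _ + X](mul0r z).
  apply: cvgD; first exact: cvg_cst.
  apply: cvgM; last exact: cvg_cst.
  under eq_fun do rewrite -exprVn.
  apply: cvg_expr; rewrite ger0_norm ?invr_ge0//; lra.
apply: squeeze_cvgr (lim0 (ln (1 - y / x))) (lim0 (ln 2)).
by apply: nearW => k; have [_] := B k.
Qed.

(* For [n = 2^k], rotation invariance under the roots of [-1] of order [2, 4, ..., n]
   replaces [ln |a + b u|] by [ln |a^n - (b u)^n| / n], which tends to
   [ln (max |a| |b u|)] and is dominated through [ln | |a| - |b u| |]. *)
Lemma integral_disc_hlog :
  (\int[area]_(u in disc) hlog c (normc (a + b * to_complex u)%R) =
   \int[area]_(u in disc) (c - L u)%R%:E)%E.
Proof.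
have mD := @measurable_unit_disc R.
have mHD j := measurable_funTS (D := disc) (mH j).
have na : 0 < normc a by rewrite normc_gt0.
have nb : 0 < normc b by rewrite normc_gt0.
pose rho := normc a / normc b.
have rho0 : 0 < rho by rewrite divr_gt0.
have rhoE u : normc a - normc b * modulus u = normc b * (rho - modulus u).
  by rewrite /rho mulrBr mulrCA divff ?mulr1// gt_eqF.
(* [K + V] will dominate, because [ln | |a| - |b u| |] is [ln |b| + ln |rho - |u||]. *)
pose V u := Num.max 0 (- ln `|rho - modulus u|).
pose K := `|c - ln (normc b)|.
pose f_ k u := ((2 ^- k)%:E * H k u)%E.
pose good u := modulus u != 0 /\ modulus u != rho.
have ae_good (P : plane -> Prop) : (forall u, good u -> P u) -> {ae area, forall u, P u}.
  move=> gP; change (area.-negligible (~` [set u | P u])).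
  apply: negligibleS (negligibleU negligible_origin (negligible_circle rho0)).
  move=> u /= nP; apply: contrapT => /not_orP[h1 h2]; apply/nP/gP.
  by split; apply/eqP.
have good_ne u : good u -> normc a != normc b * modulus u.
  move=> [_ h]; rewrite -subr_eq0 rhoE mulf_eq0 gt_eqF//= subr_eq0 eq_sym.
  exact: h.
have f_E k u : good u -> f_ k u = (c - 2 ^- k * ln (N k u))%:E.
  move=> gu; have [/(_ k)[N0 _] _] := N_lim gu.1 (good_ne _ gu).
  rewrite /f_ /H /hlog gt_eqF// -EFinM; congr (_%:E).
  by rewrite mulrBr mulKf// expf_neq0.
have mL : measurable_fun disc (fun u => (c - L u)%:E).
  have ml : measurable_fun disc (fun u => ln (modulus u)).
    by apply: measurable_funTS; apply: measurableT_comp => //; exact: measurable_modulus.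
  apply/measurable_EFinP; apply: measurable_funB => //; apply: measurable_funD.
    by apply: measurable_funM => //; exact: measurable_funD.
  by apply: measurable_funM => //; apply: measurableT_comp => //; exact: measurable_funB.
have mf_ k : measurable_fun disc (f_ k) by apply: emeasurable_funM.
have fin_area : (area disc < +oo)%E by rewrite area_unit_disc ltry.
have ig : area.-integrable disc (fun u => (K + V u)%:E).
  rewrite (_ : (fun u => _) = (fun=> K%:E) \+ (EFin \o V))%E; last first.
    by apply/funext => u.
  apply: integrableD => //; last exact: integrable_ln_distance.
  by apply/integrableP; split => //; rewrite integral_cst//= lte_mul_pinfty.
have [||_ _ +] := @dominated_convergence _ _ _ area disc mD f_ (fun u => (c - L u)%:E)
    (fun u => (K + V u)%:E) mf_ mL _ ig _.
- apply: ae_good => u gu Du.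
  have [_ h] := N_lim gu.1 (good_ne _ gu).
  under eq_fun do rewrite f_E//.
  by apply/fine_cvgP; split; [exact: nearW|apply: cvgB => //; exact: cvg_cst].
- apply: ae_good => u gu k Du.
  have f0 : (0 <= f_ k u)%E by rewrite mule_ge0 ?lee_fin ?invr_ge0 ?exprn_ge0//; exact: H0.
  rewrite gee0_abs// f_E// lee_fin.
  have [/(_ k)[N0 lo] _] := N_lim gu.1 (good_ne _ gu).
  have rn : 0 < `|rho - modulus u| by rewrite normr_gt0 subr_eq0 eq_sym; have [] := gu.
  move: lo; rewrite rhoE normrM gtr0_norm// lnM ?posrE// => lo.
  have := ler_norm (c - ln (normc b)); rewrite -/K.
  have : - ln `|rho - modulus u| <= V u by rewrite le_max lexx orbT.
  lra.
(* By [int_HE] the sequence of integrals is constant, hence equal to its limit. *)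
rewrite (_ : [sequence _]_n = fun=> (\int[area]_(u in disc) H 0 u)%E); last first.
  by apply/funext => k /=; rewrite int_HE.
move=> /(cvg_unique _ (@cvg_cst _ _ _ _ _)) <-//.
(* [H 0] concerns [a - b u]; a half-turn of [u] gives [a + b u]. *)
have [w w1 wE] := Hrot 0.
rewrite -(ge0_integral_disc_rotate (unit_cs w1) (mHD 0%N) (fun u Du => H0 0 Du)).
by apply: eq_integral => u _; rewrite wE !expr0 !expn0 !expr1 mul1r.
Qed.

End radial_average.
End jensen.

(** * Integrable functions together with the value of their integral *)

Section has_integral.
Context d (T : measurableType d) (R : realType).
Variables (mu : {measure set T -> \bar R}) (D : set T).
Hypothesis mD : measurable D.
Implicit Types (f g : T -> R) (v w r : R).

(** Integrability and value are kept together so that linear combinations transport both, and values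
    become real numbers on which [ring] and [field] operate. *)
Definition has_integral f v :=
  mu.-integrable D (EFin \o f) /\ (\int[mu]_(x in D) (f x)%:E = v%:E)%E.

Lemma has_integral_eq f g v : has_integral f v ->
  (forall x, D x -> f x = g x) -> has_integral g v.
Proof.
move=> [intf fv] fg; split.
  by apply: eq_integrable intf => // x /set_mem Dx /=; rewrite fg.
by rewrite -fv; apply: eq_integral => x /set_mem Dx; rewrite fg.
Qed.

Lemma has_integralD f g v w : has_integral f v -> has_integral g w ->
  has_integral (fun x => f x + g x) (v + w).
Proof.
move=> [intf fv] [intg gw]; split.
  have := integrableD mD intf intg; apply: eq_integrable => //.
by rewrite EFinD -fv -gw -integralD_EFin.
Qed.

Lemma has_integralZ f v r : has_integral f v -> has_integral (fun x => r * f x) (r * v).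
Proof.
move=> [intf fv]; split.
  have := integrableZl mD r intf; apply: eq_integrable => //.
by rewrite EFinM -fv -integralZl//; apply: eq_integral.
Qed.

Lemma has_integralB f g v w : has_integral f v -> has_integral g w ->
  has_integral (fun x => f x - g x) (v - w).
Proof.
move=> hf /(has_integralZ (-1)) hg; have := has_integralD hf hg.
by rewrite mulN1r => h; apply: (has_integral_eq h) => x _; rewrite mulN1r.
Qed.

Lemma has_integral_sum (I : Type) (s : seq I) (F : I -> T -> R) (V : I -> R) :
  (forall i, has_integral (F i) (V i)) ->
  has_integral (fun x => \sum_(i <- s) F i x) (\sum_(i <- s) V i).
Proof.
move=> h; elim: s => [|i s IHs].
  rewrite big_nil; split.
    apply: eq_integrable (integrable0 mu D) => // x _ /=; by rewrite big_nil.
  by rewrite integral0_eq// => x _; rewrite big_nil.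
rewrite big_cons; apply: (has_integral_eq (has_integralD (h i) IHs)) => x _.
by rewrite big_cons.
Qed.

Lemma ge0_has_integral f v : measurable_fun D f -> (forall x, D x -> 0 <= f x) ->
  (\int[mu]_(x in D) (f x)%:E = v%:E)%E -> has_integral f v.
Proof.
move=> mf f0 fv; split=> //; apply/integrableP; split; first exact/measurable_EFinP.
rewrite (_ : (\int[mu]_(x in D) _)%E = v%:E) ?ltry// -fv.
by apply: eq_integral => x /set_mem Dx /=; rewrite ger0_norm// f0.
Qed.

Lemma integrable_has_integral f : mu.-integrable D (EFin \o f) ->
  exists v, has_integral f v.
Proof.
move=> intf; exists (fine (\int[mu]_(x in D) (f x)%:E)%E); split=> //.
by rewrite fineK//; exact: integrable_fin_num.
Qed.

Lemma has_integral_measurable f v : has_integral f v -> measurable_fun D f.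
Proof. by move=> [/integrableP[/measurable_EFinP]]. Qed.

Lemma has_integral_unique f v w : has_integral f v -> has_integral f w -> v = w.
Proof. by move=> [_ fv] [_]; rewrite fv => -[]. Qed.

Variable M : R.
Hypothesis muD : mu D = M%:E.

Lemma has_integral_cst r : has_integral (fun=> r) (r * M).
Proof.
have ci (k : \bar R) : (\int[mu]_(x in D) k = k * mu D)%E by exact: integral_cst.
split; last by rewrite ci muD.
apply/integrableP; split; first exact: measurable_cst.
by rewrite /= ci muD -EFinM ltry.
Qed.

Lemma bounded_has_integral f B : measurable_fun D f -> (forall x, D x -> `|f x| <= B) ->
  exists v, has_integral f v.
Proof.
move=> mf fB; apply: integrable_has_integral.
apply: measurable_bounded_integrable => //; first by rewrite muD ltry.
exists B; split; first exact: num_real.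
by move=> C BC x Dx; apply: le_trans (fB x Dx) (ltW BC).
Qed.

End has_integral.

(** * Independent copies: coordinates and sums on a product space *)

Section tuple_integral.
Context d (T : measurableType d) (R : realType).
Variables (mu : {sigma_finite_measure set T -> \bar R}) (D : set T) (M : R).
Hypotheses (mD : measurable D) (muD : mu D = M%:E).
Notation tmu n := (@tuple_measure d T R mu n).
Notation Dn n := (@tuple_power d T D n).

Let mDn n : measurable (Dn n). Proof. exact: measurable_tuple_power. Qed.

Lemma tuple_measure_power n : tmu n (Dn n) = (M ^+ n)%:E.
Proof.
elim: n => [|n IHn].
  have := @integral_tuple0 _ _ _ mu D (cst 1%E) (measurable_cst _).
  by rewrite integral_cst ?mul1e ?expr0//; exact: mDn.
have ci (k : \bar R) : (\int[tmu n]_(z in Dn n) k = k * (M ^+ n)%:E)%E.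
  by rewrite -IHn; exact: (@integral_cst _ _ _ (tmu n) (Dn n) (@mDn n) k).
have e01 z : Dn n.+1 z -> (0 <= cst (1 : \bar R) z)%E by move=> _; exact: lee01.
have := ge0_integral_tupleS mu mD (measurable_cst 1%E) e01.
rewrite (_ : (\int[_]_(_ in _) _)%E = tmu n.+1 (Dn n.+1)) => [->|]; last first.
  rewrite -[RHS]mul1e; exact: (@integral_cst _ _ _ (tmu n.+1) _ (@mDn n.+1) 1%E).
rewrite (_ : (\int[mu]_(x in D) _)%E = \int[mu]_(x in D) (M ^+ n)%:E)%E.
  by rewrite -[X in _ = X%:E]/(M ^+ n.+1) exprSr EFinM -muD; exact: integral_cst.
by apply: eq_integral => x _; rewrite -[RHS]mul1e -ci.
Qed.

Lemma measurable_tnth_comp n (i : 'I_n) (f : T -> R) : measurable_fun D f ->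
  measurable_fun (Dn n) (fun z => f (tnth z i)).
Proof.
move=> mf; apply: (measurable_comp mD) mf _.
  by move=> _ [z zD <-]; exact: zD.
by apply: measurable_funTS; exact: measurable_tnth.
Qed.

Lemma ge0_integral_tnth n (i : 'I_n.+1) (f : T -> R) : measurable_fun D f ->
  (forall x, D x -> 0 <= f x) ->
  (\int[tmu n.+1]_(z in Dn n.+1) (f (tnth z i))%:E =
   (M ^+ n)%:E * \int[mu]_(x in D) (f x)%:E)%E.
Proof.
move=> mf f0; have M0 : 0 <= M by rewrite -lee_fin -muD.
have f0D : (0 <= \int[mu]_(x in D) (f x)%:E)%E by apply: integral_ge0 => x Dx; rewrite lee_fin f0.
elim: n i => [|n IHn] i.
  rewrite (ge0_integral_tupleS mu mD); last 2 first.
    by apply/measurable_EFinP; exact: measurable_tnth_comp.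
    by move=> z zD; rewrite lee_fin; apply: f0; exact: zD.
  rewrite expr0 mul1e; apply: eq_integral => x _.
  have e (z : 0.-tuple T) : tnth [tuple of x :: z] i = x by rewrite (ord1 i).
  under eq_integral do rewrite e.
  by rewrite (@integral_tuple0 _ _ _ mu D (cst (f x)%:E)).
rewrite (ge0_integral_tupleS mu mD); last 2 first.
  by apply/measurable_EFinP; exact: measurable_tnth_comp.
  by move=> z zD; rewrite lee_fin; apply: f0; exact: zD.
have ci n' (k : \bar R) : (\int[tmu n']_(x in Dn n') k = k * (M ^+ n')%:E)%E.
  by rewrite -tuple_measure_power; exact: (@integral_cst _ _ _ (tmu n') _ (@mDn n') k).
have ci1 (k : \bar R) : (\int[mu]_(x in D) k = k * M%:E)%E.
  by rewrite -muD; exact: integral_cst.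
have [j ->|->] := unliftP ord0 i.
  rewrite (_ : (\int[mu]_(x in D) _)%E =
      (\int[mu]_(x in D) ((M ^+ n)%:E * \int[mu]_(x in D) (f x)%:E))%E).
    by rewrite ci1 exprS EFinM muleC muleA.
  apply: eq_integral => x _; rewrite -(IHn j).
  by apply: eq_integral => z _; rewrite tnthS.
rewrite (_ : (\int[mu]_(x in D) _)%E =
    (\int[mu]_(x in D) ((M ^+ n.+1)%:E * (f x)%:E))%E).
  by rewrite ge0_integralZl_EFin ?exprn_ge0//; exact/measurable_EFinP.
by apply: eq_integral => x _; rewrite muleC -ci.
Qed.

Lemma has_integral_tnth n (i : 'I_n.+1) (f : T -> R) v : has_integral mu D f v ->
  has_integral (tmu n.+1) (Dn n.+1) (fun z => f (tnth z i)) (M ^+ n * v).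
Proof.
move=> hf; have mf := has_integral_measurable hf; have [intf fv] := hf.
have M0 : 0 <= M by rewrite -lee_fin -muD.
(* The nonnegative case, to be applied to the positive and negative parts of [f]. *)
have fin (g : T -> R) : measurable_fun D g -> (forall x, D x -> 0 <= g x) ->
    mu.-integrable D (EFin \o g) -> exists2 w,
    has_integral mu D g w & has_integral (tmu n.+1) (Dn n.+1) (fun z => g (tnth z i)) (M ^+ n * w).
  move=> mg g0 intg; have [w hw] := integrable_has_integral mD intg; exists w => //.
  apply: ge0_has_integral => //; first exact: measurable_tnth_comp.
    by move=> z zD; apply: g0; exact: zD.
  by rewrite ge0_integral_tnth//; have [_ ->] := hw.
have mp : measurable_fun D (fun x => Num.max (f x) 0) by exact: measurable_maxr.
have mn : measurable_fun D (fun x => Num.max (- f x) 0).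
  by apply: measurable_maxr => //; exact: measurable_funN.
have le_int (g : T -> R) : measurable_fun D g -> (forall x, `|g x| <= `|f x|) ->
    mu.-integrable D (EFin \o g).
  move=> mg gf; apply: le_integrable intf => //; first exact/measurable_EFinP.
  by move=> x _ /=; rewrite lee_fin.
have [||p hp hp'] := fin _ mp.
- by move=> x _; rewrite le_max lexx orbT.
- apply: le_int => // x; rewrite ger0_norm ?le_max ?lexx ?orbT//.
  by rewrite ge_max ler_norm normr_ge0.
have [||q hq hq'] := fin _ mn.
- by move=> x _; rewrite le_max lexx orbT.
- apply: le_int => // x; rewrite ger0_norm ?le_max ?lexx ?orbT//.
  by rewrite ge_max -normrN ler_norm normr_ge0.
have fE x : Num.max (f x) 0 - Num.max (- f x) 0 = f x.
  by case: (leP (f x) 0); case: (leP (- f x) 0); lra.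
have -> : v = p - q.
  apply: (has_integral_unique hf).
  by apply: (has_integral_eq mD (has_integralB mD hp hq)) => x _; exact: fE.
rewrite mulrBr; apply: (has_integral_eq (@mDn _) (has_integralB (@mDn _) hp' hq')) => z _.
exact: fE.
Qed.

Section tuple_sum.
Variables (Y W : T -> R).
Hypotheses (mY : measurable_fun D Y) (mW : measurable_fun D W).

Definition tuple_sum n (z : n.+1.-tuple T) :=
  \sum_(j < n) Y (tnth z (widen_ord (leqnSn n) j)).

Lemma tuple_sum_cons n x (z : n.+1.-tuple T) :
  tuple_sum [tuple of x :: z] = Y x + tuple_sum z.
Proof.
rewrite /tuple_sum big_ord_recl; congr (Y _ + _).
apply: eq_bigr => j _; congr Y.
by rewrite (_ : widen_ord _ _ = lift ord0 (widen_ord (leqnSn n) j)) ?tnthS//; exact: val_inj.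
Qed.

Lemma tnth_last_cons n x (z : n.+1.-tuple T) :
  tnth [tuple of x :: z] ord_max = tnth z ord_max.
Proof. by rewrite (_ : ord_max = lift ord0 ord_max) ?tnthS//; exact: val_inj. Qed.

Lemma measurable_tuple_sum n : measurable_fun (Dn n.+1) (@tuple_sum n).
Proof.
by apply: measurable_sum => j; exact: measurable_tnth_comp.
Qed.

(** Independence, one coordinate at a time: in [cos (t Y + t S) = cos (t Y) cos (t S) - sin (t Y)
    sin (t S)] the second term integrates to 0 with [sin (t Y)]. Real characteristic functions thus
    suffice. The variable carrying [W] comes last, so it is what remains in the base case. *)
Lemma has_integral_cos_tuple_sum n (t phi psi : R) :
  has_integral mu D (fun x => cos (t * Y x)) phi ->
  has_integral mu D (fun x => sin (t * Y x)) 0 ->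
  has_integral mu D (fun x => cos (t * W x)) psi ->
  has_integral (tmu n.+1) (Dn n.+1)
    (fun z => cos (t * (tuple_sum z + W (tnth z ord_max)))) (phi ^+ n * psi).
Proof.
move=> hphi hsin hpsi.
pose S n (z : n.+1.-tuple T) := tuple_sum z + W (tnth z ord_max).
have mS n' : measurable_fun (Dn n'.+1) (@S n').
  by apply: measurable_funD; [exact: measurable_tuple_sum|exact: measurable_tnth_comp].
have mcS n' : measurable_fun (Dn n'.+1) (fun z => cos (t * @S n' z)).
  apply: measurableT_comp; first exact: (continuous_measurable_fun (@continuous_cos R)).
  by apply: measurable_funM; [exact: measurable_cst|exact: mS].
have msS n' : measurable_fun (Dn n'.+1) (fun z => sin (t * @S n' z)).
  apply: measurableT_comp; first exact: (continuous_measurable_fun (@continuous_sin R)).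
  by apply: measurable_funM; [exact: measurable_cst|exact: mS].
elim: n => [|n IHn].
  have := @has_integral_tnth 0 ord_max _ _ hpsi.
  rewrite !expr0 !mul1r => h; apply: (has_integral_eq (@mDn _) h) => z _.
  by rewrite /tuple_sum big_ord0 add0r.
have [s hs] := @bounded_has_integral _ _ _ _ _ (@mDn n.+1) _ (tuple_measure_power n.+1)
  _ 1 (msS n) (fun z _ => sin_max _).
(* Adding 1 makes the integrand nonnegative, so that the first coordinate can be split off by
   Tonelli. *)
suff h1 : has_integral (tmu n.+2) (Dn n.+2) (fun z => 1 + cos (t * S _ z))
    (M ^+ n.+2 + phi ^+ n.+1 * psi).
  have h2 := @has_integral_cst _ _ _ (tmu n.+2) _ (@mDn n.+2) _ (tuple_measure_power n.+2) 1.
  have := has_integralB (@mDn _) h1 h2; rewrite mul1r addrAC subrr add0r.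
  by move=> h; apply: (has_integral_eq (@mDn _) h) => z _; rewrite addrAC subrr add0r.
have pos (u : R) : 0 <= 1 + cos u by have := cos_geN1 u; lra.
have mc1 : measurable_fun (Dn n.+2) (fun z => 1 + cos (t * S _ z)).
  by apply: measurable_funD; [exact: measurable_cst|exact: mcS].
apply: (ge0_has_integral mc1) => //.
rewrite (ge0_integral_tupleS mu mD); last 2 first.
- exact/measurable_EFinP.
- by move=> z _; rewrite lee_fin.
have h3 : has_integral mu D
    (fun x => M ^+ n.+1 + cos (t * Y x) * (phi ^+ n * psi) - sin (t * Y x) * s)
    (M ^+ n.+2 + phi ^+ n.+1 * psi).
  have h4 := has_integral_cst mD muD (M ^+ n.+1).
  have h5 := has_integralZ mD (phi ^+ n * psi) hphi.
  have h6 := has_integralZ mD s hsin.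
  have := has_integralB mD (has_integralD mD h4 h5) h6.
  rewrite (_ : _ - _ = M ^+ n.+2 + phi ^+ n.+1 * psi); last by rewrite !exprS; ring.
  by move=> h; apply: (has_integral_eq mD h) => x _; ring.
have [_ <-] := h3; apply: eq_integral => x _.
have h7 := @has_integral_cst _ _ _ (tmu n.+1) _ (@mDn n.+1) _ (tuple_measure_power n.+1) 1.
have h8 := has_integralZ (@mDn n.+1) (cos (t * Y x)) IHn.
have h9 := has_integralZ (@mDn n.+1) (sin (t * Y x)) hs.
have [_ e] := has_integralB (@mDn n.+1) (has_integralD (@mDn n.+1) h7 h8) h9.
rewrite (_ : M ^+ n.+1 + _ - _ = 1 * M ^+ n.+1 + cos (t * Y x) * (phi ^+ n * psi) - sin (t * Y x) * s); last by ring.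
rewrite -e; apply: eq_integral => z _; congr (_%:E).
by rewrite /S tuple_sum_cons tnth_last_cons -addrA mulrDr cosD; ring.
Qed.

End tuple_sum.

End tuple_integral.

From mathcomp Require Import -(notations) mpoly.

(** * The variables [Y] and [W] *)

Section disc_functions.
Context {R : realType}.
Notation leb := (@lebesgue_measure R).
Notation plane := (measurableTypeR R * measurableTypeR R)%type.
Notation area := (@planar_measure R).
Notation disc := (@unit_disc R).
Local Notation normc := (@Normc.normc R).
Local Notation has_area_integral := (has_integral area disc).

Let mD : measurable disc := @measurable_unit_disc R.

Definition lnp (z : plane) : R := ln (normc (1 + to_complex z)).
Definition lnm (z : plane) : R := ln (normc (1 - to_complex z)).
Definition logratio (z : plane) : R := lnp z - lnm z.
Definition lnmod (z : plane) : R := - ln (modulus z).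

Lemma normc1D_gt0 (e : R[i]) z : normc e = 1 -> disc z -> 0 < normc (1 + e * to_complex z).
Proof.
move=> e1; rewrite unit_discE => Dz; rewrite -[e]opprK mulNr.
apply: lt_le_trans (ler_normc_sub _ _); rewrite Normc.normc1 Normc.normcM normcN e1 mul1r.
by rewrite subr_gt0.
Qed.

Lemma measurable_ln_normc (f : plane -> R[i]) : measurable_complex setT f ->
  measurable_fun setT (fun z => ln (normc (f z))).
Proof. by move=> mf; apply: measurableT_comp => //; exact: measurable_normc. Qed.

Lemma measurable_lnp : measurable_fun setT lnp.
Proof.
apply: measurable_ln_normc; apply: measurable_complexD; first exact: measurable_complex_cst.
exact: measurable_to_complex.
Qed.

Lemma measurable_lnm : measurable_fun setT lnm.
Proof.
apply: measurable_ln_normc; apply: measurable_complexD; first exact: measurable_complex_cst.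
by apply: measurable_complexN; exact: measurable_to_complex.
Qed.

Lemma measurable_logratio : measurable_fun setT logratio.
Proof. by apply: measurable_funB; [exact: measurable_lnp|exact: measurable_lnm]. Qed.

Lemma measurable_lnmod : measurable_fun setT lnmod.
Proof.
by apply: measurable_funN; apply: measurableT_comp => //; exact: measurable_modulus.
Qed.

Lemma lnmod_ge0 z : disc z -> 0 <= lnmod z.
Proof. by rewrite unit_discE => Dz; rewrite /lnmod oppr_ge0 ln_le0// ltW. Qed.

(** Jensen's formula with [|a| = |b| = 1]: on the disc the larger of [1] and [|u|] is [1], whose
    logarithm is 0. The constant [c = 1] is admissible as [2 <= exp 1]. *)
Lemma has_integral_ln_normc1D (e : R[i]) : normc e = 1 ->
  has_area_integral (fun z => ln (normc (1 + e * to_complex z))) 0.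
Proof.
move=> e1; have e0 : e != 0 by rewrite -normc_gt0 e1.
have c2 : normc 1 + normc e <= expR 1.
  by rewrite Normc.normc1 e1; have := expR_ge1Dx (1 : R); lra.
have hD z : disc z -> 0 <= 1 - ln (normc (1 + e * to_complex z)).
  move=> Dz; rewrite subr_ge0 -[leRHS]expRK ler_ln ?posrE ?expR_gt0 ?normc1D_gt0//.
  apply: le_trans c2; apply: le_trans (le_normcD _ _) _; rewrite lerD2l.
  by rewrite Normc.normcM e1 mul1r ltW.
have h1 : has_area_integral (fun z => 1 - ln (normc (1 + e * to_complex z))) pi.
  apply: ge0_has_integral => //.
    apply: measurable_funTS; apply: measurable_funB => //; apply: measurable_ln_normc.
    apply: measurable_complexD; first exact: measurable_complex_cst.
    by apply: measurable_complexM; [exact: measurable_complex_cst|exact: measurable_to_complex].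
  have := integral_disc_hlog (oner_neq0 _) e0 c2.
  rewrite (_ : (\int[area]_(u in disc) hlog _ _)%E =
    (\int[area]_(z in disc) (1 - ln (normc (1 + e * to_complex z)%R))%:E)%E) => [->|].
    have [_] := @has_integral_cst _ _ _ area disc mD pi (@area_unit_disc R) 1.
    rewrite mul1r => <-; apply: eq_integral => u /set_mem; rewrite unit_discE => Du.
    have : ln (modulus u) <= 0 by rewrite ln_le0// ltW.
    rewrite Normc.normc1 e1 ln1 => l0; congr (_%:E).
    by rewrite subr0 sub0r normrN ler0_norm//; lra.
  by apply: eq_integral => u /set_mem Du; rewrite /hlog gt_eqF// normc1D_gt0.
have h2 := has_integralB mD (@has_integral_cst _ _ _ area disc mD pi (@area_unit_disc R) 1) h1.
move: h2; rewrite mul1r subrr => h2; apply: (has_integral_eq mD h2) => z _; ring.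
Qed.

Lemma has_integral_lnp : has_area_integral lnp 0.
Proof.
apply: (has_integral_eq mD (has_integral_ln_normc1D (Normc.normc1 R))) => z _.
by rewrite /lnp mul1r.
Qed.

Lemma has_integral_lnm : has_area_integral lnm 0.
Proof.
have e1 : normc (-1) = 1 by rewrite normcN Normc.normc1.
apply: (has_integral_eq mD (has_integral_ln_normc1D e1)) => z _.
by rewrite /lnm mulN1r.
Qed.

Lemma area_lnmod_gt (v : R) : 0 <= v ->
  area (disc `&` [set z | v < lnmod z]) = (pi * expR (- (2 * v)))%:E.
Proof.
move=> v0; have s0 := expR_gt0 (- v).
have mA : measurable (disc `&` [set z | v < lnmod z]).
  have := measurable_fun_ltr (measurable_cst v) (measurable_funTS (D := disc) measurable_lnmod).
  by move=> /(_ mD [set true] I); congr measurable.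
have -> : pi * expR (- (2 * v)) = pi * expR (- v) ^+ 2.
  by rewrite -expRM_natl mulrN.
rewrite -(area_modulus_lt s0); apply/eqP; rewrite eq_le; apply/andP; split.
  apply: le_measure; rewrite ?inE//; first exact: measurable_modulus_lt.
  move=> z [_ /=]; rewrite /lnmod ltrNr => h.
  have [->|z0] := eqVneq (modulus z) 0; first exact: expR_gt0.
  by rewrite -[ltLHS]lnK ?ltr_expR// posrE lt_def z0 modulus_ge0.
(* Since [ln 0 = 0], the origin is missing from the superlevel set; it has to be added as a
   negligible set. *)
have [N [mN N0 subN]] := @negligible_origin R.
apply: (@le_trans _ _ (area ((disc `&` [set z | v < lnmod z]) `|` N))).
  apply: le_measure; rewrite ?inE//.
  - exact: measurable_modulus_lt.
  - exact: measurableU.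
  move=> z /= zs; have [z0|z0] := eqVneq (modulus z) 0; first by right; exact: subN.
  have zp : 0 < modulus z by rewrite lt_def z0 modulus_ge0.
  left; split.
    by rewrite unit_discE (lt_le_trans zs)// -expR0 ler_expR oppr_le0.
  by rewrite /= /lnmod ltrNr -[ltRHS]expRK ltr_ln ?posrE.
by rewrite (le_trans (measureU2 _ _ _))//= N0 adde0.
Qed.

Lemma has_integral_layer_lnmod (k K : R -> R) (v : R) :
  (forall v, 0 <= v -> 0 <= k v) -> continuous k ->
  (forall v : R, is_derive v (1 : R) K (k v)) -> K 0 = 0 ->
  (\int[leb]_(v in `[0%R, +oo[) (k v * (pi * expR (- (2 * v))))%:E = v%:E)%E ->
  has_area_integral (fun z => K (lnmod z)) v.
Proof.
move=> k0 ck dK K0 kv.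
have K_ge0 x : 0 <= x -> 0 <= K x.
  rewrite le_eqVlt => /predU1P[<-|x0]; first by rewrite K0.
  have cK : {within `[0, x], continuous K}.
    by apply: continuous_subspaceT => y; exact: is_derive_continuous (dK y).
  have [c /[!in_itv]/= /andP[c0 _]] := MVT x0 (fun y _ => dK y) cK.
  by rewrite K0 !subr0 => ->; rewrite mulr_ge0 ?k0// ltW.
have cK : continuous K by move=> y; exact: is_derive_continuous (dK y).
apply: ge0_has_integral => //.
- apply: measurable_funTS; apply: measurableT_comp; last exact: measurable_lnmod.
  exact: continuous_measurable_fun.
- by move=> z Dz; exact/K_ge0/lnmod_ge0.
rewrite -kv (layer_cake area mD (measurable_funTS measurable_lnmod) lnmod_ge0 k0 ck dK K0).
apply: eq_integral => v'; rewrite mem_itv_set/= andbT => v0.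
by rewrite area_lnmod_gt// EFinM.
Qed.

Lemma has_integral_lnmod : has_area_integral lnmod (pi / 2).
Proof.
apply: (@has_integral_layer_lnmod (fun=> 1) (fun v => v)) => //.
  by move=> v; exact: cvg_cst.
have := @integral_exprM_expRN R 0 2 (ltr0n _ _).
rewrite fact0 expr1 mul1r => e.
have hE (v : R) : (1 * (pi * expR (- (2 * v))))%:E =
    (pi%:E * (v ^+ 0 * expR (- (2 * v)))%:E)%E by rewrite expr0 !mul1r EFinM.
under eq_integral do rewrite hE.
rewrite ge0_integralZl_EFin//.
- by rewrite e.
- by move=> x _; rewrite lee_fin expr0 mul1r expR_ge0.
- apply/measurable_EFinP; apply: measurable_funTS; apply: measurable_funM => //.
  by apply: measurableT_comp => //; apply: measurable_funN; exact: measurable_funM.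
- exact: pi_ge0.
Qed.

Lemma has_integral_cos_lnmod (t : R) : 0 < t ->
  has_area_integral (fun z => cos (t * lnmod z)) (pi * (4 / (4 + t ^+ 2))).
Proof.
move=> t0; have p0 := pi_gt0 R.
have d0 : 4 + t ^+ 2 != 0 by rewrite gt_eqF// ltr_wpDr ?sqr_ge0.
(* The derivative [t sin (t v)] of [1 - cos (t v)] changes sign. Adding [t v] to the function makes
   its derivative [t + t sin (t v)] nonnegative, as the layer-cake formula demands; the added part
   is known from [has_integral_lnmod]. *)
have h : has_area_integral (fun z => (fun v => t * v + 1 - cos (t * v)) (lnmod z))
    (pi * t / 2 + pi * t ^+ 2 / (4 + t ^+ 2)).
  have ck : continuous (fun v : R => t + t * sin (t * v)).
    move=> v.
    have : is_derive v (1 : R) (fun v : R => t + t * sin (t * v)) (t * (cos (t * v) * t)).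
      by der_by; ring.
    exact: is_derive_continuous.
  have k0 (v : R) : 0 <= t + t * sin (t * v).
    by have := sin_geN1 (t * v); nra.
  have dK v : is_derive v (1 : R) (fun v => t * v + 1 - cos (t * v)) (t + t * sin (t * v)).
    by der_by; ring.
  apply: (has_integral_layer_lnmod (fun v _ => k0 v) ck dK); first by rewrite mulr0 cos0; ring.
  pose F (v : R) := - (pi * t * expR (- (2 * v)) * (2^-1 + (2 * sin (t * v) + t * cos (t * v)) / (4 + t ^+ 2))).
  have dF v : is_derive v (1 : R) F ((t + t * sin (t * v)) * (pi * expR (- (2 * v)))).
    by rewrite /F; der_by => //; field.
  have g0 v : 0 <= v -> 0 <= (t + t * sin (t * v)) * (pi * expR (- (2 * v))).
    by move=> _; rewrite mulr_ge0// mulr_ge0 ?expR_ge0// ltW.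
  have cg (v : R) : 0 <= v -> {for v, continuous (fun v => (t + t * sin (t * v)) * (pi * expR (- (2 * v))))}.
    move=> _; apply: cvgM; first exact: ck.
    have : is_derive v (1 : R) (fun v : R => pi * expR (- (2 * v))) (- (2 * (pi * expR (- (2 * v))))).
      by der_by; ring.
    exact: is_derive_continuous.
  have limF : F v @[v --> +oo] --> 0.
    apply: (@cvgy_le_inv _ _ (pi * t * (2^-1 + (2 + t) / (4 + t ^+ 2)) * (1`!%:R / 2 ^+ 1))) => v v1.
    rewrite /F normrN normrM ger0_norm; last by rewrite !mulr_ge0 ?expR_ge0// ltW.
    have v0 : 0 < v by lra.
    have ev := @exprM_expRN_le R 1 2 v (ltr0n _ _) (ltW v0).
    rewrite ler_pdivlMr//.
    have B : `|2^-1 + (2 * sin (t * v) + t * cos (t * v)) / (4 + t ^+ 2)| <= 2^-1 + (2 + t) / (4 + t ^+ 2).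
      apply: le_trans (ler_normD _ _) _; rewrite ger0_norm// lerD2l.
      rewrite normrM [X in _ * X]ger0_norm ?invr_ge0 ?addr_ge0 ?sqr_ge0//.
      rewrite ler_pM2r ?invr_gt0 ?ltr_wpDr ?sqr_ge0//.
      apply: le_trans (ler_normD _ _) _; rewrite !normrM (gtr0_norm t0) gtr0_norm//.
      by have := sin_max (t * v); have := cos_max (t * v); nra.
    set X := `|_| in B *; set Y := 2^-1 + _ in B *.
    rewrite (_ : pi * t * expR (- (2 * v)) * X * v = pi * t * X * (v ^+ 1 * expR (- (2 * v)))); last by rewrite expr1; ring.
    have pt : 0 <= pi * t by rewrite mulr_ge0// ltW.
    apply: ler_pM ev.
    - by apply: mulr_ge0 => //; exact: normr_ge0.
    - by rewrite mulr_ge0 ?exprn_ge0 ?expR_ge0// ltW.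
    - by rewrite ler_wpM2l.
  have -> : pi * t / 2 + pi * t ^+ 2 / (4 + t ^+ 2) = 0 - F 0.
    by rewrite /F !mulr0 oppr0 expR0 sin0 cos0; field.
  exact: (integral_FTCy g0 cg (fun v _ => dF v) limF).
have h1 := has_integralD mD (has_integralZ mD t has_integral_lnmod)
  (@has_integral_cst _ _ _ area disc mD pi (@area_unit_disc R) 1).
have := has_integralB mD h1 h.
rewrite (_ : _ - _ = pi * (4 / (4 + t ^+ 2))); last by field.
by move=> h2; apply: (has_integral_eq mD h2) => z _; ring.
Qed.

Lemma to_complex_opp (z : plane) : to_complex (rotate (-1) 0 z) = - to_complex z.
Proof.
have := to_complex_rotate (-1) z; rewrite mulN1r => <-.
by congr to_complex; congr (rotate _ _ _); rewrite /= ?oppr0.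
Qed.

Lemma logratio_opp z : logratio (rotate (-1) 0 z) = - logratio z.
Proof. by rewrite /logratio /lnp /lnm to_complex_opp opprK opprB. Qed.

Lemma ge0_integral_disc_opp (f : plane -> \bar R) :
  measurable_fun disc f -> (forall z, disc z -> (0 <= f z)%E) ->
  (\int[area]_(z in disc) f (rotate (-1)%R 0%R z) = \int[area]_(z in disc) f z)%E.
Proof. by apply: ge0_integral_disc_rotate; ring. Qed.

Lemma measurable_comp_logratio (h : R -> R) : continuous h ->
  measurable_fun disc (fun z => h (logratio z)).
Proof.
move=> ch; apply: measurable_funTS; apply: measurableT_comp; last exact: measurable_logratio.
exact: continuous_measurable_fun.
Qed.

(** [Y] is odd under the half-turn, which preserves area; applied to the nonnegative function
    [1 + sin (t Y)], this equates its integral with that of [1 - sin (t Y)]. *)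
Lemma has_integral_sin_logratio (t : R) :
  has_area_integral (fun z => sin (t * logratio z)) 0.
Proof.
have cs : continuous (fun y : R => sin (t * y)).
  move=> y; have : is_derive y (1 : R) (fun y : R => sin (t * y)) (cos (t * y) * (0 * y + t * 1)).
    by der.
  exact: is_derive_continuous.
have [s hs] := @bounded_has_integral _ _ _ area disc mD pi (@area_unit_disc R)
  (fun z => sin (t * logratio z)) 1 (measurable_comp_logratio cs) (fun z _ => sin_max _).
have h1 := has_integralD mD (@has_integral_cst _ _ _ area disc mD pi (@area_unit_disc R) 1) hs.
have h2 := has_integralB mD (@has_integral_cst _ _ _ area disc mD pi (@area_unit_disc R) 1) hs.
have pos z : disc z -> (0 <= (1 + sin (t * logratio z))%:E)%E.
  by move=> _; rewrite lee_fin; have := sin_geN1 (t * logratio z); lra.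
have m1 : measurable_fun disc (fun z => (1 + sin (t * logratio z))%:E).
  by apply/measurable_EFinP; exact: has_integral_measurable h1.
have := ge0_integral_disc_opp m1 pos.
rewrite (_ : (\int[area]_(z in disc) _)%E = (\int[area]_(z in disc) (1 - sin (t * logratio z))%:E)%E).
  have [_ ->] := h1; have [_ ->] := h2 => -[e].
  by have -> : 0 = s by lra.
by apply: eq_integral => z _; rewrite logratio_opp mulrN sinN.
Qed.

End disc_functions.

(** * Reduction of the Mahler measure to the mean of a modulus *)

Section polydisc.
Context {R : realType}.
Notation leb := (@lebesgue_measure R).
Notation plane := (measurableTypeR R * measurableTypeR R)%type.
Notation area := (@planar_measure R).
Notation disc := (@unit_disc R).
Local Notation normc := (@Normc.normc R).
Local Notation Dn n := (@tuple_power _ plane disc n).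
Local Notation tmu n := (@tuple_measure _ plane R area n).

Let mD : measurable disc := @measurable_unit_disc R.
Let mDn n : measurable (Dn n) := @measurable_tuple_power _ _ _ mD n.

Definition tuple_prod (f : plane -> R[i]) m (z : m.+1.-tuple plane) : R[i] :=
  \prod_(j < m) f (tnth z (widen_ord (leqnSn m) j)).

Lemma tuple_prod_cons f m x (z : m.+1.-tuple plane) :
  tuple_prod f [tuple of x :: z] = f x * tuple_prod f z.
Proof.
rewrite /tuple_prod big_ord_recl; congr (f _ * _).
apply: eq_bigr => j _; congr f.
by rewrite (_ : widen_ord _ _ = lift ord0 (widen_ord (leqnSn m) j)) ?tnthS//; exact: val_inj.
Qed.

Definition onep (z : plane) : R[i] := 1 + to_complex z.
Definition onem (z : plane) : R[i] := 1 - to_complex z.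

Lemma meval_mahler_poly m (z : m.+1.-tuple plane) :
  meval (fun i => to_complex (tnth z i)) (mahler_poly R m) =
  tuple_prod onep z + to_complex (tnth z ord_max) * tuple_prod onem z.
Proof.
rewrite /mahler_poly mevalD mevalM mevalXU !rmorph_prod; congr (_ + _ * _).
  by apply: eq_bigr => j _; rewrite rmorphD rmorph1 /= mevalXU.
by apply: eq_bigr => j _; rewrite rmorphB rmorph1 /= mevalXU.
Qed.

Lemma measurable_tuple_prod f m : measurable_complex setT f ->
  measurable_complex setT (@tuple_prod f m).
Proof.
move=> mf; rewrite /tuple_prod.
elim: (index_enum _) => [|j s IHs].
  rewrite (_ : (fun z => _) = fun=> 1); first exact: measurable_complex_cst.
  by apply/funext => z; rewrite big_nil.
rewrite (_ : (fun z => _) = fun z : m.+1.-tuple plane => f (tnth z (widen_ord (leqnSn m) j)) *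
   \prod_(i <- s) f (tnth z (widen_ord (leqnSn m) i))).
  apply: measurable_complexM => //; have [m1 m2] := mf.
  by split; [apply: (measurableT_comp m1)|apply: (measurableT_comp m2)]; exact: measurable_tnth.
by apply/funext => z; rewrite big_cons.
Qed.

Lemma measurable_onep : measurable_complex setT onep.
Proof.
apply: measurable_complexD; first exact: measurable_complex_cst.
exact: measurable_to_complex.
Qed.

Lemma measurable_onem : measurable_complex setT onem.
Proof.
apply: measurable_complexD; first exact: measurable_complex_cst.
by apply: measurable_complexN; exact: measurable_to_complex.
Qed.

Lemma onep_neq0 x : disc x -> onep x != 0.
Proof.
move=> Dx; have := normc1D_gt0 (Normc.normc1 R) Dx.
by rewrite mul1r normc_gt0.
Qed.

Lemma onem_neq0 x : disc x -> onem x != 0.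
Proof.
move=> Dx; have e1 : normc (-1) = 1 by rewrite normcN Normc.normc1.
by have := normc1D_gt0 e1 Dx; rewrite mulN1r normc_gt0.
Qed.

Lemma normc_onep_le x : disc x -> normc (onep x) <= 2.
Proof.
rewrite unit_discE => Dx; apply: le_trans (le_normcD _ _) _.
by rewrite Normc.normc1; have := ltW Dx; rewrite /modulus; lra.
Qed.

Lemma normc_onem_le x : disc x -> normc (onem x) <= 2.
Proof.
rewrite unit_discE => Dx; apply: le_trans (le_normcD _ _) _.
by rewrite normcN Normc.normc1; have := ltW Dx; rewrite /modulus; lra.
Qed.

Lemma normc_tuple_prod f m (z : m.+1.-tuple plane) :
  (forall x, disc x -> f x != 0) -> (forall x, disc x -> normc (f x) <= 2) ->
  Dn m.+1 z -> 0 < normc (tuple_prod f z) <= 2 ^+ m.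
Proof.
move=> f0 f2 zD; rewrite /tuple_prod.
have key (s : seq 'I_m) : 0 < normc (\prod_(j <- s) f (tnth z (widen_ord (leqnSn m) j))) <= 2 ^+ size s.
  elim: s => [|j s /andP[IH1 IH2]]; first by rewrite big_nil Normc.normc1 ltr01 lexx.
  have Dj := zD (widen_ord (leqnSn m) j).
  rewrite big_cons Normc.normcM mulr_gt0//=; last by rewrite normc_gt0 f0.
  by rewrite exprS ler_pM ?normc_ge0// f2.
by have := key (index_enum _); rewrite /index_enum -enumT size_enum_ord.
Qed.

(* The logarithm of [max (|a prod (1 + x_j)|, |u b prod (1 - x_j)|)]. *)
Definition log_max (a b : R[i]) m (z : m.+1.-tuple plane) : R :=
  let p := ln (normc (a * tuple_prod onep z)) in
  let q := ln (normc (b * tuple_prod onem z)) - lnmod (tnth z ord_max) in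
  2^-1 * (p + q) + 2^-1 * `|p - q|.

Definition form (a b : R[i]) m (z : m.+1.-tuple plane) : R[i] :=
  a * tuple_prod onep z + b * tuple_prod onem z * to_complex (tnth z ord_max).

Lemma measurable_form a b m : measurable_complex setT (@form a b m).
Proof.
apply: measurable_complexD; apply: measurable_complexM.
- exact: measurable_complex_cst.
- exact: measurable_tuple_prod measurable_onep.
- by apply: measurable_complexM; [exact: measurable_complex_cst|exact: measurable_tuple_prod measurable_onem].
- by split; [apply: (measurableT_comp measurable_fst)|apply: (measurableT_comp measurable_snd)]; exact: measurable_tnth.
Qed.

Lemma measurable_log_max a b m : measurable_fun setT (@log_max a b m).
Proof.
have mp : measurable_fun setT (fun z : m.+1.-tuple plane => ln (normc (a * tuple_prod onep z))).
  apply: measurableT_comp => //; apply: measurable_normc; apply: measurable_complexM.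
    exact: measurable_complex_cst.
  exact: measurable_tuple_prod measurable_onep.
have mq : measurable_fun setT (fun z : m.+1.-tuple plane => ln (normc (b * tuple_prod onem z)) - lnmod (tnth z ord_max)).
  apply: measurable_funB.
    apply: measurableT_comp => //; apply: measurable_normc; apply: measurable_complexM.
      exact: measurable_complex_cst.
    exact: measurable_tuple_prod measurable_onem.
  by apply: (measurableT_comp measurable_lnmod); exact: measurable_tnth.
apply: measurable_funD; apply: measurable_funM => //; first exact: measurable_funD.
by apply: measurableT_comp => //; exact: measurable_funB.
Qed.

Lemma form_bounds a b c m (z : m.+1.-tuple plane) : a != 0 -> b != 0 ->
  (normc a + normc b) * 2 ^+ m <= expR c -> Dn m.+1 z ->
  normc (form a b z) <= expR c /\ log_max a b z <= c.
Proof.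
move=> a0 b0 abc zD.
have /andP[A0 A2] := normc_tuple_prod onep_neq0 normc_onep_le zD.
have /andP[B0 B2] := normc_tuple_prod onem_neq0 normc_onem_le zD.
have na : 0 < normc a by rewrite normc_gt0.
have nb : 0 < normc b by rewrite normc_gt0.
have Du := zD ord_max; have u1 : modulus (tnth z ord_max) <= 1 by apply: ltW; move: Du; rewrite unit_discE.
have AE : normc (a * tuple_prod onep z) <= normc a * 2 ^+ m by rewrite Normc.normcM ler_pM2l.
have BE : normc (b * tuple_prod onem z) <= normc b * 2 ^+ m by rewrite Normc.normcM ler_pM2l.
have t0 : 0 < 2 ^+ m :> R by rewrite exprn_gt0.
have le1 : normc a * 2 ^+ m <= expR c by nra.
have le2 : normc b * 2 ^+ m <= expR c by nra.
split.
  apply: le_trans abc; apply: le_trans (le_normcD _ _) _; rewrite mulrDl lerD//.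
  by rewrite Normc.normcM; apply: le_trans BE; rewrite ler_piMr// normc_ge0.
have l1 : ln (normc (a * tuple_prod onep z)) <= c.
  by rewrite -[leRHS]expRK ler_ln ?posrE ?expR_gt0 ?(le_trans AE)// Normc.normcM mulr_gt0.
have l2 : ln (normc (b * tuple_prod onem z)) <= c.
  by rewrite -[leRHS]expRK ler_ln ?posrE ?expR_gt0 ?(le_trans BE)// Normc.normcM mulr_gt0.
have := lnmod_ge0 Du; rewrite /log_max => u0.
by set p := ln _ in l1 *; set q := ln _ in l2 *; case: (ler0P (p - (q - _))); lra.
Qed.

(** The coefficients are general so that each variable [x] can be frozen and absorbed: [a] becomes
    [a (1 + x)] and [b] becomes [b (1 - x)]. The bound by [exp c] survives because [|1 + x|] and
    [|1 - x|] are at most 2. What remains at the end is Jensen's formula in [u]. *)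
Lemma integral_polydisc_hlog m a b c : a != 0 -> b != 0 ->
  (normc a + normc b) * 2 ^+ m <= expR c ->
  (\int[tmu m.+1]_(z in Dn m.+1) hlog c (normc (form a b z)) =
   \int[tmu m.+1]_(z in Dn m.+1) (c - log_max a b z)%:E)%E.
Proof.
have mh k a' b' : measurable_fun (Dn k.+1) (fun z => hlog c (normc (@form a' b' k z))).
  apply: measurable_funTS; apply: (measurableT_comp (measurable_hlog c)).
  exact: measurable_normc (measurable_form _ _ _).
have ml k a' b' : measurable_fun (Dn k.+1) (fun z => (c - @log_max a' b' k z)%:E).
  apply/measurable_EFinP; apply: measurable_funTS; apply: measurable_funB => //.
  exact: measurable_log_max.
elim: m a b => [|m IHm] a b a0 b0 abc.
  have ph z : Dn 1 z -> (0 <= hlog c (normc (form a b z)))%E.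
    by move=> zD; have [h _] := form_bounds a0 b0 abc zD; exact: hlog_ge0 (normc_ge0 _) h.
  have pl z : Dn 1 z -> (0 <= (c - log_max a b z)%:E)%E.
    by move=> zD; rewrite lee_fin subr_ge0; have [_ h] := form_bounds a0 b0 abc zD.
  rewrite (ge0_integral_tupleS area mD (mh _ _ _) ph) (ge0_integral_tupleS area mD (ml _ _ _) pl).
  have last1 x (z : 0.-tuple plane) : tnth [tuple of x :: z] ord_max = x.
    by rewrite (_ : ord_max = ord0) ?tnth0//; exact: val_inj.
  have prod1 f x (z : 0.-tuple plane) : tuple_prod f [tuple of x :: z] = 1.
    by rewrite /tuple_prod big_ord0.
  have abc' : normc a + normc b <= expR c by move: abc; rewrite expr0 mulr1.
  have tup0 (k : \bar R) : (\int[tmu 0]_(z in Dn 0) k = k)%E.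
    by rewrite (integral_tuple0 area disc (measurable_cst k)).
  transitivity (\int[area]_(u in disc) hlog c (normc (a + b * to_complex u)%R))%E.
    apply: eq_integral => x _; rewrite -[RHS]tup0.
    by apply: eq_integral => z _; rewrite /form last1 !prod1 !mulr1.
  rewrite (integral_disc_hlog a0 b0 abc').
  apply: eq_integral => x _; rewrite -[LHS]tup0.
  apply: eq_integral => z _; rewrite /log_max last1 !prod1 !mulr1 /lnmod.
  rewrite (_ : ln (normc a) - (_ - _) = ln (normc a) - ln (normc b) - ln (modulus x)); last by ring.
  by congr (_%:E); ring.
have ph z : Dn m.+2 z -> (0 <= hlog c (normc (form a b z)))%E.
  by move=> zD; have [h _] := form_bounds a0 b0 abc zD; exact: hlog_ge0 (normc_ge0 _) h.
have pl z : Dn m.+2 z -> (0 <= (c - log_max a b z)%:E)%E.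
  by move=> zD; rewrite lee_fin subr_ge0; have [_ h] := form_bounds a0 b0 abc zD.
rewrite (ge0_integral_tupleS area mD (mh _ _ _) ph) (ge0_integral_tupleS area mD (ml _ _ _) pl).
apply: eq_integral => x /set_mem Dx.
have formE (z : m.+1.-tuple plane) : form a b [tuple of x :: z] = form (a * onep x) (b * onem x) z.
  by rewrite /form !tuple_prod_cons tnth_last_cons !mulrA.
have log_maxE (z : m.+1.-tuple plane) : log_max a b [tuple of x :: z] = log_max (a * onep x) (b * onem x) z.
  by rewrite /log_max !tuple_prod_cons tnth_last_cons !mulrA.
under eq_integral do rewrite formE.
under [RHS]eq_integral do rewrite log_maxE.
apply: IHm; rewrite ?mulf_neq0 ?onep_neq0 ?onem_neq0//.
apply: le_trans abc; rewrite exprS mulrA ler_pM2r ?exprn_gt0// mulrDl !Normc.normcM.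
by rewrite lerD// ler_wpM2l ?normc_ge0 ?normc_onep_le ?normc_onem_le.
Qed.

Lemma ln_normc_tuple_prod f m (z : m.+1.-tuple plane) :
  (forall x, disc x -> f x != 0) -> Dn m.+1 z ->
  ln (normc (tuple_prod f z)) = tuple_sum (fun x => ln (normc (f x))) z.
Proof.
move=> f0 zD; rewrite /tuple_prod /tuple_sum.
elim: (index_enum _) => [|j s IHs]; first by rewrite !big_nil Normc.normc1 ln1.
rewrite !big_cons Normc.normcM lnM ?posrE ?normc_gt0 ?f0 ?IHs//.
by elim/big_ind: _ => [||i _]; [exact: oner_neq0|exact: mulf_neq0|exact/f0/zD].
Qed.

(* [max p q = (p + q) / 2 + |p - q| / 2] for the logarithms of the two products. *)
Lemma areal_mahler_polyE m (I : R) :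
  has_integral (tmu m.+1) (Dn m.+1)
    (fun z => `|tuple_sum logratio z + lnmod (tnth z ord_max)|) (pi ^+ m.+1 * I) ->
  areal_mahler (mahler_poly R m) = (2^-1 * I - 4^-1)%:E.
Proof.
move=> hI.
have p0 := pi_gt0 R.
have hsum (f : plane -> R) : has_integral area disc f 0 ->
    has_integral (tmu m.+1) (Dn m.+1) (fun z => tuple_sum f z) 0.
  move=> hf; have h (j : 'I_m) := has_integral_tnth mD (@area_unit_disc R) (widen_ord (leqnSn m) j) hf.
  have := has_integral_sum (@mDn m.+1) (index_enum _) h.
  by rewrite (_ : \sum_(i <- _) _ = 0)//; apply: big1 => i _; rewrite mulr0.
have hp := hsum _ has_integral_lnp; have hq := hsum _ has_integral_lnm.
have hw := has_integral_tnth mD (@area_unit_disc R) (@ord_max m) has_integral_lnmod.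
have hL : has_integral (tmu m.+1) (Dn m.+1) (@log_max 1 1 m) (pi ^+ m.+1 * (2^-1 * I - 4^-1)).
  have h := has_integralD (@mDn _) (has_integralB (@mDn _) (has_integralD (@mDn _)
    (has_integralZ (@mDn _) 2^-1 hp) (has_integralZ (@mDn _) 2^-1 hq))
    (has_integralZ (@mDn _) 2^-1 hw)) (has_integralZ (@mDn _) 2^-1 hI).
  move: h; rewrite (_ : _ + 2^-1 * (_ * I) = pi ^+ m.+1 * (2^-1 * I - 4^-1)); last first.
    by rewrite exprS; field.
  move=> h; apply: (has_integral_eq (@mDn _) h) => z zD.
  rewrite /log_max !mul1r !ln_normc_tuple_prod//; [|exact: onem_neq0|exact: onep_neq0].
  rewrite -/(tuple_sum lnp z) -/(tuple_sum lnm z).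
  have -> : tuple_sum logratio z = tuple_sum lnp z - tuple_sum lnm z.
    by rewrite /tuple_sum -sumrB.
  rewrite (_ : _ - _ + lnmod (tnth z ord_max) = tuple_sum lnp z - (tuple_sum lnm z - lnmod (tnth z ord_max))); last by ring.
  ring.
(* For [a = b = 1] the bound needed is [2^(m + 1) <= exp c]. *)
pose c : R := m.+1%:R.
have cE : (normc 1 + normc 1) * 2 ^+ m <= expR c :> R.
  rewrite Normc.normc1 -mulr2n -exprS -[c]mulr1 expRM_natl lerXn2r ?nnegrE ?expR_ge0//.
  by have := expR_ge1Dx (1 : R); lra.
have hlogI := integral_polydisc_hlog (oner_neq0 _) (oner_neq0 _) cE.
have hc := has_integral_cst (@mDn m.+1) (tuple_measure_power mD (@area_unit_disc R) m.+1) c.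
have [_ hcL] := has_integralB (@mDn _) hc hL.
rewrite hcL in hlogI.
rewrite /areal_mahler.
have eqF z : (lne (normc (meval (fun i => to_complex (tnth z i)) (mahler_poly R m)))%R%:E =
    c%:E - hlog c (normc (@form 1 1 m z))%R)%E.
  rewrite meval_mahler_poly hlogE ?normc_ge0// /form !mul1r mulrC.
  case: lne => //= r; by rewrite -!EFinB; congr (_%:E); ring.
have mDn1 := @mDn m.+1.
rewrite (_ : (\int[_]_(z in _) _)%E = (\int[tmu m.+1]_(z in Dn m.+1) (c%:E - hlog c (normc (@form 1 1 m z))%R)))%E; last first.
  by apply: eq_integral => z _; rewrite eqF.
have mh : measurable_fun (Dn m.+1) (fun z => hlog c (normc (@form 1 1 m z))%R).
  apply: measurable_funTS; apply: (measurableT_comp (measurable_hlog c)).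
  exact: measurable_normc (measurable_form _ _ _).
have ih : (tmu m.+1).-integrable (Dn m.+1) (fun z => hlog c (normc (@form 1 1 m z))%R).
  apply/integrableP; split => //.
  rewrite (_ : (\int[_]_(z in _) _)%E = \int[tmu m.+1]_(z in Dn m.+1) hlog c (normc (@form 1 1 m z))%R)%E.
    by rewrite hlogI ltry.
  apply: eq_integral => z /set_mem zD; rewrite gee0_abs//.
  by have [h _] := form_bounds (oner_neq0 _) (oner_neq0 _) cE zD; exact: hlog_ge0 (normc_ge0 _) h.
have [ic cv] := hc.
rewrite (integralB mDn1 ic ih) cv hlogI -!EFinB -EFinM; congr (_%:E).
by field; rewrite expf_neq0// gt_eqF.
Qed.

End polydisc.

(** * Fourier representation *)

Section fourier.
Context {R : realType}.
Notation leb := (@lebesgue_measure R).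
Notation plane := (measurableTypeR R * measurableTypeR R)%type.
Notation area := (@planar_measure R).
Notation disc := (@unit_disc R).
Notation half_line := ([set` `[(0 : R), +oo[]).

Lemma integral_one_sub_cos_expRN (v s : R) : 0 < v -> s != 0 ->
  (\int[leb]_(t in half_line) (v * expR (- (v * t)) * (1 - cos (t * s)))%:E =
   (s ^+ 2 / (v ^+ 2 + s ^+ 2))%:E)%E.
Proof.
move=> v0 s0.
have d0 : 0 < v ^+ 2 + s ^+ 2 by rewrite ltr_wpDr ?sqr_ge0// exprn_gt0.
have dn0 : v ^+ 2 + s ^+ 2 != 0 by rewrite gt_eqF.
pose F t := - expR (- (v * t)) + v / (v ^+ 2 + s ^+ 2) * (expR (- (v * t)) * (v * cos (t * s) - s * sin (t * s))).
have dF (t : R) : is_derive t (1 : R) F (v * expR (- (v * t)) * (1 - cos (t * s))).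
  by rewrite /F; der_by; field.
have f0 t : 0 <= t -> 0 <= v * expR (- (v * t)) * (1 - cos (t * s)).
  by move=> _; rewrite !mulr_ge0 ?expR_ge0 ?subr_ge0 ?cos_le1// ltW.
have cf (t : R) : 0 <= t -> {for t, continuous (fun t => v * expR (- (v * t)) * (1 - cos (t * s)))}.
  move=> _.
  have : is_derive t (1 : R) (fun t => v * expR (- (v * t)) * (1 - cos (t * s)))
    (v * expR (- (v * t)) * (s * sin (t * s) - v * (1 - cos (t * s)))) by der_by; ring.
  exact: is_derive_continuous.
have limF : F t @[t --> +oo] --> 0.
  apply: (@cvgy_le_inv _ _ ((1 + v / (v ^+ 2 + s ^+ 2) * (v + `|s|)) * (1`!%:R / v ^+ 1))) => t t1.
  have t0 : 0 < t by lra.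
  have et := @exprM_expRN_le R 1 v t v0 (ltW t0).
  have q0 : 0 < v / (v ^+ 2 + s ^+ 2) by rewrite divr_gt0.
  set q := v / _ in q0 *.
  rewrite (_ : F t = expR (- (v * t)) * (- 1 + q * (v * cos (t * s) - s * sin (t * s)))); last first.
    by rewrite /F /q; ring.
  rewrite normrM ger0_norm ?expR_ge0// ler_pdivlMr//.
  have B : `|-1 + q * (v * cos (t * s) - s * sin (t * s))| <= 1 + q * (v + `|s|).
    apply: le_trans (ler_normD _ _) _; rewrite normrN1 lerD2l normrM (gtr0_norm q0) ler_pM2l//.
    apply: le_trans (ler_normB _ _) _; rewrite !normrM (gtr0_norm v0).
    by have := cos_max (t * s); have := sin_max (t * s); have := normr_ge0 s; nra.
  rewrite mulrAC mulrC; apply: ler_pM => //; first by rewrite mulr_ge0 ?expR_ge0// ltW.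
  by move: et; rewrite expr1 mulrC.
rewrite (integral_FTCy f0 cf (fun t _ => dF t) limF) /F; congr (_%:E).
by rewrite mulr0 oppr0 expR0 mul0r cos0 sin0; field.
Qed.

Lemma integral_sqr_div (s : R) : 0 < s ->
  (\int[leb]_(v in half_line) (s ^+ 2 / (v ^+ 2 + s ^+ 2))%:E = (s * (pi / 2))%:E)%E.
Proof.
move=> s0.
have d0 (v : R) : v ^+ 2 + s ^+ 2 != 0 by rewrite gt_eqF// ltr_wpDl ?sqr_ge0// exprn_gt0.
have dF (v : R) : is_derive v (1 : R) (fun v => s * atan (v / s)) (s ^+ 2 / (v ^+ 2 + s ^+ 2)).
  by der_by; rewrite ?gt_eqF//; field; rewrite d0 gt_eqF.
have f0 (v : R) : 0 <= v -> 0 <= s ^+ 2 / (v ^+ 2 + s ^+ 2).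
  by move=> _; rewrite divr_ge0 ?addr_ge0 ?sqr_ge0.
have cf (v : R) : 0 <= v -> {for v, continuous (fun v : R => s ^+ 2 / (v ^+ 2 + s ^+ 2))}.
  move=> _; apply: cvgM; first exact: cvg_cst.
  apply: cvgV; first exact: d0.
  by apply: cvgD; [exact: exprn_continuous|exact: cvg_cst].
have limF : (s * atan (v / s : R)) @[v --> +oo] --> s * (pi / 2).
  apply: cvgM; first exact: cvg_cst.
  apply: (cvg_comp (fun v => v / s) atan) (@cvgy_atan R).
  by apply: gt0_cvgMly; [rewrite invr_gt0|exact: cvg_id].
rewrite (integral_FTCy f0 cf (fun v _ => dF v) limF); congr (_%:E).
by rewrite mul0r atan0 mulr0 subr0.
Qed.

(** Write [1 / t^2] as the integral of [v exp (- v t)] over [v] and exchange the integrals: the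
    inner one becomes [s^2 / (v^2 + s^2)], whose primitive is an arctangent. *)
Lemma integral_one_sub_cos (s : R) :
  (\int[leb]_(t in half_line) ((1 - cos (t * s)) / t ^+ 2)%:E = (`|s| * (pi / 2))%:E)%E.
Proof.
wlog s0 : s / 0 < s.
  move=> wlg; have [s0|s0|->] := ltgtP s 0; last 1 first.
  - by rewrite normr0 mul0r integral0_eq// => t _; rewrite mulr0 cos0 subrr mul0r.
  - rewrite -normrN -wlg ?oppr_gt0//; apply: eq_integral => t _.
    by rewrite mulrN cosN.
  - exact: wlg.
rewrite gtr0_norm// -integral_sqr_div//.
(* The point [v = 0] is left out: there the inner integral is 0, but [s^2 / (v^2 + s^2)] is 1. *)
pose J : set R := [set` `](0 : R), +oo[].
have mJ : measurable J by exact: measurable_itv.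
have mH : measurable half_line by exact: measurable_itv.
pose f (p : R * R) := (p.2 * expR (- (p.2 * p.1)) * (1 - cos (p.1 * s)))%:E.
have mf : measurable_fun (half_line `*` J) f.
  apply: measurable_funTS; apply/measurable_EFinP; apply: measurable_funM.
    apply: measurable_funM => //; apply: measurableT_comp => //.
    by apply: measurable_funN; exact: measurable_funM.
  apply: measurable_funB => //; apply: measurableT_comp; first exact: (continuous_measurable_fun (@continuous_cos R)).
  exact: measurable_funM.
have f0 t v : half_line t -> J v -> (0 <= f (t, v))%E.
  rewrite /J/= !in_itv/= !andbT => t0 v0.
  by rewrite lee_fin !mulr_ge0 ?expR_ge0 ?subr_ge0 ?cos_le1// ltW.
transitivity (\int[leb]_(t in half_line) \int[leb]_(v in J) f (t, v))%E.
  apply: eq_integral => t; rewrite mem_itv_set/= andbT le_eqVlt => /predU1P[<-|t0].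
    rewrite mul0r cos0 subrr mul0r integral0_eq// => v _.
    by rewrite /f/= mul0r cos0 subrr mulr0.
  rewrite /J integral_itv_obnd_cbnd; last first.
    rewrite /f/=; apply: measurable_funTS; apply/measurable_EFinP; apply: measurable_funM => //.
    apply: measurable_funM => //; apply: measurableT_comp => //.
    by apply: measurable_funN; apply: measurable_funM.
  have hE (v : R) : f (t, v) = ((1 - cos (t * s))%:E * (v ^+ 1 * expR (- (t * v)))%:E)%E.
    by rewrite /f -EFinM /= expr1 (mulrC v t); congr (_%:E); ring.
  under eq_integral do rewrite hE.
  rewrite ge0_integralZl_EFin ?subr_ge0 ?cos_le1//.
  - by rewrite integral_exprM_expRN// -EFinM factS fact0 muln1 mul1r.
  - by move=> v; rewrite /= in_itv/= andbT => v0; rewrite lee_fin mulr_ge0 ?expR_ge0 ?exprn_ge0.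
  - apply: measurable_funTS; apply/measurable_EFinP; apply: measurable_funM => //.
    apply: measurableT_comp => //.
    by apply: measurable_funN; apply: measurable_funM.
rewrite ge0_integral_swap//.
rewrite -[RHS]integral_itv_obnd_cbnd; last first.
  apply/measurable_EFinP; apply: measurable_funTS; apply: continuous_measurable_fun => v.
  apply: cvgM; first exact: cvg_cst.
  apply: cvgV; first by rewrite gt_eqF// ltr_wpDl ?sqr_ge0// exprn_gt0.
  by apply: cvgD; [exact: exprn_continuous|exact: cvg_cst].
apply: eq_integral => v; rewrite mem_itv_set/= andbT => v0.
by rewrite -integral_one_sub_cos_expRN// gt_eqF.
Qed.

Lemma has_integral_fourier_norm d (T : measurableType d)
    (mu : {sigma_finite_measure set T -> \bar R}) (D : set T) (M : R) (S : T -> R)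
    (C : R -> R) (J : R) :
  measurable D -> mu D = M%:E -> measurable_fun D S ->
  (forall t, 0 < t -> has_integral mu D (fun z => cos (t * S z)) (C t)) ->
  (\int[leb]_(t in half_line) ((M - C t) / t ^+ 2)%:E = J%:E)%E ->
  has_integral mu D (fun z => `|S z|) (2 / pi * J).
Proof.
move=> mD muD mS hC hJ; have p0 := pi_gt0 R.
have mH : measurable half_line by exact: measurable_itv.
pose f (p : T * R) := ((1 - cos (p.2 * S p.1)) / p.2 ^+ 2)%:E.
have mDS : measurable_fun (D `*` half_line) (fun p : T * R => S p.1).
  apply: (measurable_comp mD) mS _; first by move=> _ [[x y] [? ?] <-].
  exact: measurable_funTS.
have minv : measurable_fun setT (fun t : R => t ^- 2).
  rewrite (_ : (fun t : R => t ^- 2) = (fun y => powR y (-1)) \o (fun t => t ^+ 2)).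
    by apply: measurableT_comp => //; exact: measurable_funX.
  by apply/funext => t /=; rewrite powR_inv1// sqr_ge0.
have mf : measurable_fun (D `*` half_line) f.
  apply/measurable_EFinP; apply: measurable_funM.
    apply: measurable_funB => //.
    apply: measurableT_comp; first exact: (continuous_measurable_fun (@continuous_cos R)).
    by apply: measurable_funM => //; exact: measurable_funTS.
  by apply: measurable_funTS; exact: (measurableT_comp minv).
have f0 z t : D z -> half_line t -> (0 <= f (z, t))%E.
  by move=> _ _; rewrite lee_fin divr_ge0 ?sqr_ge0 ?subr_ge0 ?cos_le1.
have key : (\int[mu]_(z in D) (`|S z| * (pi / 2))%:E = J%:E)%E.
  under eq_integral do rewrite -integral_one_sub_cos.
  rewrite (ge0_integral_swap mu leb mD mH mf f0) -hJ; apply: eq_integral => t.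
  (* At [t = 0] both integrands vanish, as [0^-1 = 0]; the hypothesis on [C] covers only [t > 0]. *)
  rewrite mem_itv_set/= andbT le_eqVlt => /predU1P[<-|t0].
    rewrite expr0n/= invr0 mulr0; apply: integral0_eq => z _.
    by rewrite /f/= expr0n/= invr0 mulr0.
  have h1 := has_integralB mD (has_integral_cst mD muD 1) (hC _ t0).
  have [_] := has_integralZ mD (t ^- 2) h1; rewrite mul1r (mulrC _ (M - _)) => <-.
  by apply: eq_integral => z _; rewrite /f/= mulrC.
have h2 : has_integral mu D (fun z => `|S z| * (pi / 2)) J.
  apply: ge0_has_integral => //.
    by apply: measurable_funM => //; exact: measurableT_comp.
  by move=> z _; rewrite mulr_ge0// divr_ge0// ltW.
apply: (has_integral_eq mD (has_integralZ mD (2 / pi) h2)) => z _.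
have e : 2 / pi * (pi / 2) = 1 :> R by rewrite mulrA divfK ?divff// gt_eqF.
by rewrite mulrCA e mulr1.
Qed.

Lemma areal_mahler_fourier m (phi : R -> R) (J : R) :
  (forall t, 0 < t -> has_integral area disc (fun z => cos (t * logratio z)) (pi * phi t)) ->
  has_integral leb half_line (fun t => (1 - phi t ^+ m * (4 / (4 + t ^+ 2))) / t ^+ 2) J ->
  areal_mahler (mahler_poly R m) = (pi^-1 * J - 4^-1)%:E.
Proof.
move=> hphi hJ; have p0 := pi_gt0 R; have mD := @measurable_unit_disc R.
have muDn := tuple_measure_power mD (@area_unit_disc R) m.+1.
have mY := measurable_funTS (D := disc) (@measurable_logratio R).
have mW := measurable_funTS (D := disc) (@measurable_lnmod R).
rewrite (@areal_mahler_polyE _ m (2 / pi * J)); last first.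
  rewrite (_ : pi ^+ m.+1 * (2 / pi * J) = 2 / pi * (pi ^+ m.+1 * J)); last by ring.
  have hS : measurable_fun (@tuple_power _ plane disc m.+1)
      (fun z => tuple_sum logratio z + lnmod (tnth z ord_max)).
    by apply: measurable_funD; [exact: measurable_tuple_sum|exact: measurable_tnth_comp].
  apply: (has_integral_fourier_norm (@measurable_tuple_power _ _ _ mD m.+1) muDn hS
    (C := fun t => pi ^+ m.+1 * (phi t ^+ m * (4 / (4 + t ^+ 2))))).
  - move=> t t0.
    have := has_integral_cos_tuple_sum mD (@area_unit_disc R) mY mW m (hphi _ t0)
      (has_integral_sin_logratio t) (has_integral_cos_lnmod t0).
    by congr has_integral; rewrite exprMn [pi ^+ m.+1]exprS; ring.
  - have mH : measurable (half_line : set (measurableTypeR R)) by exact: measurable_itv.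
    have [_ <-] := has_integralZ mH (pi ^+ m.+1) hJ.
    by apply: eq_integral => t _; congr (_%:E); ring.
have pn0 : (pi : R) != 0 by rewrite gt_eqF.
by congr (_%:E); rewrite mulrA mulrA mulVf ?mul1r// pnatr_eq0.
Qed.

End fourier.

Section domination.
Context d (T : measurableType d) (R : realType) (mu : {measure set T -> \bar R}).
Variable D : set T.
Hypothesis mD : measurable D.

Lemma has_integral_le (f g : T -> R) v w :
  has_integral mu D f v -> has_integral mu D g w ->
  (forall x, D x -> f x <= g x) -> v <= w.
Proof.
move=> hf hg fg; have [_] := has_integralB mD hg hf.
rewrite -subr_ge0 -lee_fin => <-; apply: integral_ge0 => x Dx.
by rewrite lee_fin subr_ge0 fg.
Qed.

Lemma dominated_has_integral (f g : T -> R) w :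
  measurable_fun D f -> has_integral mu D g w -> (forall x, D x -> `|f x| <= g x) ->
  exists2 v, has_integral mu D f v & `|v| <= w.
Proof.
move=> mf hg fg.
have intf : mu.-integrable D (EFin \o f).
  have [ig _] := hg; apply: (le_integrable mD) ig => //; first exact/measurable_EFinP.
  by move=> x Dx /=; rewrite lee_fin; apply: le_trans (fg x Dx) (ler_norm _).
have [v hv] := integrable_has_integral mD intf; exists v => //.
rewrite ler_norml lerNl; apply/andP; split.
  rewrite -mulN1r; apply: (has_integral_le (has_integralZ mD (-1) hv) hg) => x Dx.
  by rewrite mulN1r; apply: le_trans (fg x Dx); rewrite -normrN ler_norm.
apply: (has_integral_le hv hg) => x Dx.
by apply: le_trans (fg x Dx); rewrite ler_norm.
Qed.

End domination.

(** * Asymptotics of powers of a characteristic function *)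

Section half_line_integrals.
Context {R : realType}.
Notation leb := (@lebesgue_measure R).
Notation half_line := ([set` `[(0 : R), +oo[]).

Lemma measurable_half_line : measurable (half_line : set (measurableTypeR R)).
Proof. exact: measurable_itv. Qed.

Lemma has_integral_oneDsqrV :
  has_integral leb half_line (fun t => (1 + t ^+ 2)^-1) (pi / 2).
Proof.
apply: (@ge0_has_integral _ _ _ leb half_line).
- apply: measurable_funTS; apply: continuous_measurable_fun; exact: continuous_oneDsqrV.
- by move=> t _; rewrite invr_ge0 addr_ge0// sqr_ge0.
- exact: integral0y_oneDsqr.
Qed.

Lemma oneDsqr_neq0 (t : R) : 1 + t ^+ 2 != 0.
Proof. by rewrite gt_eqF// ltr_pwDl// sqr_ge0. Qed.

(** [f] may change sign. Adding [K / (1 + t^2)], which has primitive [K atan t], gives a nonnegative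
    integrand; the addition is removed afterwards. *)
Lemma has_integral_FTCy (f F : R -> R) (K l : R) :
  (forall t : R, 0 <= t -> `|f t| <= K / (1 + t ^+ 2)) -> continuous f ->
  (forall t : R, 0 <= t -> is_derive t (1 : R) F (f t)) ->
  F t @[t --> +oo] --> l -> has_integral leb half_line f (l - F 0).
Proof.
move=> fK cf dF Fl; have mH := measurable_half_line.
have h : has_integral leb half_line (fun t => f t + K / (1 + t ^+ 2))
    (l + K * (pi / 2) - (F 0 + K * atan 0)).
  have cg : continuous (fun t : R => f t + K / (1 + t ^+ 2)).
    move=> t; apply: cvgD; first exact: cf.
    apply: cvgM; [exact: cvg_cst|exact: continuous_oneDsqrV].
  have g0 (t : R) : 0 <= t -> 0 <= f t + K / (1 + t ^+ 2).
    by move=> /fK; rewrite ler_norml lerNl => /andP[]; lra.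
  apply: (@ge0_has_integral _ _ _ leb half_line).
  - by apply: measurable_funTS; exact: continuous_measurable_fun.
  - by move=> t; rewrite /= in_itv/= andbT; exact: g0.
  - have dG (t : R) : 0 <= t ->
        is_derive t (1 : R) (fun t => F t + K * atan t) (f t + K / (1 + t ^+ 2)).
      by move=> /dF ?; der_by; ring.
    have lG : (F t + K * atan t) @[t --> +oo] --> l + K * (pi / 2).
      apply: cvgD => //; apply: cvgM; [exact: cvg_cst|exact: cvgy_atan].
    by rewrite (integral_FTCy g0 (fun t _ => cg t) dG lG).
have := has_integralB mH h (has_integralZ mH K has_integral_oneDsqrV).
rewrite atan0 mulr0 addr0 [_ - F 0]addrAC addrK => h'.
by apply: (has_integral_eq mH h') => t _; rewrite addrK.
Qed.

Lemma integral_gauss_scale (w : R) : 0 < w ->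
  (\int[leb]_(t in half_line) (2 * w * expR (- (w * t) ^+ 2))%:E = (Num.sqrt pi)%:E)%E.
Proof.
move=> w0.
have h : (\int[leb]_(t in half_line) (2 * gauss_fun t)%:E = (Num.sqrt pi)%:E :> \bar R)%E.
  under eq_integral do rewrite EFinM.
  rewrite ge0_integralZl//=; last 2 first.
  - by apply/measurable_EFinP; apply: measurable_funTS; exact: measurable_gauss_fun.
  - by move=> t _; rewrite lee_fin gauss_fun_ge0.
  by rewrite integral0y_gauss -EFinM mulrC divfK.
rewrite -h; have F0 : *%R w 0 = 0 by rewrite mulr0.
have dF : derive1 ( *%R w : R -> R) = cst w.
  apply/funext => t; rewrite derive1E.
  have [_ ->] : is_derive t (1 : R) ( *%R w) (0 * t + w * 1).
    exact: der_mul (der_cst _ _) (der_id _).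
  by rewrite mul0r add0r mulr1.
rewrite -[in RHS]F0 (@increasing_ge0_integration_by_substitutiony R ( *%R w) (fun t => 2 * gauss_fun t) 0).
- apply: eq_integral => t _; rewrite dF/= /gauss_fun; congr (_%:E).
  by rewrite [RHS]mulrAC.
- by move=> x y _ _; rewrite ltr_pM2l.
- by rewrite dF => ? _; exact: cvg_cst.
- by rewrite dF; exact: is_cvg_cst.
- by rewrite dF; exact: is_cvg_cst.
- split; first by move=> x _.
  by apply: cvg_at_right_filter; exact: mulrl_continuous.
- by apply: gt0_cvgMry => //; exact: cvg_id.
- apply: continuous_subspaceT => x; apply: cvgM; [exact: cvg_cst|exact: continuous_gauss_fun].
- by move=> x _; rewrite mulr_ge0// gauss_fun_ge0.
Qed.

Lemma has_integral_gauss (lam : R) : 0 < lam ->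
  has_integral leb half_line (fun t => expR (- (lam * t ^+ 2))) (Num.sqrt (pi / lam) / 2).
Proof.
move=> l0; have mH := measurable_half_line; have s0 : 0 < Num.sqrt lam by rewrite sqrtr_gt0.
have h : has_integral leb half_line
    (fun t => 2 * Num.sqrt lam * expR (- (Num.sqrt lam * t) ^+ 2)) (Num.sqrt pi).
  apply: (@ge0_has_integral _ _ _ leb half_line).
  - apply: measurable_funTS; apply: continuous_measurable_fun => t.
    by eapply is_derive_continuous; der.
  - by move=> t _; rewrite !mulr_ge0 ?expR_ge0// ltW.
  - exact: integral_gauss_scale.
have := has_integralZ mH (2 * Num.sqrt lam)^-1 h.
rewrite sqrtrM ?pi_ge0// sqrtrV ?ltW// (_ : _ * Num.sqrt pi = Num.sqrt pi / Num.sqrt lam / 2); last first.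
  by rewrite invfM mulrC mulrA mulrAC.
move=> h'; apply: (has_integral_eq mH h') => t _.
by rewrite mulKf ?exprMn ?sqr_sqrtr ?ltW// gt_eqF// mulr_gt0.
Qed.

(** Integration by parts: [- t exp (- lam t^2)] vanishes at both ends, and its derivative [f]
    combines this integrand with the Gaussian. *)
Lemma has_integral_sqr_gauss (lam : R) : 0 < lam ->
  has_integral leb half_line (fun t => t ^+ 2 * expR (- (lam * t ^+ 2)))
    (Num.sqrt (pi / lam) / (4 * lam)).
Proof.
move=> l0; have mH := measurable_half_line; have ln0 : lam != 0 by rewrite gt_eqF.
have bnd n (t : R) : t ^+ n.*2 * expR (- (lam * t ^+ 2)) <= n`!%:R / lam ^+ n.
  by rewrite -mul2n exprM exprM_expRN_le// sqr_ge0.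
pose f t := (2 * lam) * (t ^+ 2 * expR (- (lam * t ^+ 2))) - expR (- (lam * t ^+ 2)).
pose K := (2 * lam) * (lam^-1 + 2 / lam ^+ 2) + (1 + lam^-1).
have fK (t : R) : 0 <= t -> `|f t| <= K / (1 + t ^+ 2).
  move=> _; rewrite ler_pdivlMr ?ltr_pwDl ?sqr_ge0//.
  have := bnd 0 t; have := bnd 1 t; have := bnd 2 t.
  rewrite /f /K !doubleS double0 !factS fact0 !muln1 expr0 !expr1 !mul1r invr1.
  have := expR_ge0 (- (lam * t ^+ 2)); set e := expR _ => e0 h2 h1 h0.
  apply: (@le_trans _ _ ((2 * lam * (t ^+ 2 * e) + e) * (1 + t ^+ 2))).
    rewrite ler_wpM2r ?addr_ge0 ?sqr_ge0//; apply: le_trans (ler_normB _ _) _.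
    have l0' := ltW l0; have t2 := sqr_ge0 t.
    by rewrite [ `|e| ]ger0_norm// ger0_norm// mulr_ge0// mulr_ge0.
  rewrite (_ : _ * (1 + t ^+ 2) =
    (2 * lam) * (t ^+ 2 * e + t ^+ 4 * e) + (e + t ^+ 2 * e)); last by ring.
  by rewrite lerD ?lerD// ler_pM2l ?mulr_gt0// lerD.
have cf : continuous f.
  by move=> t; rewrite /f; eapply is_derive_continuous; der.
have dF (t : R) : 0 <= t -> is_derive t (1 : R) (fun t => - (t * expR (- (lam * t ^+ 2)))) (f t).
  by move=> _; der_by; rewrite /f; ring.
have lF : (- (t * expR (- (lam * t ^+ 2)))) @[t --> +oo] --> 0.
  apply: (@cvgy_le_inv _ _ lam^-1) => t t1; rewrite normrN ger0_norm; last first.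
    by rewrite mulr_ge0 ?expR_ge0//; lra.
  rewrite ler_pdivlMr; last by lra.
  by have := bnd 1 t; rewrite doubleS double0 factS fact0 muln1 expr1 mul1r; apply: le_trans; rewrite le_eqVlt; apply/orP; left; apply/eqP; ring.
have h := has_integral_FTCy fK cf dF lF.
have h' := has_integralD mH h (has_integral_gauss l0).
have := has_integralZ mH (2 * lam)^-1 h'.
rewrite mul0r oppr0 subrr add0r => h2.
rewrite (_ : _ / (4 * lam) = (2 * lam)^-1 * (Num.sqrt (pi / lam) / 2)); last by field.
by apply: (has_integral_eq mH h2) => t _; rewrite /f subrK mulKf// mulf_neq0.
Qed.


Lemma measurable_sqrV : measurable_fun setT (fun t : R => t ^- 2).
Proof.
rewrite (_ : (fun t : R => t ^- 2) = (fun y => powR y (-1)) \o (fun t => t ^+ 2)).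
  by apply: measurableT_comp => //; exact: measurable_funX.
by apply/funext => t /=; rewrite powR_inv1// sqr_ge0.
Qed.

(** The integrand is the integral of [2 w exp (- (w t)^2)] over [w] in []0, sqrt lam]]. By
    [integral_gauss_scale] the integral over [t] is [sqrt pi] for every such [w], so Tonelli gives
    the length [sqrt lam] times [sqrt pi]. *)
Lemma has_integral_one_sub_gauss (lam : R) : 0 < lam ->
  has_integral leb half_line (fun t => (1 - expR (- (lam * t ^+ 2))) / t ^+ 2)
    (Num.sqrt pi * Num.sqrt lam).
Proof.
move=> l0; have s0 : 0 < Num.sqrt lam by rewrite sqrtr_gt0.
set s := Num.sqrt lam in s0 *; have ls : lam = s ^+ 2 by rewrite sqr_sqrtr// ltW.
pose H : set (measurableTypeR R) := [set` `]0, +oo[].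
pose W : set (measurableTypeR R) := [set` `]0, s]].
pose f (p : measurableTypeR R * measurableTypeR R) : \bar R :=
  (2 * p.2 * expR (- (p.2 * p.1) ^+ 2))%:E.
have mH : measurable H by exact: measurable_itv.
have mW : measurable W by exact: measurable_itv.
have me (mu' : R) : measurable_fun setT (fun t : R => expR (- (mu' * t ^+ 2))).
  by apply: continuous_measurable_fun => t; eapply is_derive_continuous; der.
have mh : measurable_fun setT (fun t : R => (1 - expR (- (lam * t ^+ 2))) / t ^+ 2).
  by apply: measurable_funM; [exact: measurable_funB|exact: measurable_sqrV].
apply: (@ge0_has_integral _ _ _ leb half_line).
- exact: measurable_funTS.
- move=> t _; rewrite divr_ge0 ?sqr_ge0// subr_ge0 expR_le1 oppr_le0.
  by rewrite mulr_ge0 ?sqr_ge0// ltW.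
have mf : measurable_fun (H `*` W) f.
  apply: measurable_funTS; apply/measurable_EFinP; apply: measurable_funM.
    by apply: measurable_funM.
  apply: measurableT_comp => //; apply: measurable_funN; apply: measurable_funX.
  exact: measurable_funM.
have f0 t w : H t -> W w -> (0 <= f (t, w))%E.
  move=> _; rewrite /W/= in_itv/= => /andP[w0 _].
  by rewrite lee_fin mulr_ge0 ?expR_ge0// mulr_ge0// ltW.
transitivity (\int[leb]_(t in H) \int[leb]_(w in W) f (t, w))%E.
  rewrite -integral_itv_obnd_cbnd; last by apply/measurable_EFinP; exact: measurable_funTS.
  apply: eq_integral => t; rewrite mem_itv_set/= andbT => t0.
  have F (w : R) : 0 <= w <= s -> is_derive w (1 : R)
      (fun w => - expR (- (w * t) ^+ 2) / t ^+ 2) (2 * w * expR (- (w * t) ^+ 2)).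
    by move=> _; der_by; rewrite expr1; field; rewrite gt_eqF.
  have cf (w : R) : 0 <= w <= s -> {for w, continuous (fun w : R => 2 * w * expR (- (w * t) ^+ 2))}.
    by move=> _; eapply is_derive_continuous; der.
  rewrite /W /f/= integral_itv_obnd_cbnd; last first.
    apply/measurable_EFinP; apply: measurable_funTS; apply: continuous_measurable_fun => w.
    by eapply is_derive_continuous; der.
  rewrite (integral_FTC_for (ltW s0) cf F); congr (_%:E).
  rewrite mul0r expr0n oppr0 expR0 exprMn -ls; field; by rewrite gt_eqF.
rewrite (ge0_integral_swap leb leb mH mW mf f0).
rewrite (eq_integral (fun=> (Num.sqrt pi)%:E)); last first.
  move=> w; rewrite mem_itv_set/= => /andP[w0 _].
  rewrite -(integral_gauss_scale w0) /H /f/= integral_itv_obnd_cbnd//.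
  apply/measurable_EFinP; apply: measurable_funTS; apply: continuous_measurable_fun => t.
  by eapply is_derive_continuous; der.
by rewrite integral_cst//= /W lebesgue_measure_itv/= lte_fin s0 sube0 -EFinM.
Qed.

End half_line_integrals.

(** * Alternating Taylor bounds for exp, sin and cos *)

Section taylor.
Context {R : realType}.
Implicit Types x y : R.

Lemma der_ge0_le (f df : R -> R) x : 0 <= x ->
  (forall y, 0 <= y -> is_derive y (1 : R) f (df y)) ->
  (forall y, 0 <= y -> 0 <= df y) -> f 0 <= f x.
Proof.
rewrite le_eqVlt => /predU1P[<- //|x0] dF df0.
have [y||c /andP[c0 _] e] := MVT_segment (ltW x0) (f := f) (df := df).
- by rewrite in_itv/= => /andP[/ltW /dF].
- apply: continuous_in_subspaceT => y /[!inE]/=; rewrite in_itv/= => /andP[/dF h _].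
  exact: is_derive_continuous h.
- by rewrite -subr_ge0 e mulr_ge0 ?df0// subr_ge0 ltW.
Qed.

(** Each bound in this section comes from an earlier one by integration: the difference vanishes at
    0 and its derivative is the difference of that bound. *)
Lemma expRN_le2 x : 0 <= x -> expR (- x) <= 1 - x + x ^+ 2 / 2.
Proof.
move=> x0; rewrite -subr_ge0.
have /= := @der_ge0_le (fun x => 1 - x + x ^+ 2 / 2 - expR (- x))
  (fun x => - 1 + x + expR (- x)) x x0.
rewrite ?expr0n/= ?(oppr0, expR0, sin0, cos0, mul0r, addr0, subrr); apply.
  by move=> y _; der_by; field.
by move=> y _; have := expR_ge1Dx (- y); lra.
Qed.

Lemma expRN_ge3 x : 0 <= x -> 1 - x + x ^+ 2 / 2 - x ^+ 3 / 6 <= expR (- x).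
Proof.
move=> x0; rewrite -subr_ge0.
have /= := @der_ge0_le (fun x => expR (- x) - (1 - x + x ^+ 2 / 2 - x ^+ 3 / 6))
  (fun x => 1 - x + x ^+ 2 / 2 - expR (- x)) x x0.
rewrite ?expr0n/= ?(oppr0, expR0, sin0, cos0, mul0r, addr0, subrr); apply.
  by move=> y _; der_by; field.
by move=> y /expRN_le2; rewrite subr_ge0.
Qed.

Lemma sin_le_id x : 0 <= x -> sin x <= x.
Proof.
move=> x0; rewrite -subr_ge0.
have /= := @der_ge0_le (fun x => x - sin x) (fun x => 1 - cos x) x x0.
rewrite ?expr0n/= ?(oppr0, expR0, sin0, cos0, mul0r, addr0, subrr); apply.
by move=> y _; rewrite subr_ge0 cos_le1.
Qed.

Lemma cos_ge2 x : 0 <= x -> 1 - x ^+ 2 / 2 <= cos x.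
Proof.
move=> x0; rewrite -subr_ge0.
have /= := @der_ge0_le (fun x => cos x - (1 - x ^+ 2 / 2)) (fun x => x - sin x) x x0.
rewrite ?expr0n/= ?(oppr0, expR0, sin0, cos0, mul0r, addr0, subrr); apply.
  by move=> y _; der_by; field.
by move=> y /sin_le_id; rewrite subr_ge0.
Qed.

Lemma sin_ge3 x : 0 <= x -> x - x ^+ 3 / 6 <= sin x.
Proof.
move=> x0; rewrite -subr_ge0.
have /= := @der_ge0_le (fun x => sin x - (x - x ^+ 3 / 6))
  (fun x => cos x - (1 - x ^+ 2 / 2)) x x0.
rewrite ?expr0n/= ?(oppr0, expR0, sin0, cos0, mul0r, addr0, subrr); apply.
  by move=> y _; der_by; field.
by move=> y /cos_ge2; rewrite subr_ge0.
Qed.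

Lemma cos_le4 x : 0 <= x -> cos x <= 1 - x ^+ 2 / 2 + x ^+ 4 / 24.
Proof.
move=> x0; rewrite -subr_ge0.
have /= := @der_ge0_le (fun x => 1 - x ^+ 2 / 2 + x ^+ 4 / 24 - cos x)
  (fun x => sin x - (x - x ^+ 3 / 6)) x x0.
rewrite ?expr0n/= ?(oppr0, expR0, sin0, cos0, mul0r, addr0, subrr); apply.
  by move=> y _; der_by; field.
by move=> y /sin_ge3; rewrite subr_ge0.
Qed.

Lemma sin_le5 x : 0 <= x -> sin x <= x - x ^+ 3 / 6 + x ^+ 5 / 120.
Proof.
move=> x0; rewrite -subr_ge0.
have /= := @der_ge0_le (fun x => x - x ^+ 3 / 6 + x ^+ 5 / 120 - sin x)
  (fun x => 1 - x ^+ 2 / 2 + x ^+ 4 / 24 - cos x) x x0.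
rewrite ?expr0n/= ?(oppr0, expR0, sin0, cos0, mul0r, addr0, subrr); apply.
  by move=> y _; der_by; field.
by move=> y /cos_le4; rewrite subr_ge0.
Qed.

Lemma cos_ge6 x : 0 <= x -> 1 - x ^+ 2 / 2 + x ^+ 4 / 24 - x ^+ 6 / 720 <= cos x.
Proof.
move=> x0; rewrite -subr_ge0.
have /= := @der_ge0_le (fun x => cos x - (1 - x ^+ 2 / 2 + x ^+ 4 / 24 - x ^+ 6 / 720))
  (fun x => x - x ^+ 3 / 6 + x ^+ 5 / 120 - sin x) x x0.
rewrite ?expr0n/= ?(oppr0, expR0, sin0, cos0, mul0r, addr0, subrr); apply.
  by move=> y _; der_by; field.
by move=> y /sin_le5; rewrite subr_ge0.
Qed.

Lemma cos_taylor4 x : `|cos x - (1 - x ^+ 2 / 2 + x ^+ 4 / 24)| <= x ^+ 6 / 720.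
Proof.
have main y : 0 <= y -> `|cos y - (1 - y ^+ 2 / 2 + y ^+ 4 / 24)| <= y ^+ 6 / 720.
  move=> y0; have := cos_le4 y0; have := cos_ge6 y0.
  have : 0 <= y ^+ 6 by exact: exprn_ge0.
  by rewrite ler_norml; lra.
have [x0|/ltW x0] := leP 0 x; first exact: main.
have := main (- x); rewrite oppr_ge0 cosN => /(_ x0).
have -> : (- x) ^+ 2 = x ^+ 2 by ring.
have -> : (- x) ^+ 4 = x ^+ 4 by ring.
by have -> : (- x) ^+ 6 = x ^+ 6 by ring.
Qed.

End taylor.

Ltac nonneg := repeat first [ done | exact: ltW | exact: sqr_ge0 | exact: expR_ge0
  | exact: normr_ge0 | apply: addr_ge0 | apply: mulr_ge0 | rewrite invr_ge0
  | apply: exprn_ge0 ].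

Section power_estimate.
Context {R : realType}.

(* The factor [r] on the left makes the induction start at [n = 0]. *)
Lemma power_perturbation (a e x r : R) (B : R) n : 0 <= r -> r <= 1 -> 0 <= e -> e <= r ->
  `|a| <= r -> e * (1 + `|x|) <= r -> `|a - e * (1 + x)| <= B ->
  r * `|a ^+ n - e ^+ n * (1 + n%:R * x)| <= r ^+ n * (n%:R * B + n%:R ^+ 2 * x ^+ 2).
Proof.
move=> r0 r1 e0 er ar exr aB; have B0 : 0 <= B by apply: le_trans aB.
(* Through [|1 + m x| <= (1 + |x|)^m]. *)
have enr m : e ^+ m * `|1 + m%:R * x| <= r ^+ m.
  apply: (@le_trans _ _ (e ^+ m * (1 + `|x|) ^+ m)); last first.
    by rewrite -exprMn lerXn2r// nnegrE mulr_ge0// addr_ge0.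
  rewrite ler_wpM2l ?exprn_ge0//; elim: m => [|m IHm]; first by rewrite mul0r addr0 expr0 normr1.
  rewrite exprSr mulrDr mulr1 (_ : _ + _ = (1 + m%:R * x) + x); last by rewrite mulrSr; ring.
  apply: le_trans (ler_normD _ _) _; apply: lerD => //.
  by rewrite ler_peMl// exprn_ege1// lerDl.
elim: n => [|n IHn]; first by rewrite !expr0 !mul0r expr0n !addr0/= mulr1 subrr normr0 mulr0 mul0r.
(* The last summand compensates the term [n x^2] in [(1 + n x)(1 + x) = 1 + (n + 1) x + n x^2]. *)
rewrite (_ : a ^+ n.+1 - _ = a * (a ^+ n - e ^+ n * (1 + n%:R * x)) +
  e ^+ n * (1 + n%:R * x) * (a - e * (1 + x)) + e ^+ n.+1 * (n%:R * x ^+ 2)); last first.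
  by rewrite !exprS mulrSr; ring.
apply: (@le_trans _ _ (r * (r ^+ n * (n%:R * B + n%:R ^+ 2 * x ^+ 2) +
    r ^+ n * B + r ^+ n * (n%:R * x ^+ 2)))); last first.
  rewrite -!mulrDr mulrA -exprS ler_wpM2l ?exprn_ge0// mulrSr.
  have := ler0n R n; have := sqr_ge0 x; nra.
rewrite ler_wpM2l//; apply: le_trans (ler_normD _ _) _; apply: lerD; last first.
  have n0 : 0 <= n%:R * x ^+ 2 by rewrite mulr_ge0// sqr_ge0.
  rewrite normrM [ `|n%:R * _| ]ger0_norm// ler_wpM2r// ger0_norm ?exprn_ge0// exprS.
  apply: (@le_trans _ _ (e ^+ n)); last by rewrite lerXn2r// nnegrE.
  by rewrite ler_piMl ?exprn_ge0// (le_trans er).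
apply: le_trans (ler_normD _ _) _; apply: lerD.
  by apply: le_trans IHn; rewrite normrM ler_wpM2r.
rewrite !normrM [ `|e ^+ n| ]ger0_norm ?exprn_ge0//.
by apply: ler_pM => //; rewrite mulr_ge0// exprn_ge0.
Qed.

(** Half of the exponential absorbs the power of [x], the other half decays faster than
    [1 / (1 + t^2)]. It will serve with [x = n t^2]. *)
Lemma exprM_gauss_le (c x t : R) j : 0 < c -> t ^+ 2 <= x ->
  x ^+ j * expR (- (c * x)) <= j`!%:R / (c / 2) ^+ j * (1 + 2 / c) / (1 + t ^+ 2).
Proof.
move=> c0 tx; have t0 := sqr_ge0 t; have x0 := le_trans t0 tx; have c20 : 0 < c / 2 by lra.
rewrite (_ : - (c * x) = - (c / 2 * x) - c / 2 * x); last by field.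
rewrite expRD mulrA -[leRHS]mulrA; apply: ler_pM.
- by rewrite mulr_ge0 ?expR_ge0// exprn_ge0.
- exact: expR_ge0.
- exact: exprM_expRN_le.
rewrite ler_pdivlMr; last by lra.
have h1 := exprM_expRN_le 1 c20 x0; have h0 := exprM_expRN_le 0 c20 x0.
have : expR (- (c / 2 * x)) * (1 + t ^+ 2) <= expR (- (c / 2 * x)) * (1 + x).
  by rewrite ler_wpM2l ?expR_ge0// lerD2l.
move=> /le_trans; apply; rewrite mulrDr mulr1 [expR _ * x]mulrC; apply: lerD.
  by move: h0; rewrite !expr0 fact0 mul1r divr1.
by move: h1; rewrite !expr1 factS fact0 muln1 (_ : 1 / (c / 2) = 2 / c)//; field; rewrite gt_eqF.
Qed.

(** By [q <= exp (- (1 - q))] and [y exp (- y) <= 1]. *)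
Lemma exprn_le_inv (q : R) n : 0 <= q -> q < 1 -> (0 < n)%N ->
  q ^+ n <= (1 - q)^-1 / n%:R.
Proof.
move=> q0 q1 n0; have h : 0 < 1 - q by rewrite subr_gt0.
rewrite ler_pdivlMr ?ltr0n// mulrC.
have := exprM_expRN_le 1 h (ler0n R n).
rewrite !expr1 factS fact0 muln1 mul1r; apply: le_trans; rewrite ler_wpM2l//.
rewrite [_ * n%:R]mulrC -mulrN expRM_natl lerXn2r// ?nnegrE ?expR_ge0//.
by have := expR_ge1Dx (- (1 - q)); rewrite opprB addrC subrK.
Qed.

End power_estimate.

Section integral_half_line.
Context {R : realType}.
Notation leb := (@lebesgue_measure R).
Notation half_line := ([set` `[(0 : R), +oo[]).

Lemma has_integral_off0 (f g : R -> R) w : has_integral leb half_line f w ->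
  measurable_fun setT g -> (forall t, 0 < t -> f t = g t) ->
  has_integral leb half_line g w.
Proof.
move=> hf mg fg; have mf := has_integral_measurable hf; have [/integrableP[_ intf] fw] := hf.
have mf' : measurable_fun ([set` `](0 : R), +oo[]) f.
  apply: (measurable_funS _ _ mf); first exact: measurable_itv.
  by move=> t; rewrite /= !in_itv/= !andbT; exact: ltW.
split.
  apply/integrableP; split; first by apply: measurable_funTS; apply/measurable_EFinP.
  rewrite (_ : (\int[leb]_(x in _) _)%E = (\int[leb]_(x in half_line) `|(f x)%:E|)%E)//.
  rewrite -integral_itv_obnd_cbnd; last first.
    by apply: measurable_funTS; apply: measurableT_comp => //; apply/measurable_EFinP.
  rewrite -integral_itv_obnd_cbnd; last first.
    by apply: measurableT_comp => //; apply/measurable_EFinP.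
  by apply: eq_integral => t; rewrite mem_itv_set/= andbT => t0; rewrite fg.
rewrite -fw -integral_itv_obnd_cbnd; last by apply: measurable_funTS; apply/measurable_EFinP.
rewrite -integral_itv_obnd_cbnd; last exact/measurable_EFinP.
by apply: eq_integral => t; rewrite mem_itv_set/= andbT => t0; rewrite fg.
Qed.

End integral_half_line.

(** * Edgeworth approximation of a power of a characteristic function *)

Section characteristic_function_power.
Context {R : realType}.
Variables (phi : R -> R) (v k M : R).
Hypothesis v0 : 0 < v.
Hypothesis phi4 : forall t, 0 <= t ->
  `|phi t - (1 - v * t ^+ 2 / 2 + (v ^+ 2 / 8 + k) * t ^+ 4)| <= M * t ^+ 6.
Hypothesis phiq : forall d, 0 < d ->
  exists q, [/\ 0 <= q, q < 1 & forall t, d <= t -> `|phi t| <= q].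

Let E (t : R) := expR (- (v * t ^+ 2 / 2)).
Let rho (t : R) := expR (- (v / 4 * t ^+ 2)).
Let N := `|M| + v ^+ 3 / 48 + `|k| * v / 2.

(** The Gaussian already accounts for the coefficient [v^2 / 8] of [t^4], so only [k] is left. In
    [N], the term [v^3 / 48] is the cubic Taylor error of the Gaussian at [v t^2 / 2], and
    [|k| v / 2] the cost of multiplying [k t^4] by [E t]. *)
Let phiE t : 0 <= t -> `|phi t - E t * (1 + k * t ^+ 4)| <= N * t ^+ 6.
Proof.
move=> t0; have x0 : 0 <= v * t ^+ 2 / 2 by rewrite divr_ge0// mulr_ge0 ?sqr_ge0// ltW.
have u2 := expRN_le2 x0; have u3 := expRN_ge3 x0; have u1 := expR_ge1Dx (- (v * t ^+ 2 / 2)).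
have u0 : E t <= 1 by rewrite expR_le1 oppr_le0.
rewrite -/(E t) in u1 u2 u3.
rewrite (_ : phi t - _ = (phi t - (1 - v * t ^+ 2 / 2 + (v ^+ 2 / 8 + k) * t ^+ 4)) +
  (1 - v * t ^+ 2 / 2 + (v * t ^+ 2 / 2) ^+ 2 / 2 - E t) + k * t ^+ 4 * (1 - E t)); last by field.
have t60 : 0 <= t ^+ 6 by exact: exprn_ge0.
rewrite [leRHS]mulrDl [X in _ <= X + _]mulrDl; apply: le_trans (ler_normD _ _) (lerD _ _).
  apply: le_trans (ler_normD _ _) (lerD _ _).
    by apply: le_trans (phi4 t0) _; rewrite ler_wpM2r// ler_norm.
  rewrite ger0_norm ?subr_ge0// (_ : v ^+ 3 / 48 * t ^+ 6 = (v * t ^+ 2 / 2) ^+ 3 / 6); last by field.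
  by move: u3; lra.
rewrite normrM [ `|k * _| ]normrM [ `|t ^+ 4| ]ger0_norm ?exprn_ge0// [ `|1 - _| ]ger0_norm ?subr_ge0//.
rewrite (_ : `|k| * v / 2 * t ^+ 6 = `|k| * t ^+ 4 * (v * t ^+ 2 / 2)); last by field.
rewrite ler_wpM2l ?mulr_ge0 ?exprn_ge0//; by move: u1; lra.
Qed.

(** [rho] is a Gaussian with half the exponent of [E]. The spare [v t^2 / 4] absorbs the terms of
    higher order once [t^2] is below a constant, so [rho] dominates both [phi] and its
    approximation; this is what [power_perturbation] requires. *)
Let small : exists2 d, 0 < d & forall t, 0 <= t -> t <= d ->
  [/\ t <= 1, `|phi t| <= rho t & E t * (1 + `|k * t ^+ 4|) <= rho t].
Proof.
pose A := `|v ^+ 2 / 8 + k| + `|M|.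
have A0 : 0 <= A by rewrite addr_ge0.
pose e := Num.min 1 (Num.min (v / 4 / (A + `|k| + 1)) (v^-1)).
have Ak : 0 < A + `|k| + 1 by rewrite ltr_wpDl// addr_ge0.
have e0 : 0 < e by rewrite !lt_min ltr01 invr_gt0 v0 !divr_gt0.
exists (Num.sqrt e); first by rewrite sqrtr_gt0.
move=> t t0 te; have : t ^+ 2 <= e.
  by rewrite -(sqr_sqrtr (ltW e0)) lerXn2r// nnegrE sqrtr_ge0.
have t2 := sqr_ge0 t; set x := t ^+ 2 in t2 *.
have t4 : t ^+ 4 = x ^+ 2 by rewrite -exprM.
have t6 : t ^+ 6 = x ^+ 3 by rewrite -exprM.
rewrite /e !le_min => /and3P[x1 xA xv].
have {xA} xA : (A + `|k| + 1) * x <= v / 4 by move: xA; rewrite ler_pdivlMr// mulrC.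
have {xv} xv : v * x <= 1 by move: xv; rewrite -(mulr1 v^-1) ler_pdivlMl.
have Ax : A * x <= v / 4 by have := normr_ge0 k; nra.
have kx : `|k| * x <= v / 4 by nra.
split; first by rewrite -(@ler_pXn2r _ 2)// ?nnegrE// expr1n.
- have r1 : 1 - v / 4 * x <= rho t by have := expR_ge1Dx (- (v / 4 * x)).
  have := phi4 t0; rewrite t4 t6 -/x.
  have AA : `|(v ^+ 2 / 8 + k) * x ^+ 2| + M * x ^+ 3 <= A * x ^+ 2.
    rewrite normrM [ `|x ^+ 2| ]ger0_norm ?sqr_ge0// mulrDl lerD2l.
    apply: (@le_trans _ _ (`|M| * x ^+ 3)); first by rewrite ler_wpM2r ?exprn_ge0// ler_norm.
    by rewrite ler_wpM2l// exprS ler_piMl ?sqr_ge0.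
  have AB : A * x ^+ 2 <= v / 4 * x by rewrite expr2 mulrA ler_wpM2r.
  move: AA; set y := (_ + k) * _; have := ler_norm y; have := ler_norm (- y).
  by rewrite normrN !ler_norml; move=> *; apply/andP; split; lra.
- rewrite t4 normrM [ `|x ^+ 2| ]ger0_norm ?sqr_ge0//.
  apply: (@le_trans _ _ (E t * expR (`|k| * x ^+ 2))).
    by rewrite ler_wpM2l ?expR_ge0// expR_ge1Dx.
  rewrite -expRD ler_expR -/x.
  have : `|k| * x ^+ 2 <= v / 4 * x by rewrite expr2 mulrA ler_wpM2r.
  by move: (`|k| * x ^+ 2) => y; lra.
Qed.

Let G j := j`!%:R / (v / 4 / 2) ^+ j * (1 + 2 / (v / 4)).

Let rhoG j n t : (0 < n)%N -> (n%:R * t ^+ 2) ^+ j * rho t ^+ n <= G j / (1 + t ^+ 2).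
Proof.
move=> n0; rewrite -expRM_natl (_ : n%:R * - _ = - (v / 4 * (n%:R * t ^+ 2))); last by ring.
by apply: exprM_gauss_le; [rewrite divr_gt0|rewrite ler_peMl ?sqr_ge0// ler1n].
Qed.

Let G0 j : 0 <= G j.
Proof. by rewrite /G mulr_ge0 ?addr_ge0 ?divr_ge0 ?exprn_ge0 ?divr_ge0// ltW. Qed.

Let E_le_rho t : E t <= rho t.
Proof. by rewrite ler_expR; have := sqr_ge0 t; have := v0; nra. Qed.

(** For [t <= d], [power_perturbation] applies with [x = k t^4] and [B = N t^6]; powers of [n t^2]
    are absorbed by [rho^n], which leaves the factor [t^2 / n]. For [t > d], [q^n] is [O(1/n)] and
    the Gaussian terms are bounded one by one. The shape [t^2 / (1 + t^2)] anticipates the division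
    by [t^2]. *)
Lemma power_gauss_estimate : exists C, forall n t, (0 < n)%N -> 0 < t ->
  `|phi t ^+ n * (4 / (4 + t ^+ 2)) - E t ^+ n * (1 + n%:R * (k * t ^+ 4) - t ^+ 2 / 4)| <=
  C / n%:R * (t ^+ 2 / (1 + t ^+ 2)).
Proof.
have [d d0 sm] := small; have [q [q0 q1 hq]] := phiq d0.
pose C1 := expR (v / 4) * (N * G 2 + k ^+ 2 * G 3) + (G 1 / 16 + `|k| / 4 * G 2).
pose C2 := 4 * (1 - q)^-1 / d ^+ 2 + (G 1 / d ^+ 4 + `|k| / d ^+ 2 * G 2 + G 1 / (4 * d ^+ 2)).
have r0 t : 0 <= rho t by exact: expR_ge0.
have r1 t : rho t <= 1 by rewrite expR_le1 oppr_le0 mulr_ge0 ?sqr_ge0 ?divr_ge0// ltW.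
have e0 t : 0 <= E t by exact: expR_ge0.
have Enr n t : E t ^+ n <= rho t ^+ n by rewrite lerXn2r// nnegrE.
have N0 : 0 <= N.
  by rewrite /N !addr_ge0 ?divr_ge0 ?mulr_ge0 ?exprn_ge0// ltW.
have C10 : 0 <= C1.
  by have := G0; rewrite /C1 => ?; nonneg.
have C20 : 0 <= C2.
  have q10 : 0 <= (1 - q)^-1 by rewrite invr_ge0 subr_ge0 ltW.
  by have := G0; rewrite /C2 => ?; nonneg.
exists (C1 + C2) => n t n0 t0; have nn0 : (0 : R) < n%:R by rewrite ltr0n.
have tn0 : t != 0 by rewrite gt_eqF.
have nR0 : n%:R != 0 :> R by rewrite gt_eqF.
have t2 : 0 <= t ^+ 2 by exact: sqr_ge0.
have p0 : 0 <= 4 / (4 + t ^+ 2) by rewrite divr_ge0 ?addr_ge0.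
have p1 : 4 / (4 + t ^+ 2) <= 1 by rewrite ler_pdivrMr; lra.
have T0 : 0 <= t ^+ 2 / n%:R by rewrite divr_ge0.
rewrite (_ : _ / n%:R * _ = t ^+ 2 / n%:R * ((C1 + C2) / (1 + t ^+ 2))); last first.
  by field; rewrite nR0 oneDsqr_neq0.
have [td|dt] := leP t d.
- apply: (@le_trans _ _ (t ^+ 2 / n%:R * (C1 / (1 + t ^+ 2)))); last first.
    by rewrite ler_wpM2l// ler_wpM2r ?lerDl// invr_ge0 addr_ge0.
  have [t1 pr er] := sm t (ltW t0) td.
  have := power_perturbation n (r0 t) (r1 t) (e0 t) (E_le_rho t) pr er (phiE (ltW t0)).
  set D := phi t ^+ n - _ => hD.
  (* The factor [rho t] in [power_perturbation] is at least [exp (- v / 4)], as [t <= 1]. *)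
  have {}hD : `|D| <= expR (v / 4) * (rho t ^+ n * (n%:R * (N * t ^+ 6) + n%:R ^+ 2 * (k * t ^+ 4) ^+ 2)).
    rewrite -ler_pdivrMl ?expR_gt0// -expRN; apply: le_trans hD; rewrite ler_wpM2r// ler_expR lerN2.
    have t21 : t ^+ 2 <= 1 by rewrite exprn_ile1// ltW.
    by rewrite ler_piMr// divr_ge0// ltW.
  (* Besides [D psi] there remains [E^n] times [(1 + n k t^4) psi - (1 + n k t^4 - t^2 / 4)], where
     [psi = 4 / (4 + t^2)]. *)
  rewrite (_ : _ - _ = D * (4 / (4 + t ^+ 2)) + E t ^+ n * (t ^+ 4 / (4 * (4 + t ^+ 2)) -
      n%:R * k * t ^+ 6 / (4 + t ^+ 2))); last first.
    by rewrite /D; field; rewrite gt_eqF// ltr_pwDl.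
  rewrite /C1 [X in _ <= _ * X]mulrDl [leRHS]mulrDr; apply: le_trans (ler_normD _ _) (lerD _ _).
    rewrite normrM [ `|4 / _| ]ger0_norm//; apply: (@le_trans _ _ `|D|); first by rewrite ler_piMr.
    apply: le_trans hD _.
    rewrite [leLHS](_ : _ = t ^+ 2 / n%:R * (expR (v / 4) *
      (N * ((n%:R * t ^+ 2) ^+ 2 * rho t ^+ n) + k ^+ 2 * ((n%:R * t ^+ 2) ^+ 3 * rho t ^+ n)))).
      rewrite ler_wpM2l// -[leRHS]mulrA ler_wpM2l ?expR_ge0// [leRHS]mulrDl.
      rewrite -[N * G 2 / _]mulrA -[k ^+ 2 * G 3 / _]mulrA.
      by apply: lerD; rewrite ler_wpM2l ?sqr_ge0// rhoG.
    by field.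
  rewrite normrM ger0_norm ?exprn_ge0//.
  apply: (@le_trans _ _ (rho t ^+ n * (t ^+ 4 / 16 + n%:R * `|k| * t ^+ 6 / 4))).
    apply: ler_pM; rewrite ?exprn_ge0//; apply: le_trans (ler_normB _ _) _; apply: lerD.
      rewrite ger0_norm; last by nonneg.
      by rewrite ler_wpM2l ?exprn_ge0 ?(ltW t0)// lef_pV2 ?posrE; lra.
    rewrite normrM [ `|(4 + _)^-1| ]ger0_norm; last by nonneg.
    rewrite [ `|n%:R * k * _| ]normrM [ `|n%:R * k| ]normrM ger0_norm ?ler0n// [ `|t ^+ 6| ]ger0_norm ?exprn_ge0 ?(ltW t0)//.
    rewrite ler_wpM2l//; first by nonneg.
    by rewrite lef_pV2 ?posrE; lra.
  rewrite [leLHS](_ : _ = t ^+ 2 / n%:R * (((n%:R * t ^+ 2) ^+ 1 * rho t ^+ n) / 16 +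
     `|k| / 4 * ((n%:R * t ^+ 2) ^+ 2 * rho t ^+ n))); last by field.
  rewrite ler_wpM2l// [leRHS]mulrDl [G 1 / _ / _]mulrAC -[_ * G 2 / _]mulrA.
  apply: lerD; first by rewrite ler_wpM2r ?rhoG// invr_ge0.
  by rewrite ler_wpM2l ?rhoG// divr_ge0.
- apply: (@le_trans _ _ (t ^+ 2 / n%:R * (C2 / (1 + t ^+ 2)))); last first.
    by rewrite ler_wpM2l// ler_wpM2r ?lerDr// invr_ge0 addr_ge0.
  apply: le_trans (ler_normB _ _) _; rewrite normrM [ `|4 / _| ]ger0_norm// normrX.
  rewrite [ `|E t ^+ n * _| ]normrM [ `|E t ^+ n| ]ger0_norm ?exprn_ge0//.
  have dn0 : d != 0 by rewrite gt_eqF.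
  (* Multiplying by this ratio, at least 1 here, supplies the powers of [t^2] that the bound must
     contain. *)
  have td1 : 1 <= t ^+ 2 / d ^+ 2.
    by rewrite ler_pdivlMr ?exprn_gt0// mul1r lerXn2r ?nnegrE// ltW.
  have q10 : 0 <= (1 - q)^-1 by rewrite invr_ge0 subr_ge0 ltW.
  rewrite /C2 [X in _ <= _ * X]mulrDl [leRHS]mulrDr; apply: lerD.
    apply: (@le_trans _ _ ((1 - q)^-1 / n%:R * (4 / (1 + t ^+ 2)))).
      apply: ler_pM; [by nonneg|by []| |by rewrite ler_wpM2l// lef_pV2 ?posrE; lra].
      apply: le_trans (exprn_le_inv q0 q1 n0).
      by rewrite lerXn2r ?nnegrE// hq// ltW.
    rewrite [leRHS](_ : _ = ((1 - q)^-1 / n%:R * (4 / (1 + t ^+ 2))) * (t ^+ 2 / d ^+ 2)).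
      by rewrite ler_peMr//; nonneg.
    by field; rewrite dn0 oneDsqr_neq0 nR0 subr_eq0 gt_eqF.
  apply: (@le_trans _ _ (rho t ^+ n * (1 + n%:R * (`|k| * t ^+ 4) + t ^+ 2 / 4))).
    apply: ler_pM; rewrite ?exprn_ge0//; apply: le_trans (ler_normB _ _) _.
    rewrite [ `|t ^+ 2 / 4| ]ger0_norm ?divr_ge0// lerD2r; apply: le_trans (ler_normD _ _) _.
    rewrite normr1 lerD2l normrM ger0_norm ?ler0n// normrM [ `|t ^+ 4| ]ger0_norm ?exprn_ge0//.
    exact: ltW.
  have P j : 0 <= (n%:R * t ^+ 2) ^+ j * rho t ^+ n by rewrite mulr_ge0// exprn_ge0// mulr_ge0// ltW.
  apply: (@le_trans _ _ (t ^+ 2 / n%:R * ((((n%:R * t ^+ 2) ^+ 1 * rho t ^+ n) / d ^+ 4 +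
      `|k| / d ^+ 2 * ((n%:R * t ^+ 2) ^+ 2 * rho t ^+ n)) +
      ((n%:R * t ^+ 2) ^+ 1 * rho t ^+ n) / (4 * d ^+ 2)))).
    rewrite [leRHS](_ : _ = rho t ^+ n * ((t ^+ 2 / d ^+ 2) ^+ 2 +
       n%:R * (`|k| * t ^+ 4) * (t ^+ 2 / d ^+ 2) + t ^+ 2 / 4 * (t ^+ 2 / d ^+ 2))); last first.
      by field; rewrite dn0.
    rewrite ler_wpM2l ?exprn_ge0// !lerD//.
    - by rewrite exprn_ege1.
    - by rewrite ler_peMr//; nonneg.
    - by rewrite ler_peMr//; nonneg.
  rewrite ler_wpM2l// [leRHS]mulrDl [X in _ <= X + _]mulrDl.
  rewrite [G 1 / d ^+ 4 / _]mulrAC [G 1 / (4 * _) / _]mulrAC -[_ * G 2 / _]mulrA.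
  have d20 := sqr_ge0 d; have d40 : 0 <= d ^+ 4 by rewrite exprn_ge0// ltW.
  apply: lerD; first apply: lerD.
  - by rewrite ler_wpM2r ?rhoG// invr_ge0.
  - by rewrite ler_wpM2l ?rhoG// divr_ge0.
  - by rewrite ler_wpM2r ?rhoG// invr_ge0 mulr_ge0.
Qed.

Notation leb := (@lebesgue_measure R).
Notation half_line := ([set` `[(0 : R), +oo[]).
Hypothesis mphi : measurable_fun setT phi.

(** With [lam = n v / 2], the three Gaussian integrals come from [1 - E^n], [n k t^4 E^n] and
    [t^2 E^n / 4], each divided by [t^2]. The error is [C / n] times the integral of
    [1 / (1 + t^2)]. *)
Lemma has_integral_fourier_asymptotics : exists C, forall n, (0 < n)%N -> exists2 J,
  has_integral leb half_line (fun t => (1 - phi t ^+ n * (4 / (4 + t ^+ 2))) / t ^+ 2) J &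
  `|J - (Num.sqrt pi * Num.sqrt (n%:R * v / 2)
    - n%:R * k * (Num.sqrt (pi / (n%:R * v / 2)) / (4 * (n%:R * v / 2)))
    + Num.sqrt (pi / (n%:R * v / 2)) / 8)| <= C / n%:R.
Proof.
have [C hC] := power_gauss_estimate; exists (C * (pi / 2)) => n n0.
set lam := n%:R * v / 2; have l0 : 0 < lam by rewrite divr_gt0// mulr_gt0// ltr0n.
have En t : E t ^+ n = expR (- (lam * t ^+ 2)).
  by rewrite -expRM_natl; congr expR; rewrite /lam; field.
have mH := @measurable_half_line R.
have h1 := has_integral_one_sub_gauss l0; have h2 := has_integral_sqr_gauss l0.
have mE : measurable_fun setT (fun t : R => expR (- (lam * t ^+ 2))).
  by apply: continuous_measurable_fun => t; eapply is_derive_continuous; der.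
have h3 : has_integral leb half_line
    (fun t => t ^+ 2 * expR (- (lam * t ^+ 2)) / t ^+ 2) (Num.sqrt (pi / lam) / 2).
  apply: (has_integral_off0 (has_integral_gauss l0)) => [|t t0].
    apply: measurable_funM; last exact: measurable_sqrV.
    by apply: measurable_funM; first exact: measurable_funX.
  by rewrite [RHS]mulrAC mulfV ?mul1r// sqrf_eq0 gt_eqF.
have h := has_integralD mH (has_integralB mH h1 (has_integralZ mH (n%:R * k) h2))
  (has_integralZ mH 4^-1 h3).
pose f t := (1 - phi t ^+ n * (4 / (4 + t ^+ 2))) / t ^+ 2.
have mf : measurable_fun half_line f.
  apply: measurable_funTS; apply: measurable_funM; last exact: measurable_sqrV.
  apply: measurable_funB => //; apply: measurable_funM; first exact: measurable_funX.
  apply: continuous_measurable_fun => t; eapply is_derive_continuous; der.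
  by rewrite gt_eqF// ltr_pwDl ?sqr_ge0.
have mg := has_integral_measurable h.
have [t|w hw wC] := dominated_has_integral mH (measurable_funB mf mg)
   (has_integralZ mH (C / n%:R) (@has_integral_oneDsqrV R)).
  rewrite /= in_itv/= andbT le_eqVlt => /predU1P[<-|t0].
    have C0 : 0 <= C.
      have := hC 1%N 1 isT ltr01; rewrite divr1 => /(le_trans (normr_ge0 _)).
      by rewrite pmulr_lge0// divr_gt0// ltr_pwDl// sqr_ge0.
    rewrite /f !expr0n/= !invr0 !(mulr0, mul0r) !(oppr0, addr0) normr0.
    by rewrite mulr_ge0 ?invr_ge0// divr_ge0.
  have := hC n t n0 t0; rewrite En => le.
  have tn0 : t != 0 by rewrite gt_eqF.
  rewrite (_ : _ - _ = - (phi t ^+ n * (4 / (4 + t ^+ 2)) - expR (- (lam * t ^+ 2)) *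
    (1 + n%:R * (k * t ^+ 4) - t ^+ 2 / 4)) / t ^+ 2); last first.
    by rewrite /f; field; rewrite tn0/= gt_eqF// ltr_pwDl ?sqr_ge0.
  rewrite normrM normrN normfV [ `|t ^+ 2| ]ger0_norm ?sqr_ge0// ler_pdivrMr ?exprn_gt0//.
  rewrite [leRHS](_ : _ = C / n%:R * (t ^+ 2 / (1 + t ^+ 2))); last by ring.
  exact: le.
eexists; first by apply: (has_integral_eq mH (has_integralD mH h hw)) => t _; rewrite addrC subrK.
rewrite (_ : _ - _ = w); first by rewrite mulrAC.
by field; rewrite gt_eqF.
Qed.

End characteristic_function_power.

Notation cosh a := ((expR a + expR (- a)) / 2).
Notation sinh a := ((expR a - expR (- a)) / 2).

(** * Moments of [Y] *)

Section harmonic_kernel.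
Context {R : realType}.
Notation leb := (@lebesgue_measure R).
Notation half_line := ([set` `[(0 : R), +oo[]).
Implicit Types a b s : R.

Lemma cosh_ge1 a : 1 <= cosh a.
Proof.
have e0 := expR_gt0 a; rewrite expRN.
have : 0 <= (expR a - 1) ^+ 2 / expR a by rewrite divr_ge0 ?sqr_ge0// ltW.
rewrite (_ : _ / _ = expR a + (expR a)^-1 - 2); last by field; rewrite gt_eqF.
by lra.
Qed.

Lemma cosh_le_expR a : 0 <= a -> cosh a <= expR a.
Proof.
move=> a0; have : expR (- a) <= expR a by rewrite ler_expR ge0_cp.
by lra.
Qed.

Lemma sinh_ge0 a : 0 <= a -> 0 <= sinh a.
Proof.
move=> a0; have : expR (- a) <= expR a by rewrite ler_expR ge0_cp.
by lra.
Qed.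

Lemma sinh_le_expR a : sinh a <= expR a.
Proof. by have := expR_gt0 a; have := expR_gt0 (- a); lra. Qed.

Lemma sinh_sqr a : sinh a ^+ 2 = cosh a ^+ 2 - 1.
Proof. by rewrite expRN; field; rewrite gt_eqF// expR_gt0. Qed.

Lemma cos_gtN1 b : 0 <= b -> b < pi -> -1 < cos b.
Proof.
move=> b0 bp; rewrite -(@cospi R).
by rewrite ltr_cos// in_itv/= ?b0 ?lexx ?pi_ge0// ltW.
Qed.

Lemma cosh_cos_ge a b c : 0 <= c -> c < pi -> 0 <= b -> b <= c ->
  (1 + cos c) / 4 * expR a <= cosh a + cos b.
Proof.
move=> c0 cp b0 bc; have c1 := cos_gtN1 c0 cp; have a1 := cosh_ge1 a.
have cb : cos c <= cos b.
  move: bc; rewrite le_eqVlt => /predU1P[->//|bc]; apply/ltW.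
  by rewrite ltr_cos// in_itv/= ?b0 ?c0/= ltW// (lt_trans bc).
have := expR_ge0 (- a); have := expR_gt0 a; set e := expR a in a1 *; set f := expR _ in a1 *.
move=> e0 f0; have := cos_le1 c; nra.
Qed.

Lemma cosh_cos_gt0 a b : 0 <= b -> b < pi -> 0 < cosh a + cos b.
Proof.
move=> b0 bp; apply: lt_le_trans (cosh_cos_ge a b0 bp b0 (lexx b)).
by rewrite mulr_gt0 ?expR_gt0// divr_gt0//; have := cos_gtN1 b0 bp; lra.
Qed.

Lemma dominated_expRN (f : R -> R) C j : (forall a, 0 <= a -> `|f a| <= C * (a ^+ j * expR (- a))) ->
  exists K, forall a, 0 <= a -> `|f a| <= K / (1 + a ^+ 2).
Proof.
move=> fC; exists (`|C| * (j`!%:R + j.+2`!%:R)) => a a0; apply: le_trans (fC a a0) _.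
rewrite ler_pdivlMr ?ltr_pwDl ?sqr_ge0// -mulrA.
have e n : a ^+ n * expR (- a) <= n`!%:R.
  by have := exprM_expRN_le n (ltr01 : (0 : R) < 1) a0; rewrite mul1r expr1n divr1.
have aj0 n : 0 <= a ^+ n * expR (- a) by rewrite mulr_ge0 ?exprn_ge0 ?expR_ge0.
apply: (@le_trans _ _ (`|C| * (a ^+ j * expR (- a) * (1 + a ^+ 2)))).
  by rewrite ler_wpM2r ?ler_norm// mulr_ge0// addr_ge0 ?sqr_ge0.
rewrite ler_wpM2l// mulrDr mulr1 lerD// (_ : _ * _ = a ^+ j.+2 * expR (- a))//.
by rewrite !exprS expr0; ring.
Qed.

Lemma has_integral_exprM_expRN j :
  has_integral leb half_line (fun a => a ^+ j * expR (- a)) j`!%:R.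
Proof.
apply: (@ge0_has_integral _ _ _ leb half_line).
- apply: measurable_funTS; apply: continuous_measurable_fun => t.
  by eapply is_derive_continuous; der.
- by move=> a; rewrite /= in_itv/= andbT => a0; rewrite mulr_ge0 ?exprn_ge0 ?expR_ge0.
- have := integral_exprM_expRN j (ltr01 : (0 : R) < 1); rewrite expr1n divr1 => <-.
  by apply: eq_integral => a _; rewrite mul1r.
Qed.

(* The imaginary part of [tanh ((a + i b) / 2)], hence harmonic in [(a, b)]. *)
Definition strip_kernel b a := sin b / (cosh a + cos b).

(** The primitive [- 2 atan ((exp (- a) + cos b) / sin b)] has at both ends the arctangent of a
    cotangent: of [b] at infinity, of [b / 2] at 0. Their values [pi / 2 - b] and [pi / 2 - b / 2]
    give [b]. *)
Lemma has_integral_strip_kernel0 b : 0 <= b -> b < pi ->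
  has_integral leb half_line (fun a => a ^+ 0 * strip_kernel b a) b.
Proof.
move=> b0 bp.
have c1 := cos_gtN1 b0 bp.
have mh : measurable_fun setT (fun a => a ^+ 0 * strip_kernel b a).
  apply: continuous_measurable_fun => a; rewrite /strip_kernel.
  by eapply is_derive_continuous; der; rewrite gt_eqF// cosh_cos_gt0.
have h0 a : 0 <= a ^+ 0 * strip_kernel b a.
  by rewrite expr0 mul1r divr_ge0 ?sin_ge0_pi ?b0 ?(ltW bp)// ltW// cosh_cos_gt0.
apply: (@ge0_has_integral _ _ _ leb half_line) => //; first exact: measurable_funTS.
move: b0; rewrite le_eqVlt => /predU1P[e|b0].
  by rewrite -[RHS]/(b%:E) -e; apply: integral0_eq => a _; rewrite /strip_kernel sin0 mul0r mulr0.
have s0 : 0 < sin b by rewrite sin_gt0_pi// b0.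
have sn0 : sin b != 0 by rewrite gt_eqF.
have cf a : 0 <= a -> {for a, continuous (fun a => a ^+ 0 * strip_kernel b a)}.
  move=> _; rewrite /strip_kernel.
  by eapply is_derive_continuous; der; rewrite gt_eqF// cosh_cos_gt0// ltW.
have dF a : 0 <= a -> is_derive a (1 : R)
    (fun a => - 2 * atan ((expR (- a) + cos b) / sin b)) (a ^+ 0 * strip_kernel b a).
  move=> _; have e0 := expR_gt0 a; have := cosh_cos_gt0 a (ltW b0) bp.
  rewrite /strip_kernel expRN => d0; der_by.
  have sc : sin b ^+ 2 = 1 - cos b ^+ 2 by have := cos2Dsin2 b; lra.
  have q0 : sin b ^+ 2 + ((expR a)^-1 + cos b) ^+ 2 != 0.
    by rewrite gt_eqF// ltr_pwDl ?exprn_gt0 ?sqr_ge0.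
  rewrite expRN.
  have e1 : (1 + ((expR a)^-1 + cos b) ^+ 2 / sin b ^+ 2) = (sin b ^+ 2 + ((expR a)^-1 + cos b) ^+ 2) / sin b ^+ 2.
    by field; rewrite sn0 gt_eqF.
  have e2 : sin b ^+ 2 + ((expR a)^-1 + cos b) ^+ 2 = 2 * (expR a)^-1 * ((expR a + (expR a)^-1) / 2 + cos b).
    by rewrite sc; field; rewrite gt_eqF.
  rewrite exprMn exprVn e1 e2; field.
  apply/and3P; split => //; first by rewrite gt_eqF.
  rewrite (_ : _ + _ = 2 * expR a * ((expR a + (expR a)^-1) / 2 + cos b)); last by field; rewrite gt_eqF.
  by rewrite gt_eqF// mulr_gt0// mulr_gt0.
have lF : (- 2 * atan ((expR (- a) + cos b) / sin b)) @[a --> +oo] --> - 2 * atan (cos b / sin b).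
  apply: cvgM; first exact: cvg_cst.
  apply: continuous_cvg; first exact: continuous_atan.
  apply: cvgM; last exact: cvg_cst.
  rewrite -[X in _ --> X]add0r; apply: cvgD; last exact: cvg_cst.
  have := cvgy_exprM_expRN 0 (ltr01 : (0 : R) < 1).
  by under eq_fun do rewrite expr0 mul1r mul1r.
rewrite (integral_FTCy (fun a _ => h0 a) cf dF lF) oppr0 expR0; congr (_%:E).
have atan_cot y : 0 < y -> y < pi -> atan (cos y / sin y) = pi / 2 - y.
  move=> y0 yp; rewrite -[RHS]tanK; last by rewrite in_itv/=; apply/andP; split; lra.
  by rewrite /tan sinB cosB sin_pihalf cos_pihalf !(mul0r, mul1r) subr0 add0r.
have -> : (1 + cos b) / sin b = cos (b / 2) / sin (b / 2).
  have s2 : 0 < sin (b / 2) by rewrite sin_gt0_pi//; apply/andP; split; lra.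
  have e : b = b / 2 + b / 2 by lra.
  rewrite {1 2}e cosD sinD; have := cos2Dsin2 (b / 2); move=> cs.
  have c20 : 0 < cos (b / 2) by rewrite cos_gt0_pihalf//; apply/andP; split; lra.
  apply/eqP; rewrite eqr_div; last 2 first.
  - by rewrite gt_eqF// addr_gt0// mulr_gt0.
  - by rewrite gt_eqF.
  apply/eqP; have : sin (b / 2) * sin (b / 2) = 1 - cos (b / 2) * cos (b / 2) by lra.
  by move=> h; ring: h.
by rewrite !atan_cot//; lra.
Qed.

Lemma measurable_strip_kernel j b : 0 <= b -> b < pi ->
  measurable_fun setT (fun a => a ^+ j * strip_kernel b a).
Proof.
move=> b0 bp; apply: continuous_measurable_fun => a; rewrite /strip_kernel.
by eapply is_derive_continuous; der; rewrite gt_eqF// cosh_cos_gt0.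
Qed.

Lemma strip_kernel_ge0 b a : 0 <= b -> b < pi -> 0 <= strip_kernel b a.
Proof.
by move=> b0 bp; rewrite divr_ge0 ?sin_ge0_pi ?b0 ?(ltW bp)// ltW// cosh_cos_gt0.
Qed.

Lemma cvgy_exprM_dominated (f : R -> R) C j :
  (forall a, 0 <= a -> `|f a| <= C * (a ^+ j * expR (- a))) -> f a @[a --> +oo] --> 0.
Proof.
move=> fC; apply: (@cvgy_le_inv _ _ (`|C| * j.+1`!%:R)) => a a1; have a0 : 0 <= a by lra.
apply: le_trans (fC a a0) _; rewrite ler_pdivlMr; last by lra.
apply: (@le_trans _ _ (`|C| * (a ^+ j.+1 * expR (- a)))).
  rewrite (_ : C * _ * a = C * (a ^+ j.+1 * expR (- a))); last by rewrite exprS; ring.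
  by rewrite ler_wpM2r ?ler_norm// mulr_ge0 ?exprn_ge0 ?expR_ge0.
rewrite ler_wpM2l//.
by have := exprM_expRN_le j.+1 (ltr01 : (0 : R) < 1) a0; rewrite mul1r expr1n divr1.
Qed.

(** [dkernel_a] is the derivative of the kernel in [a]. [d2kernel] is its second derivative in [b],
    that is, minus the second derivative in [a]. *)
Let dkernel_a b a := - (sin b * sinh a / (cosh a + cos b) ^+ 2).
Let d2kernel b a := sin b * (2 + cosh a * cos b - cosh a ^+ 2) / (cosh a + cos b) ^+ 3.

(** Staying at [b <= c < pi] keeps the denominator above [k exp a] with [k > 0]; the numerators grow
    at most like [1], [exp a] and [4 exp (2 a)]. *)
Lemma strip_kernel_bounds c : 0 <= c -> c < pi -> exists2 K, 0 <= K &
  forall b a, 0 <= b -> b <= c -> 0 <= a ->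
  [/\ `|strip_kernel b a| <= K * expR (- a), `|dkernel_a b a| <= K * expR (- a) &
      `|d2kernel b a| <= K * expR (- a)].
Proof.
move=> c0 cp; set k := (1 + cos c) / 4.
have k0 : 0 < k by rewrite divr_gt0//; have := cos_gtN1 c0 cp; lra.
exists (k^-1 + k^-1 ^+ 2 + 4 * k^-1 ^+ 3).
  by rewrite !addr_ge0 ?mulr_ge0 ?exprn_ge0 ?invr_ge0// ltW.
move=> b a b0 bc a0.
have e0 := expR_gt0 a; have en0 : expR a != 0 by rewrite gt_eqF.
have kn0 : k != 0 by rewrite gt_eqF.
have dk := cosh_cos_ge a c0 cp b0 bc; rewrite -/k in dk.
have ke : 0 < k * expR a by rewrite mulr_gt0.
have d0 := lt_le_trans ke dk; set d := _ + cos b in dk d0 *.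
have sn : `|sin b| <= 1 by rewrite ler_norml sin_geN1 sin_le1.
have ch1 := cosh_ge1 a; have che := cosh_le_expR a0.
have she := sinh_le_expR a; have sh0 := sinh_ge0 a0.
have iv n : (d ^+ n)^-1 <= (k^-1) ^+ n * (expR (- a)) ^+ n.
  rewrite (_ : _ * _ = ((k * expR a) ^+ n)^-1); last first.
    by rewrite expRN -exprMn -invfM exprVn.
  by rewrite lef_pV2 ?posrE ?exprn_gt0// lerXn2r// nnegrE ltW.
have iv0 n : 0 <= (d ^+ n)^-1 by rewrite invr_ge0 exprn_ge0// ltW.
have ki0 n : 0 <= k^-1 ^+ n by rewrite exprn_ge0// invr_ge0 ltW.
have E0 := expR_ge0 (- a).
have split3 (x : R) n : `|x| <= k^-1 ^+ n * expR (- a) \/ `|x| <= 4 * k^-1 ^+ 3 * expR (- a) ->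
    (n = 1%N \/ n = 2) -> `|x| <= (k^-1 + k^-1 ^+ 2 + 4 * k^-1 ^+ 3) * expR (- a).
  have h1 := mulr_ge0 (ki0 1%N) E0; have h2 := mulr_ge0 (ki0 2) E0; have h3 := mulr_ge0 (ki0 3) E0.
  by rewrite expr1 in h1; move=> hx [] en; move: hx; rewrite en ?expr1 !mulrDl => -[]; lra.
split.
- apply: (split3 _ 1%N); [left|by left].
  rewrite /strip_kernel -/d normrM normfV [ `|d| ]gtr0_norm//.
  have := iv 1%N; rewrite !expr1 => ivd.
  by rewrite -[leRHS]mul1r; apply: ler_pM => //; have := iv0 1%N; rewrite expr1.
- apply: (split3 _ 2); [left|by right].
  rewrite /dkernel_a -/d normrN normrM normfV [ `|sin b * _| ]normrM (ger0_norm sh0) [ `|d ^+ 2| ]ger0_norm ?exprn_ge0 ?(ltW d0)//.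
  have := iv 2; rewrite (_ : k^-1 ^+ 2 * expR (- a) ^+ 2 = k^-1 ^+ 2 * expR (- a) / expR a) => [ivd|]; last first.
    by rewrite expRN; field; rewrite en0.
  rewrite (_ : k^-1 ^+ 2 * expR (- a) = 1 * expR a * (k^-1 ^+ 2 * expR (- a) / expR a)); last first.
    by field; rewrite en0.
  by apply: ler_pM; [rewrite mulr_ge0|exact: iv0|apply: ler_pM|].
- apply: (split3 _ 1%N); [right|by left].
  rewrite /d2kernel -/d normrM normfV [ `|sin b * _| ]normrM [ `|d ^+ 3| ]ger0_norm ?exprn_ge0 ?(ltW d0)//.
  have := iv 3; rewrite (_ : k^-1 ^+ 3 * expR (- a) ^+ 3 = k^-1 ^+ 3 * expR (- a) / expR a ^+ 2) => [ivd|]; last first.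
    by rewrite expRN; field; rewrite en0.
  rewrite (_ : 4 * k^-1 ^+ 3 * expR (- a) = 1 * (4 * expR a ^+ 2) * (k^-1 ^+ 3 * expR (- a) / expR a ^+ 2)); last first.
    by field; rewrite en0.
  apply: ler_pM; [by rewrite mulr_ge0|exact: iv0| |exact: ivd]; apply: ler_pM => //.
  have cl := cos_le1 b; have cg := cos_geN1 b.
  have q : cosh a ^+ 2 <= expR a ^+ 2 by rewrite lerXn2r// nnegrE; lra.
  move: q; set x := cosh a in ch1 che *; rewrite ler_norml => q.
  by apply/andP; split; nra.
Qed.

(* Taylor's formula in [b] with integral remainder, where harmonicity turns the
   second derivative in [b] into minus the one in [a], integrated by parts twice. *)
Lemma has_integral_strip_kernel_step j (P Q Q1 : R -> R) c ck :
  0 <= c -> c < pi ->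
  (forall b, 0 <= b <= c -> has_integral leb half_line (fun a => a ^+ j * strip_kernel b a) (P b)) ->
  (forall b, is_derive b (1 : R) Q (Q1 b)) ->
  (forall b, is_derive b (1 : R) Q1 (j.+2%:R * j.+1%:R * P b)) ->
  continuous P -> Q 0 = 0 -> Q1 0 = 0 ->
  has_integral leb half_line (fun a => a ^+ j.+2 / (cosh a + 1)) ck ->
  has_integral leb half_line (fun a => a ^+ j.+2 * strip_kernel c a) (ck * c - Q c).
Proof.
move=> c0 cp hP dQ dQ1 cP Q0 Q10 hck.
have [K K0 KB] := strip_kernel_bounds c0 cp.
have mH := @measurable_half_line R.
have dn0 b a : 0 <= b <= c -> cosh a + cos b != 0.
  by move=> /andP[b0 bc]; rewrite gt_eqF// cosh_cos_gt0// (le_lt_trans bc).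
have h2 b : 0 <= b <= c ->
    has_integral leb half_line (fun a => a ^+ j.+2 * d2kernel b a) (- (j.+2%:R * j.+1%:R * P b)).
  move=> bc; have /andP[b0 bc'] := bc.
  pose f a := - (a ^+ j.+2 * d2kernel b a) - j.+2%:R * j.+1%:R * (a ^+ j * strip_kernel b a).
  pose F a := a ^+ j.+2 * dkernel_a b a - j.+2%:R * (a ^+ j.+1 * strip_kernel b a).
  have [L1 fL1] : exists L, forall a, 0 <= a -> `|a ^+ j.+2 * d2kernel b a| <= L / (1 + a ^+ 2).
    apply: (@dominated_expRN _ K j.+2) => a a0; have [_ _ h] := KB b a b0 bc' a0.
    by rewrite normrM ger0_norm ?exprn_ge0// mulrCA ler_wpM2l ?exprn_ge0.
  have [L2 fL2] : exists L, forall a, 0 <= a -> `|a ^+ j * strip_kernel b a| <= L / (1 + a ^+ 2).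
    apply: (@dominated_expRN _ K j) => a a0; have [h _ _] := KB b a b0 bc' a0.
    by rewrite normrM ger0_norm ?exprn_ge0// mulrCA ler_wpM2l ?exprn_ge0.
  have fL a : 0 <= a -> `|f a| <= (L1 + j.+2%:R * j.+1%:R * L2) / (1 + a ^+ 2).
    move=> a0; apply: le_trans (ler_normB _ _) _; rewrite normrN [leRHS]mulrDl; apply: lerD; first exact: fL1.
    by rewrite normrM ger0_norm ?mulr_ge0// -[leRHS]mulrA ler_wpM2l ?mulr_ge0 ?fL2.
  have cf : continuous f.
    move=> a; rewrite /f /d2kernel /strip_kernel.
    by eapply is_derive_continuous; der; rewrite ?expf_neq0// dn0.
  have dF a : 0 <= a -> is_derive a (1 : R) F (f a).
    move=> a0; rewrite /F /f /dkernel_a /d2kernel /strip_kernel.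
    have d0 := dn0 b a bc.
    have eE : expR a * expR (- a) = 1 by rewrite -expRD subrr expR0.
    der_by; rewrite ?expf_neq0//= (exprS a j.+1) (exprS a j).
    move: (a ^+ j) => p; move: d0 eE; move: (expR a) (expR (- a)) => E E' d0 eE; field: eE.
    by apply: contra d0 => /eqP e; apply/eqP; lra.
  have lF : F a @[a --> +oo] --> 0.
    rewrite -[X in _ --> X](subr0 0) -{2}(mulr0 j.+2%:R); apply: cvgB; last apply: cvgM; try exact: cvg_cst.
      apply: (@cvgy_exprM_dominated _ K j.+2) => a a0; have [_ h _] := KB b a b0 bc' a0.
      by rewrite normrM ger0_norm ?exprn_ge0// mulrCA ler_wpM2l ?exprn_ge0.
    apply: (@cvgy_exprM_dominated _ K j.+1) => a a0; have [h _ _] := KB b a b0 bc' a0.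
    by rewrite normrM ger0_norm ?exprn_ge0// mulrCA ler_wpM2l ?exprn_ge0.
  have h := has_integral_FTCy fL cf dF lF.
  have := has_integralD mH h (has_integralZ mH (j.+2%:R * j.+1%:R) (hP b bc)).
  rewrite {1}/F !expr0n/= !mul0r mulr0 subrr subr0 add0r => h'.
  have := has_integralZ mH (-1) h'; rewrite mulN1r => h''.
  by apply: (has_integral_eq mH h'') => a _; rewrite /f subrK mulN1r opprK.
pose W : set (measurableTypeR R) := [set` `[0, c]].
have mW : measurable W by exact: measurable_itv.
(* [K exp (- a)] bounds [|d2kernel|], so this is nonnegative and Tonelli applies; the added part is
   subtracted at the end. *)
pose g b a := K * (a ^+ j.+2 * expR (- a)) + a ^+ j.+2 * d2kernel b a.
have hg b : 0 <= b <= c ->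
    has_integral leb half_line (g b) (K * j.+2`!%:R - j.+2%:R * j.+1%:R * P b).
  move=> bc.
  exact: (has_integralD mH (has_integralZ mH K (has_integral_exprM_expRN _)) (h2 b bc)).
have g0 b a : 0 <= b <= c -> 0 <= a -> 0 <= g b a.
  move=> /andP[b0 bc] a0; have [_ _] := KB b a b0 bc a0; rewrite ler_norml => /andP[h _].
  rewrite /g mulrCA -mulrDr mulr_ge0 ?exprn_ge0//; lra.
pose f (p : measurableTypeR R * measurableTypeR R) : \bar R := ((c - p.2) * g p.2 p.1)%:E.
have f0 a b : half_line a -> W b -> (0 <= f (a, b))%E.
  rewrite /W /f/= !in_itv/= andbT => a0 bc; rewrite lee_fin mulr_ge0 ?g0//.
  by case/andP: bc => _; rewrite subr_ge0.
have mf : measurable_fun (half_line `*` W) f.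
  pose f' (p : measurableTypeR R * measurableTypeR R) := (c - p.2) *
    (K * (p.1 ^+ j.+2 * expR (- p.1)) + p.1 ^+ j.+2 * (sin p.2 *
     (2 + cosh p.1 * cos p.2 - cosh p.1 ^+ 2) * powR (cosh p.1 + cos p.2) (-1) ^+ 3)).
  have mf' : measurable_fun setT f'.
    have mx : measurable_fun setT (fun p : measurableTypeR R * measurableTypeR R => p.1) by exact: measurable_fst.
    have my : measurable_fun setT (fun p : measurableTypeR R * measurableTypeR R => p.2) by exact: measurable_snd.
    have mc : measurable_fun setT (fun p : measurableTypeR R * measurableTypeR R => cos p.2).
      by apply: measurableT_comp my; exact: (continuous_measurable_fun (@continuous_cos R)).
    have ms : measurable_fun setT (fun p : measurableTypeR R * measurableTypeR R => sin p.2).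
      by apply: measurableT_comp my; exact: (continuous_measurable_fun (@continuous_sin R)).
    have me : measurable_fun setT (fun p : measurableTypeR R * measurableTypeR R => expR p.1).
      by apply: measurableT_comp mx.
    have me' : measurable_fun setT (fun p : measurableTypeR R * measurableTypeR R => expR (- p.1)).
      by apply: measurableT_comp => //; exact: measurable_funN.
    have mch : measurable_fun setT (fun p : measurableTypeR R * measurableTypeR R => cosh p.1).
      by apply: measurable_funM => //; exact: measurable_funD.
    have mX : measurable_fun setT (fun p : measurableTypeR R * measurableTypeR R => p.1 ^+ j.+2).
      exact: measurable_funX.
    have mp : measurable_fun setT (fun p : measurableTypeR R * measurableTypeR R =>
        powR (cosh p.1 + cos p.2) (-1) ^+ 3).
      have md := measurable_funD mch mc.
      by apply: measurable_funX; exact: (measurableT_comp (@measurable_powR R (-1)) md).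
    apply: measurable_funM; first exact: measurable_funB.
    apply: measurable_funD; first by apply: measurable_funM => //; exact: measurable_funM.
    apply: measurable_funM => //; apply: measurable_funM => //; apply: measurable_funM => //.
    apply: measurable_funB; last exact: measurable_funX.
    by apply: measurable_funD => //; exact: measurable_funM.
  apply: (eq_measurable_fun (EFin \o f')).
    move=> [a b] /set_mem[/= _]; rewrite /W/= in_itv/= => bc.
    rewrite /f /f' /g /d2kernel/= powR_inv1 ?exprVn//.
    by apply: ltW; have /andP[b0 bc'] := bc; rewrite cosh_cos_gt0// (le_lt_trans bc').
  by apply: measurable_funTS; apply/measurable_EFinP.
have tonelli := ge0_integral_swap leb leb mH mW mf f0.
have inner_b a : 0 <= a -> (\int[leb]_(b in W) f (a, b) =
    (K * (a ^+ j.+2 * expR (- a)) * (c ^+ 2 / 2) + a ^+ j.+2 * strip_kernel c a -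
     c * (a ^+ j.+2 / (cosh a + 1)))%:E)%E.
  move=> a0.
  (* Integration by parts against [c - b]: the quotient is the derivative of the kernel in [b],
     equal to [1 / (cosh a + 1)] at [b = 0]. *)
  pose G b := - (K * (a ^+ j.+2 * expR (- a))) * ((c - b) ^+ 2 / 2) +
    a ^+ j.+2 * ((c - b) * ((1 + cosh a * cos b) / (cosh a + cos b) ^+ 2) + strip_kernel b a).
  have dG b : 0 <= b <= c -> is_derive b (1 : R) G ((c - b) * g b a).
    move=> bc; have d0 := dn0 b a bc.
    rewrite /G /g /d2kernel /strip_kernel; der_by; rewrite ?expf_neq0//= expr1.
    have sc : sin b ^+ 2 = 1 - cos b ^+ 2 by have := cos2Dsin2 b; lra.
    move: (cosh a) d0 sc => ch d0 sc; field: sc.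
    exact: d0.
  have cg b : 0 <= b <= c -> {for b, continuous (fun b => (c - b) * g b a)}.
    move=> bc; have d0 := dn0 b a bc; rewrite /g /d2kernel.
    by eapply is_derive_continuous; der; rewrite ?expf_neq0.
  rewrite (integral_FTC_for c0 cg dG) /G; congr (_%:E).
  have e0 : cosh a + 1 != 0 by rewrite gt_eqF// ltr_wpDl// (le_trans _ (cosh_ge1 a)).
  rewrite {2}/strip_kernel cos0 sin0; field.
  have d1 := cosh_cos_gt0 a c0 cp; have d2 := cosh_ge1 a.
  by rewrite !gt_eqF//; lra.
have inner_a b : 0 <= b <= c -> (\int[leb]_(a in half_line) f (a, b) =
    ((c - b) * (K * j.+2`!%:R - j.+2%:R * j.+1%:R * P b))%:E)%E.
  by move=> bc; have [_ <-] := has_integralZ mH (c - b) (hg b bc).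
have outer : (\int[leb]_(b in W) ((c - b) * (K * j.+2`!%:R - j.+2%:R * j.+1%:R * P b))%:E =
    (K * j.+2`!%:R * (c ^+ 2 / 2) - Q c)%:E)%E.
  pose G b := - (K * j.+2`!%:R) * ((c - b) ^+ 2 / 2) - ((c - b) * Q1 b + Q b).
  have dG b : 0 <= b <= c ->
      is_derive b (1 : R) G ((c - b) * (K * j.+2`!%:R - j.+2%:R * j.+1%:R * P b)).
    move=> _; have d1 := dQ b; have d2 := dQ1 b; rewrite /G; der_by.
    by rewrite /= expr1; field.
  rewrite (integral_FTC_for c0 _ dG); last first.
    move=> b _; apply: cvgM; first by apply: cvgB; [exact: cvg_cst|exact: cvg_id].
    by apply: cvgB; [exact: cvg_cst|apply: cvgM; [exact: cvg_cst|exact: cP]].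
  by rewrite /G Q0 Q10; congr (_%:E); field.
pose m a := K * (a ^+ j.+2 * expR (- a)) * (c ^+ 2 / 2) + a ^+ j.+2 * strip_kernel c a -
     c * (a ^+ j.+2 / (cosh a + 1)).
have hm : has_integral leb half_line m (K * j.+2`!%:R * (c ^+ 2 / 2) - Q c).
  have inner_b' a : a \in half_line -> (\int[leb]_(b in W) f (a, b) = (m a)%:E)%E.
    by rewrite mem_itv_set/= andbT; exact: inner_b.
  apply: (@ge0_has_integral _ _ _ leb half_line).
  - apply: measurable_funB; last by apply: has_integral_measurable (has_integralZ mH c hck).
    apply: measurable_funD; last exact: measurable_funTS (measurable_strip_kernel _ c0 cp).
    have := has_integral_measurable (has_integralZ mH (K * (c ^+ 2 / 2)) (has_integral_exprM_expRN j.+2)).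
    by apply: eq_measurable_fun => a _; ring.
  - move=> a; rewrite /= in_itv/= andbT => a0; rewrite -lee_fin -inner_b//.
    by apply: integral_ge0 => b Wb; apply: f0 => //; rewrite /= in_itv/= andbT.
  - transitivity (\int[leb]_(a in half_line) \int[leb]_(b in W) f (a, b))%E.
      by apply: eq_integral => a ain; rewrite inner_b'.
    rewrite -outer tonelli.
    by apply: eq_integral => b; rewrite mem_itv_set/= => bc; exact: inner_a.
have := has_integralD mH (has_integralB mH hm (has_integralZ mH (K * (c ^+ 2 / 2))
   (has_integral_exprM_expRN j.+2))) (has_integralZ mH c hck).
rewrite (_ : _ + c * ck = ck * c - Q c); last by ring.
by move=> h; apply: (has_integral_eq mH h) => a _; rewrite /m; ring.
Qed.

(** Replacing [cos b] by -1, the right side becomes the square of [(1 + a)(1 - exp (- a))], which is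
    at least [a] because [(1 + a) exp (- a) <= 1]. The bound is uniform up to [b = pi], where
    [strip_kernel_bounds] fails. *)
Lemma sqr_le_cosh_cos a b : 0 <= a -> a ^+ 2 <= 2 * (1 + a) ^+ 2 * expR (- a) * (cosh a + cos b).
Proof.
move=> a0; have e0 := expR_gt0 a; have a10 : 0 < 1 + a by lra.
apply: (@le_trans _ _ (2 * (1 + a) ^+ 2 * expR (- a) * (cosh a - 1))); last first.
  have cb := cos_geN1 b.
  by rewrite ler_wpM2l ?lerD2l//; nonneg.
rewrite (_ : _ * _ = ((1 + a) * (1 - expR (- a))) ^+ 2); last by rewrite expRN; field; rewrite gt_eqF.
rewrite lerXn2r// ?nnegrE//; last first.
  have : (1 + a) * expR (- a) <= 1.
    by rewrite expRN ler_pdivrMr// mul1r expR_ge1Dx.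
  by lra.
by rewrite mulr_ge0 ?(ltW a10)// subr_ge0 expR_le1 oppr_le0.
Qed.

(* The linear coefficient is fixed by letting [b] tend to [pi], where the integral
   is [O(sin b)]. *)
Lemma has_integral_strip_kernelS j (P Q Q1 : R -> R) :
  (forall b, 0 <= b < pi -> has_integral leb half_line (fun a => a ^+ j * strip_kernel b a) (P b)) ->
  (forall b, is_derive b (1 : R) Q (Q1 b)) ->
  (forall b, is_derive b (1 : R) Q1 (j.+2%:R * j.+1%:R * P b)) ->
  continuous P -> Q 0 = 0 -> Q1 0 = 0 -> forall b, 0 <= b < pi ->
  has_integral leb half_line (fun a => a ^+ j.+2 * strip_kernel b a) (Q pi / pi * b - Q b).
Proof.
move=> hP dQ dQ1 cP Q0 Q10; have mH := @measurable_half_line R; have p0 := pi_gt0 R.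
(* The linear coefficient [ck] is so far only known to exist. *)
have [|a|ck hck _] := dominated_has_integral mH _
    (has_integralZ mH 2 (has_integral_exprM_expRN j.+2)) (f := fun a => a ^+ j.+2 / (cosh a + 1)).
- apply: measurable_funTS; apply: continuous_measurable_fun => a.
  by eapply is_derive_continuous; der; rewrite gt_eqF// -cos0 cosh_cos_gt0.
- rewrite /= in_itv/= andbT => a0; have d0 := cosh_cos_gt0 a (lexx 0) p0; rewrite cos0 in d0.
  rewrite ger0_norm; last by rewrite divr_ge0 ?exprn_ge0// ltW.
  rewrite [leRHS]mulrCA ler_wpM2l ?exprn_ge0//.
  have eE : expR a * expR (- a) = 1 by rewrite -expRD subrr expR0.
  rewrite -div1r ler_pdivrMr//; have := expR_gt0 (- a); nra.
have h b : 0 <= b < pi ->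
    has_integral leb half_line (fun a => a ^+ j.+2 * strip_kernel b a) (ck * b - Q b).
  move=> /andP[b0 bp]; apply: (has_integral_strip_kernel_step b0 bp _ dQ dQ1) => // s /andP[s0 sb].
  by apply: hP; rewrite s0 (le_lt_trans sb).
pose C := (2 * j`!%:R + 4 * j.+1`!%:R + 2 * j.+2`!%:R) : R.
have hC : has_integral leb half_line (fun a => a ^+ j * (2 * (1 + a) ^+ 2 * expR (- a))) C.
  have := has_integralD mH (has_integralD mH (has_integralZ mH 2 (has_integral_exprM_expRN j))
     (has_integralZ mH 4 (has_integral_exprM_expRN j.+1))) (has_integralZ mH 2 (has_integral_exprM_expRN j.+2)).
  by move=> h'; apply: (has_integral_eq mH h') => a _; rewrite !exprS; ring.
pose f b := ck * b - Q b.
have fge b : 0 <= b < pi -> 0 <= f b.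
  move=> bp; have := h b bp; have /andP[b0 bp'] := bp.
  have hz := has_integralZ mH 0 hC; rewrite mul0r in hz.
  move=> h'; apply: (has_integral_le mH hz h') => a; rewrite /= in_itv/= andbT => a0.
  by rewrite mul0r mulr_ge0 ?exprn_ge0 ?strip_kernel_ge0.
have fle b : 0 <= b < pi -> f b <= sin b * C.
  move=> bp; have := h b bp; have /andP[b0 bp'] := bp.
  move=> h'; apply: (has_integral_le mH h' (has_integralZ mH (sin b) hC)) => a; rewrite /= in_itv/= andbT => a0.
  have d0 := cosh_cos_gt0 a b0 bp'; have s0 : 0 <= sin b by rewrite sin_ge0_pi ?b0 ?ltW.
  rewrite /strip_kernel mulrCA ler_wpM2l// (_ : a ^+ j.+2 / _ = a ^+ j * (a ^+ 2 / (cosh a + cos b))).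
    by rewrite ler_wpM2l ?exprn_ge0// ler_pdivrMr// sqr_le_cosh_cos.
  by rewrite mulrA -exprD addn2.
have cQ : {for (pi : R), continuous f}.
  apply: cvgB; first by apply: cvgM; [exact: cvg_cst|exact: cvg_id].
  exact: (is_derive_continuous (dQ pi)).
have near_pi (S : R -> Prop) : (forall b, 0 <= b < pi -> S b) -> \forall b \near (pi : R)^'-, S b.
  move=> hS; near=> b; apply: hS; apply/andP; split; near: b; first exact: nbhs_left_ge.
  exact: nbhs_left_lt.
(* [0 <= f b <= C sin b] for [b < pi], and [f] is continuous at [pi]. *)
have fpi : f pi = 0.
  have fl := cvg_at_left_filter cQ.
  apply/eqP; rewrite eq_le; apply/andP; split.
    have sl : (sin b * C) @[b --> (pi : R)^'-] --> sin (pi : R) * C.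
      apply: cvgM; last exact: cvg_cst.
      exact: cvg_at_left_filter (@continuous_sin R pi).
    have e0 : sin (pi : R) * C = 0 by rewrite sinpi mul0r.
    by rewrite -e0; apply: (ler_cvg_to fl sl); exact: near_pi.
  by apply: (ler_cvg_to (cvg_cst (0 : R)) fl); exact: near_pi.
move=> b bp; rewrite (_ : Q pi = ck * pi); last by apply/eqP; rewrite eq_sym -subr_eq0; apply/eqP.
by rewrite mulfK ?gt_eqF//; exact: h.
Unshelve. all: by end_near.
Qed.

Lemma has_integral_strip_kernel2 b : 0 <= b < pi ->
  has_integral leb half_line (fun a => a ^+ 2 * strip_kernel b a) ((pi ^+ 2 * b - b ^+ 3) / 3).
Proof.
move=> bp; have p0 := pi_gt0 R.
have := @has_integral_strip_kernelS 0 id (fun b => b ^+ 3 / 3) (fun b => b ^+ 2) _ _ _ _ _ _ b bp.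
rewrite (_ : _ - _ = (pi ^+ 2 * b - b ^+ 3) / 3); last first.
  by move: (pi : R) p0 => p p0; field; rewrite gt_eqF.
apply; rewrite ?expr0n/= ?mul0r//.
- by move=> s /andP[s0 sp]; exact: has_integral_strip_kernel0.
- by move=> s; der_by; rewrite /=; field.
- by move=> s; der_by; rewrite /=; ring.
- by move=> s; exact: cvg_id.
Qed.

Lemma has_integral_strip_kernel4 b : 0 <= b < pi ->
  has_integral leb half_line (fun a => a ^+ 4 * strip_kernel b a)
    (7 / 15 * pi ^+ 4 * b - 2 / 3 * pi ^+ 2 * b ^+ 3 + b ^+ 5 / 5).
Proof.
move=> bp; have p0 := pi_gt0 R.
have := @has_integral_strip_kernelS 2 (fun b => (pi ^+ 2 * b - b ^+ 3) / 3)
  (fun b => 2 / 3 * pi ^+ 2 * b ^+ 3 - b ^+ 5 / 5) (fun b => 2 * pi ^+ 2 * b ^+ 2 - b ^+ 4) _ _ _ _ _ _ b bp.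
rewrite (_ : _ / pi * b - _ = 7 / 15 * pi ^+ 4 * b - 2 / 3 * pi ^+ 2 * b ^+ 3 + b ^+ 5 / 5); last first.
  by move: (pi : R) p0 => p p0; field; rewrite gt_eqF.
apply; rewrite ?expr0n/= ?mulr0 ?mul0r ?subrr//.
- by move=> s sp; exact: has_integral_strip_kernel2.
- by move=> s; der_by; rewrite /=; field.
- by move=> s; der_by; rewrite /=; field.
- by move=> s; eapply is_derive_continuous; der.
Qed.

Lemma has_integral_sqr_cosh :
  has_integral leb half_line (fun a => a ^+ 2 / cosh a) (pi ^+ 3 / 8).
Proof.
have mH := @measurable_half_line R; have p0 := pi_gt0 R.
have := @has_integral_strip_kernel2 (pi / 2); rewrite (_ : _ / 3 = pi ^+ 3 / 8); last by field.
move=> /(_ _)[|h]; first by apply/andP; split; lra.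
move=> h'; apply: (has_integral_eq mH (conj h h')) => a _.
by rewrite /strip_kernel sin_pihalf cos_pihalf addr0 mul1r.
Qed.

Lemma has_integral_pow4_cosh :
  has_integral leb half_line (fun a => a ^+ 4 / cosh a) (5 * pi ^+ 5 / 32).
Proof.
have mH := @measurable_half_line R; have p0 := pi_gt0 R.
have := @has_integral_strip_kernel4 (pi / 2); rewrite (_ : _ + _ / 5 = 5 * pi ^+ 5 / 32); last by field.
move=> /(_ _)[|h]; first by apply/andP; split; lra.
move=> h'; apply: (has_integral_eq mH (conj h h')) => a _.
by rewrite /strip_kernel sin_pihalf cos_pihalf addr0 mul1r.
Qed.

End harmonic_kernel.

Lemma cvg_ext (R : realType) (u v : nat -> R) (l : R) :
  (forall n, u n = v n) -> u @ \oo --> l -> v @ \oo --> l.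
Proof. by move=> /funext ->. Qed.

(** * Cotangent integrals by the Dirichlet kernel *)

Section riemann_lebesgue.
Context {R : realType}.
Notation leb := (@lebesgue_measure R).
Implicit Types a b x : R.

Lemma has_integral_FTC (f F : R -> R) a b : a <= b -> continuous f ->
  (forall x, is_derive x (1 : R) F (f x)) ->
  has_integral leb [set` `[a, b]] f (F b - F a).
Proof.
move=> ab cf dF; split; last by apply: (integral_FTC_for ab) => x _; exact: cf.
apply: continuous_compact_integrable; first exact: segment_compact.
exact: continuous_subspaceT.
Qed.

Lemma sin_npi n : sin (n%:R * pi) = 0 :> R.
Proof. by elim: n => [|n IHn]; rewrite ?mul0r ?sin0// mulrSr mulrDl mul1r sinDpi IHn oppr0. Qed.

Lemma cos_npi n : cos (n%:R * pi) = (-1) ^+ n :> R.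
Proof.
elim: n => [|n IHn]; rewrite ?mul0r ?cos0 ?expr0//.
by rewrite mulrSr mulrDl mul1r cosDpi IHn exprS mulN1r.
Qed.

Let I : set (measurableTypeR R) := [set` `[0, pi / 2]].
Let c (n : nat) (b : R) := cos ((n.*2.+1)%:R * b).

Let mI : measurable I. Proof. exact: measurable_itv. Qed.

Let p20 : 0 <= pi / 2 :> R. Proof. by rewrite divr_ge0// pi_ge0. Qed.

Let II : leb I = (pi / 2)%:E.
Proof.
rewrite /I lebesgue_measure_itv/= lte_fin; have p0 := pi_gt0 R.
by rewrite divr_gt0//= sube0.
Qed.

Let oddR n : (n.*2.+1)%:R = n%:R + n%:R + 1 :> R.
Proof. by rewrite -addn1 natrD -addnn natrD. Qed.

Let orth n m : n != m -> has_integral leb I (fun b => c n b * c m b) 0.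
Proof.
move=> nm; pose al := (n.*2.+1)%:R : R; pose be := (m.*2.+1)%:R : R.
have a0 : al + be != 0 by rewrite gt_eqF// /al /be addr_gt0// ltr0n.
have b0 : al - be != 0.
  by rewrite subr_eq0 eqr_nat eqSS -!muln2 eqn_pmul2r.
have := @has_integral_FTC (fun b => c n b * c m b)
  (fun b => (sin ((al + be) * b) / (al + be) + sin ((al - be) * b) / (al - be)) / 2) 0 (pi / 2) p20 _ _.
rewrite !mulr0 sin0 !mul0r addr0 mul0r subr0.
rewrite (_ : (al + be) * (pi / 2) = (n + m).+1%:R * pi); last first.
  by rewrite /al /be !oddR -[(n + m).+1]addn1 !natrD; field.
rewrite (_ : (al - be) * (pi / 2) = n%:R * pi - m%:R * pi); last first.
  by rewrite /al /be !oddR; field.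
rewrite sin_npi sinB !sin_npi !(mul0r, mulr0) subrr mul0r addr0 mul0r; apply.
- by move=> x; rewrite /c; eapply is_derive_continuous; der.
- move=> x; der_by; rewrite /c -/al -/be.
  have -> : cos ((al + be) * x) = cos (al * x) * cos (be * x) - sin (al * x) * sin (be * x).
    by rewrite mulrDl cosD.
  have -> : cos ((al - be) * x) = cos (al * x) * cos (be * x) + sin (al * x) * sin (be * x).
    by rewrite mulrBl cosB.
  by clearbody al be; field; rewrite a0 b0.
Qed.

Let norm2 n : has_integral leb I (fun b => c n b * c n b) (pi / 4).
Proof.
pose al := (n.*2.+1)%:R : R; have a0 : al != 0 by rewrite pnatr_eq0.
have := @has_integral_FTC (fun b => c n b * c n b)
  (fun b => b / 2 + sin (al * b) * cos (al * b) / (2 * al)) 0 (pi / 2) p20 _ _.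
rewrite !mulr0 sin0 !mul0r !addr0 subr0.
have -> : sin (al * (pi / 2)) * cos (al * (pi / 2)) = 0.
  have : sin (al * pi) = 0 by exact: sin_npi.
  rewrite (_ : al * pi = al * (pi / 2) + al * (pi / 2)); last by field.
  by rewrite sinD; lra.
rewrite mul0r addr0 (_ : pi / 2 / 2 = pi / 4); last by field.
apply.
- by move=> x; rewrite /c; eapply is_derive_continuous; der.
- move=> x; der_by; rewrite /c -/al.
  have sc : sin (al * x) ^+ 2 = 1 - cos (al * x) ^+ 2 by have := cos2Dsin2 (al * x); lra.
  by clearbody al; field: sc; rewrite a0.
Qed.

(** The projections on the orthogonal functions [c n] are subtracted one at a time. Each has squared
    norm [pi / 4], so the squared norm of the rest drops by [4 / pi * r N ^ 2], and the later
    coefficients do not change. *)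
Lemma bessel (q : R -> R) (V : R) (r : nat -> R) N :
  has_integral leb I (fun b => q b * q b) V ->
  (forall n, has_integral leb I (fun b => q b * c n b) (r n)) ->
  4 / pi * \sum_(0 <= n < N) r n ^+ 2 <= V.
Proof.
move=> hV hr; have p0 := pi_gt0 R; have pn0 : (pi : R) != 0 by rewrite gt_eqF.
suff [qN [hqN hrN]] : exists qN : R -> R,
    has_integral leb I (fun b => qN b * qN b) (V - 4 / pi * \sum_(0 <= n < N) r n ^+ 2) /\
    forall n, (N <= n)%N -> has_integral leb I (fun b => qN b * c n b) (r n).
  rewrite -subr_ge0 -lee_fin; have [_ <-] := hqN.
  by apply: integral_ge0 => x _; rewrite lee_fin -expr2 sqr_ge0.
elim: N => [|N [qN [hqN hrN]]]; first by exists q; rewrite big_nil mulr0 subr0.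
exists (fun b => qN b - 4 / pi * r N * c N b); split.
  have h := has_integralD mI (has_integralB mI hqN (has_integralZ mI (2 * (4 / pi * r N)) (hrN N (leqnn N))))
    (has_integralZ mI ((4 / pi * r N) ^+ 2) (norm2 N)).
  rewrite big_nat_recr//= (_ : V - _ = V - 4 / pi * \sum_(0 <= n < N) r n ^+ 2 -
     2 * (4 / pi * r N) * r N + (4 / pi * r N) ^+ 2 * (pi / 4)); last first.
    by move: (pi : R) pn0 => p pn0; field.
  by apply: (has_integral_eq mI h) => x _; ring.
move=> n Nn.
have h := has_integralB mI (hrN n (ltnW Nn)) (has_integralZ mI (4 / pi * r N) (orth (negbT (ltn_eqF Nn)))).
rewrite mulr0 subr0 in h.
by apply: (has_integral_eq mI h) => x _; ring.
Qed.

(* Bessel's inequality spares any regularity of [q = p / sin] at [0]. *)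
Lemma riemann_lebesgue (q : R -> R) (B : R) (r : nat -> R) : measurable_fun I q ->
  (forall b, I b -> `|q b| <= B) ->
  (forall n, has_integral leb I (fun b => q b * c n b) (r n)) -> r @ \oo --> 0.
Proof.
move=> mq qB hr; have p0 := pi_gt0 R.
have [V hV] : exists V, has_integral leb I (fun b => q b * q b) V.
  apply: (bounded_has_integral mI II (B := B * B)); first exact: measurable_funM.
  by move=> x Ix; rewrite normrM ler_pM// qB.
have cv : cvgn (series (fun n => r n ^+ 2)).
  apply: nondecreasing_is_cvgn.
    by apply: nondecreasing_series => n _ _; exact: sqr_ge0.
  exists (V * (pi / 4)) => _ [N _ <-]; have := bessel N hV hr.
  have e : 4 / pi * (pi / 4) = 1 :> R by rewrite mulrA divfK ?divff// gt_eqF.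
  rewrite -(@ler_pM2r _ (pi / 4)) ?divr_gt0// mulrAC e mul1r; exact.
have := cvg_series_cvg_0 cv => h.
apply: norm_cvg0.
have : (fun n => Num.sqrt (r n ^+ 2)) @ \oo --> Num.sqrt (0 : R).
  by apply: continuous_cvg => //; exact: sqrt_continuous.
by rewrite sqrtr0; apply: cvg_trans; apply: near_eq_cvg; near=> n; rewrite sqrtr_sqr.
Unshelve. all: by end_near.
Qed.

(** A telescoping sum: [2 sin b sin (2 k b) = cos ((2 k - 1) b) - cos ((2 k + 1) b)]. Dividing by
    [sin b] expands the cotangent with remainder [c N b / sin b]. *)
Lemma cot_dirichlet b N :
  cos b = \sum_(0 <= n < N) 2 * sin b * sin (n.+1.*2%:R * b) + c N b.
Proof.
elim: N => [|N ->]; first by rewrite big_nil add0r /c mul1r.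
rewrite big_nat_recr//= -addrA; congr (_ + _).
rewrite /c (_ : N.*2.+1%:R * b = N.+1.*2%:R * b - b); last by rewrite doubleS !mulrSr; ring.
rewrite (_ : N.+1.*2.+1%:R * b = N.+1.*2%:R * b + b); last by rewrite mulrSr; ring.
by rewrite cosB cosD; ring.
Qed.

(** For every [N] the integral is the partial sum of [A] plus the coefficient [r N] of [p / sin].
    The bound on [p] makes this quotient bounded, so [r N] tends to 0. *)
Lemma has_integral_cot (p : R -> R) (A : nat -> R) (B : R) : continuous p ->
  (forall b, I b -> `|p b| <= B * sin b) ->
  (forall n, has_integral leb I (fun b => p b * (2 * sin (n.+1.*2%:R * b))) (A n)) ->
  exists2 V, has_integral leb I (fun b => cos b / sin b * p b) V & series A @ \oo --> V.
Proof.
move=> cp pB hA; have p0 := pi_gt0 R.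
have sI b : I b -> 0 <= sin b.
  rewrite /I/= in_itv/= => /andP[b0 b1]; apply: sin_ge0_pi; rewrite b0/=.
  by apply: le_trans b1 _; lra.
pose q b := p b / sin b.
have msV : measurable_fun I (fun b => (sin b)^-1).
  apply: (eq_measurable_fun (fun b => powR (sin b) (-1))).
    by move=> b /set_mem Ib; rewrite powR_inv1// sI.
  apply: measurable_funTS; apply: (measurableT_comp (@measurable_powR R (-1))).
  exact: (continuous_measurable_fun (@continuous_sin R)).
have mp : measurable_fun I p by apply: measurable_funTS; exact: continuous_measurable_fun.
have mq : measurable_fun I q by exact: measurable_funM.
have mc n : measurable_fun I (c n).
  apply: measurable_funTS; apply: continuous_measurable_fun => x.
  by rewrite /c; eapply is_derive_continuous; der.
have qB b : I b -> `|q b| <= `|B|.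
  move=> Ib; rewrite normrM normfV (ger0_norm (sI b Ib)).
  have := sI b Ib; rewrite le_eqVlt => /predU1P[<-|s0]; first by rewrite invr0 mulr0.
  rewrite ler_pdivrMr//; apply: le_trans (pB b Ib) _.
  by rewrite ler_pM2r// ler_norm.
have c1 n b : `|c n b| <= 1 by rewrite ler_norml cos_geN1 cos_le1.
have hr n : exists v, has_integral leb I (fun b => q b * c n b) v.
  apply: (bounded_has_integral mI II (B := `|B| * 1)); first exact: measurable_funM.
  by move=> b Ib; rewrite normrM ler_pM// qB.
pose r n : R := projT1 (cid (hr n)).
have hr' n : has_integral leb I (fun b => q b * c n b) (r n) by rewrite /r; case: cid.
have r0 := riemann_lebesgue mq qB hr'.
have key N : has_integral leb I (fun b => cos b / sin b * p b) (series A N + r N).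
  have h := has_integralD mI (has_integral_sum mI (index_iota 0 N) hA) (hr' N).
  apply: (has_integral_eq mI h) => b Ib.
  have [s0|s0] := eqVneq (sin b) 0.
    have pb0 : p b = 0 by apply/normr0_eq0/eqP; rewrite eq_le normr_ge0 andbT; have := pB b Ib; rewrite s0 mulr0.
    by rewrite /q s0 pb0 !mul0r mulr0 addr0 big1// => i _; rewrite mul0r.
  rewrite [in RHS](cot_dirichlet b N) mulrDl mulrDl; congr (_ + _); last by rewrite /q mulrAC; ring.
  rewrite !mulr_suml; apply: eq_bigr => n _.
  by field; rewrite s0.
exists (series A 0 + r 0); first exact: key.
have e N : series A N = series A 0 + r 0 - r N.
  by rewrite (has_integral_unique (key 0) (key N)) addrK.
have L : (fun N => series A 0 + r 0 - r N) @ \oo --> series A 0 + r 0 - 0.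
  by apply: cvgB; [exact: cvg_cst|exact: r0].
by rewrite subr0 in L; apply: cvg_ext L => N; rewrite [RHS]e.
Qed.

(** [ln (1 + y)] minus the partial sum has derivative [(- y)^N / (1 + y)], at most [y^N] in absolute
    value; comparison with [y^(N + 1) / (N + 1)] bounds the error at 1 by [1 / (N + 1)]. The
    parameter [s] takes the values 1 and -1 for the two sides. *)
Lemma cvg_alternating_ln2 : series (fun n => (-1) ^+ n / n.+1%:R : R) @ \oo --> ln (2 : R).
Proof.
have dS N x : 0 <= x -> is_derive x (1 : R)
    (fun y => \sum_(0 <= n < N) (-1) ^+ n / n.+1%:R * y ^+ n.+1) ((1 - (- x) ^+ N) / (1 + x)).
  move=> x0; have x1 : 1 + x != 0 by rewrite gt_eqF// ltr_pwDl.
  elim: N => [|N IHN].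
    rewrite expr0 subrr mul0r (_ : (fun y : R => _) = fun=> 0); first exact: der_cst.
    by apply/funext => y; rewrite big_nil.
  rewrite (_ : (fun y : R => _) = (fun y => \sum_(0 <= n < N) (-1) ^+ n / n.+1%:R * y ^+ n.+1 +
     (-1) ^+ N / N.+1%:R * y ^+ N.+1)); last by apply/funext => y; rewrite big_nat_recr.
  have Nn : N.+1%:R != 0 :> R by rewrite pnatr_eq0.
  der_by; rewrite /= (exprNn x N) (exprNn x N.+1) (exprS (-1) N) (exprS x N).
  by move: (N.+1%:R : R) Nn ((-1) ^+ N : R) (x ^+ N) => k Nn u w; field; rewrite x1 Nn.
have bnd N : `|ln (2 : R) - series (fun n => (-1) ^+ n / n.+1%:R) N| <= N.+1%:R^-1.
  have S1 : series (fun n => (-1) ^+ n / n.+1%:R : R) N = \sum_(0 <= n < N) (-1) ^+ n / n.+1%:R * 1 ^+ n.+1.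
    by apply: eq_bigr => n _; rewrite expr1n mulr1.
  pose S y := \sum_(0 <= n < N) (-1) ^+ n / n.+1%:R * y ^+ n.+1 : R.
  have S0 : S 0 = 0 by rewrite /S big1// => n _; rewrite expr0n mulr0.
  have Nn : N.+1%:R != 0 :> R by rewrite pnatr_eq0.
  have d x s : 0 <= x -> is_derive x (1 : R)
      (fun y => y ^+ N.+1 / N.+1%:R + s * (ln (1 + y) - S y)) (x ^+ N + s * ((- x) ^+ N / (1 + x))).
    move=> x0; have x1 : 0 < 1 + x by rewrite ltr_pwDl.
    have dSx := dS N x x0; rewrite -/(S _) in dSx.
    der_by; rewrite /=; move: (N.+1%:R : R) Nn => k Nn.
    by field; rewrite Nn gt_eqF.
  have d0 x s : `|s| <= 1 -> 0 <= x -> 0 <= x ^+ N + s * ((- x) ^+ N / (1 + x)).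
    move=> s1 x0; have x1 : 0 < 1 + x by rewrite ltr_pwDl.
    have : `|s * ((- x) ^+ N / (1 + x))| <= x ^+ N.
      rewrite !normrM normrX normrN (ger0_norm x0) normfV (gtr0_norm x1).
      rewrite -[leRHS]mul1r ler_pM// ?mulr_ge0 ?exprn_ge0 ?invr_ge0 ?(ltW x1)//.
      by rewrite ler_pdivrMr// ler_peMr ?exprn_ge0// lerDl.
    by rewrite ler_norml => /andP[]; lra.
  have key s : `|s| <= 1 -> 0 <= N.+1%:R^-1 + s * (ln 2 - S 1).
    move=> s1; have := der_ge0_le ler01 (fun y hy => d y s hy) (fun y hy => d0 y s s1 hy).
    by rewrite S0 addr0 ln1 subrr mulr0 expr0n/= mul0r addr0 expr1n mul1r.
  have k1 := key 1; have k2 := key (-1); rewrite normrN normr1 in k1 k2.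
  rewrite S1 -/(S 1) ler_norml; apply/andP; split.
    by have := k1 (lexx _); rewrite mul1r addrC -lerBlDr sub0r.
  by have := k2 (lexx _); rewrite mulN1r subr_ge0.
apply/cvgrPdist_le => e e0; near=> N; apply: le_trans (bnd N) _.
near: N; have := @cvg_harmonic R; move=> /cvgrPdist_le /(_ e e0).
by apply: filterS => N; rewrite sub0r normrN /harmonic/= ger0_norm ?invr_ge0.
Unshelve. all: by end_near.
Qed.

Lemma is_cvg_zeta3 : cvgn (series (fun k : nat => (k.+1%:R ^+ 3)^-1 : R)).
Proof.
apply: nondecreasing_is_cvgn.
  by apply: nondecreasing_series => n _ _; rewrite invr_ge0 exprn_ge0.
exists 2 => _ [N _ <-].
(* The induction needs this sharper bound: [1 / x^3 <= 2 / x - 2 / (x + 1)] for [x >= 1]. *)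
suff: series (fun k : nat => (k.+1%:R ^+ 3)^-1 : R) N <= 2 - 2 / N.+1%:R.
  have h : 0 <= N.+1%:R^-1 :> R by rewrite invr_ge0.
  by move: (N.+1%:R^-1 : R) h => y; lra.
elim: N => [|N IHN]; first by rewrite /series/= big_nil invr1; lra.
rewrite seriesSr; apply: le_trans (lerD IHN (lexx _)) _.
have x1 : 1 <= N.+1%:R :> R by rewrite ler1n.
rewrite (mulrSr 1 N.+1); move: (N.+1%:R : R) x1 => x x1.
have x0 : x != 0 by rewrite gt_eqF//; lra.
have y0 : x + 1 != 0 by rewrite gt_eqF//; lra.
rewrite -subr_ge0 (_ : _ - _ = (2 * x + 1) * (x - 1) / (x ^+ 3 * (x + 1))); last by field; rewrite x0 y0.
by rewrite divr_ge0 ?mulr_ge0 ?exprn_ge0//; lra.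
Qed.

Lemma zetaE3 : series (fun k : nat => (k.+1%:R ^+ 3)^-1 : R) @ \oo --> zeta 3.
Proof.
rewrite /zeta (_ : (fun k : nat => (k.+1%:R `^ 3)^-1) = (fun k : nat => (k.+1%:R ^+ 3)^-1 : R)).
  exact: is_cvg_zeta3.
by apply/funext => k; rewrite powR_mulrn.
Qed.

(** Up to [2 M], changing the sign of the even denominators subtracts [2 / 8] of the sum up to [M];
    hence the factor [1 - 1/4]. *)
Lemma alternating_zeta3 (l : R) :
  series (fun n => (-1) ^+ n / n.+1%:R ^+ 3 : R) @ \oo --> l -> l = 3 / 4 * zeta 3.
Proof.
set z := series (fun k : nat => (k.+1%:R ^+ 3)^-1 : R) => hl.
have hz : z @ \oo --> zeta 3 := zetaE3.
have e M : series (fun n => (-1) ^+ n / n.+1%:R ^+ 3 : R) (2 * M)%N = z (2 * M)%N - z M / 4.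
  rewrite mul2n; elim: M => [|M IHM]; first by rewrite /z /series/= !big_nil mul0r subr0.
  rewrite doubleS /z !seriesSr -/z IHM -[(-1) ^+ M.*2.+1]signr_odd -[(-1) ^+ M.*2]signr_odd.
  rewrite /= odd_double/= expr0 expr1.
  have -> : M.*2.+2%:R = M.+1%:R * 2 :> R by rewrite -doubleS -muln2 natrM.
  have Mn : M.+1%:R != 0 :> R by rewrite pnatr_eq0.
  have wn : M.*2.+1%:R != 0 :> R by rewrite pnatr_eq0.
  by move: (M.+1%:R : R) (M.*2.+1%:R : R) Mn wn (z M.*2) (z M) => x w Mn wn z1 z2; field; rewrite Mn wn.
have h2 : (fun M => (2 * M)%N) @ \oo --> \oo by exact: cvg_mulnl.
have l1 := cvg_comp _ _ h2 hl.
have l2 : (fun M => z (2 * M)%N - z M / 4) @ \oo --> zeta 3 - zeta 3 / 4.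
  apply: cvgB; first exact: (cvg_comp _ _ h2 hz).
  by apply: cvgM; [exact: hz|exact: cvg_cst].
have : l = zeta 3 - zeta 3 / 4.
  by apply: (cvg_unique _ l1) => //; apply: cvg_ext l2 => M /=; rewrite -e.
by move=> ->; field.
Qed.

Let cosk n : cos (n.+1.*2%:R * (pi / 2)) = - (-1) ^+ n :> R.
Proof.
rewrite (_ : _ * (pi / 2) = n.+1%:R * pi); last by rewrite -muln2 natrM; field.
by rewrite cos_npi exprS mulN1r.
Qed.

Let sink n : sin (n.+1.*2%:R * (pi / 2)) = 0 :> R.
Proof.
rewrite (_ : _ * (pi / 2) = n.+1%:R * pi); last by rewrite -muln2 natrM; field.
exact: sin_npi.
Qed.

(** From [sin b >= b - b^3 / 6] and [b <= 2]. *)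
Let le_sin b : I b -> b <= 3 * sin b.
Proof.
rewrite /I/= in_itv/= => /andP[b0 b1]; have := sin_ge3 b0.
have /andP[_ p2] := @pihalf_02 R.
have b2 : b ^+ 2 <= 4 by nra.
by nra.
Qed.

Let sin_moment n b :
  is_derive b (1 : R) (fun b => - b * (cos (n.+1.*2%:R * b) / n.+1%:R) +
    sin (n.+1.*2%:R * b) / (2 * n.+1%:R ^+ 2)) (b * (2 * sin (n.+1.*2%:R * b))).
Proof.
have n0 : n.+1%:R != 0 :> R by rewrite pnatr_eq0.
by der_by; rewrite -muln2 natrM; move: (n.+1%:R : R) n0 => k n0; field; rewrite n0.
Qed.

Lemma has_integral_cot_id :
  has_integral leb I (fun b => cos b / sin b * b) (pi / 2 * ln 2).
Proof.
have hA n : has_integral leb I (fun b => b * (2 * sin (n.+1.*2%:R * b))) (pi / 2 * ((-1) ^+ n / n.+1%:R)).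
  have := has_integral_FTC p20 _ (sin_moment n).
  rewrite [X in has_integral _ _ _ X](_ : _ = pi / 2 * ((-1) ^+ n / n.+1%:R)).
    by apply => x; eapply is_derive_continuous; der.
  have n0 : n.+1%:R != 0 :> R by rewrite pnatr_eq0.
  rewrite cosk sink !mulr0 sin0.
  by move: (n.+1%:R : R) n0 ((-1) ^+ n : R) (pi : R) => k n0 u p; field; rewrite n0.
have [|b Ib|V hV AV] := has_integral_cot (p := id) (B := 3) _ _ hA.
- by move=> x; exact: cvg_id.
- have := le_sin Ib; move: Ib; rewrite /I/= in_itv/= => /andP[b0 _].
  by rewrite ger0_norm.
rewrite (_ : pi / 2 * ln 2 = V)//; apply: (cvg_unique _ _ AV) => //.
rewrite (_ : series _ = (fun N => pi / 2 * series (fun n => (-1) ^+ n / n.+1%:R) N)).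
  by apply: cvgM; [exact: cvg_cst|exact: cvg_alternating_ln2].
by apply/funext => N; rewrite /series/= mulr_sumr.
Qed.

(** With [k = n + 1], the coefficients of the cubic against [2 sin (2 k b)] combine [(-1)^n / k] and
    [(-1)^n / k^3], which sum to [ln 2] and [3 / 4 * zeta 3]. The series gives the value of the
    convergent sum as a limit of differences. *)
Lemma has_integral_cot_cubic :
  has_integral leb I (fun b => cos b / sin b * (pi ^+ 2 * b - b ^+ 3))
    (3 / 8 * pi ^+ 3 * ln 2 + 9 / 16 * pi * zeta 3).
Proof.
have p0 := pi_gt0 R.
pose A n := 3 / 8 * pi ^+ 3 * ((-1) ^+ n / n.+1%:R) + 3 / 4 * pi * ((-1) ^+ n / n.+1%:R ^+ 3) : R.
pose p b := pi ^+ 2 * b - b ^+ 3 : R.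
have hA n : has_integral leb I (fun b => p b * (2 * sin (n.+1.*2%:R * b))) (A n).
  pose k := n.+1%:R : R; have n0 : k != 0 by rewrite pnatr_eq0.
  have d b : is_derive b (1 : R) (fun b => pi ^+ 2 * (- b * (cos (n.+1.*2%:R * b) / k) +
      sin (n.+1.*2%:R * b) / (2 * k ^+ 2)) - (- b ^+ 3 * (cos (n.+1.*2%:R * b) / k) +
      3 * b ^+ 2 * sin (n.+1.*2%:R * b) / (2 * k ^+ 2) + 3 * b * cos (n.+1.*2%:R * b) / (2 * k ^+ 3) -
      3 * sin (n.+1.*2%:R * b) / (4 * k ^+ 4))) (p b * (2 * sin (n.+1.*2%:R * b))).
    by der_by; rewrite -muln2 natrM -/k /p; clearbody k; field; rewrite n0.
  have := has_integral_FTC p20 _ d.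
  rewrite [X in has_integral _ _ _ X](_ : _ = A n).
    by apply => x; rewrite /p; eapply is_derive_continuous; der.
  rewrite /A -/k cosk sink !mulr0 sin0.
  by move: (pi : R) ((-1) ^+ n : R) => q u; clearbody k; field; rewrite n0.
have [|b Ib|V hV AV] := has_integral_cot (p := p) (B := pi ^+ 2 * 3) _ _ hA.
- by move=> x; rewrite /p; eapply is_derive_continuous; der.
- have := le_sin Ib; move: Ib; rewrite /I/= in_itv/= => /andP[b0 b1] bs.
  have bp : b ^+ 2 <= pi ^+ 2 by rewrite lerXn2r ?nnegrE// ?ltW//; lra.
  rewrite /p (_ : _ - _ = b * (pi ^+ 2 - b ^+ 2)); last by ring.
  rewrite ger0_norm ?mulr_ge0 ?subr_ge0//; have := sqr_ge0 b; nra.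
pose a n := (-1) ^+ n / n.+1%:R : R.
have Aa : series (fun n => (-1) ^+ n / n.+1%:R ^+ 3 : R) @ \oo -->
    (V - 3 / 8 * pi ^+ 3 * ln 2) / (3 / 4 * pi).
  have L : (fun N => (series A N - 3 / 8 * pi ^+ 3 * series (fun n => (-1) ^+ n / n.+1%:R) N) /
      (3 / 4 * pi)) @ \oo --> (V - 3 / 8 * pi ^+ 3 * ln 2) / (3 / 4 * pi).
    apply: cvgM; last exact: cvg_cst; apply: cvgB; first exact: AV.
    by apply: cvgM; [exact: cvg_cst|exact: cvg_alternating_ln2].
  apply: cvg_ext L => N.
  rewrite /= /series/= /A big_split/= -!mulr_sumr; move: (\sum_(_ <= _ < _) _) => S1.
  move: (\sum_(_ <= _ < _) _) => S2; move: (pi : R) p0 => q q0; field; rewrite gt_eqF//.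
have Ve := alternating_zeta3 Aa.
rewrite (_ : _ + _ = V)//.
have -> : V = (V - 3 / 8 * pi ^+ 3 * ln 2) / (3 / 4 * pi) * (3 / 4 * pi) + 3 / 8 * pi ^+ 3 * ln 2.
  by move: (pi : R) p0 => q q0; field; rewrite gt_eqF.
by rewrite Ve; field.
Qed.

End riemann_lebesgue.

(** * Distribution and even moments of [logratio] *)

Section tail.
Context {R : realType}.
Notation leb := (@lebesgue_measure R).
Notation half_line := ([set` `[(0 : R), +oo[]).
Notation I := ([set` `[(0 : R), pi / 2]]).
Notation plane := (measurableTypeR R * measurableTypeR R)%type.
Notation area := (@planar_measure R).
Notation disc := (@unit_disc R).
Implicit Types a b : R.

(* The area where [Y > a] is [tail_main a - tail_corr a]; with [r = 1 / sinh a],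
   [tail_corr a] is also [int_0^(pi/2) sinh a cos b / (cosh a + cos b)^2 db]. *)
Definition tail_main a : R := 2 * atan (expR (- a)).

Definition tail_corr a : R :=
  let r := 2 * expR (- a) / (1 - expR (- a) ^+ 2) in
  r - (pi / 2 - 2 * atan (expR (- a))) * r ^+ 2.

Lemma logratioE z : disc z ->
  [/\ 0 < (1 + z.1) ^+ 2 + z.2 ^+ 2, 0 < (1 - z.1) ^+ 2 + z.2 ^+ 2 &
  logratio z = (ln ((1 + z.1) ^+ 2 + z.2 ^+ 2) - ln ((1 - z.1) ^+ 2 + z.2 ^+ 2)) / 2].
Proof.
move=> Dz; have nN1 : Normc.normc (-1 : R[i]) = 1 by rewrite normcN Normc.normc1.
have := normc1D_gt0 (Normc.normc1 R) Dz; have := normc1D_gt0 nN1 Dz.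
rewrite /logratio /lnp /lnm mulN1r mul1r.
have -> : Normc.normc (1 + to_complex z) = Num.sqrt ((1 + z.1) ^+ 2 + z.2 ^+ 2).
  by rewrite /= add0r.
have -> : Normc.normc (1 - to_complex z) = Num.sqrt ((1 - z.1) ^+ 2 + z.2 ^+ 2).
  by rewrite /= add0r sqrrN.
rewrite !sqrtr_gt0 => h2 h1; split => //.
have ls w : 0 < w -> ln (Num.sqrt w) = ln w / 2.
  move=> w0; have : ln w = ln (Num.sqrt w) *+ 2 by rewrite -lnXn ?sqrtr_gt0// sqr_sqrtr// ltW.
  by rewrite mulr2n; lra.
by rewrite !ls// mulrBl.
Qed.

Lemma area_logratio_gt a : 0 < a ->
  area (disc `&` [set z | a < logratio z]) = (tail_main a - tail_corr a)%:E.
Proof.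
move=> a0; have e0 := expR_gt0 (- a).
have e1 : expR (- a) < 1 by rewrite expR_lt1 oppr_lt0.
have := @area_lens R (expR (- a)); rewrite e0 e1 => /(_ isT) /=.
rewrite /tail_main /tail_corr (_ : _ - (_ - _) = 2 * atan (expR (- a)) +
  (pi / 2 - 2 * atan (expR (- a))) * (2 * expR (- a) / (1 - expR (- a) ^+ 2)) ^+ 2 -
  2 * expR (- a) / (1 - expR (- a) ^+ 2)); last by rewrite opprB addrA.
have K w1 w2 : 0 < w1 -> 0 < w2 -> (w2 < expR (- a) ^+ 2 * w1) = (ln w2 < ln w1 - 2 * a).
  move=> h1 h2; rewrite -(@ltr_ln _ w2) ?posrE ?mulr_gt0 ?exprn_gt0//.
  rewrite lnM ?posrE ?exprn_gt0// lnXn// expRK mulr2n; congr (_ < _); ring.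
move=> <-; congr (area _); apply/seteqP; split => z /=.
- move=> [Dz]; have [h1 h2 ->] := logratioE Dz => az; split.
    by move: Dz; rewrite /unit_disc/= -[X in _ < X]sqrtr1 ltr_sqrt.
  by rewrite K//; lra.
- move=> [D1 az]; have Dz : disc z by rewrite /unit_disc/= -[X in _ < X]sqrtr1 ltr_sqrt.
  split => //; have [h1 h2 ->] := logratioE Dz.
  by move: az; rewrite K//; lra.
Qed.

(** This form makes the moments accessible: in [a] the integrand is [cos b] times the derivative of
    [- 1 / (cosh a + cos b)]. *)
Lemma integral_tail_corr a : 0 < a ->
  (\int[leb]_(b in I) (sinh a * cos b / (cosh a + cos b) ^+ 2)%:E = (tail_corr a)%:E)%E.
Proof.
move=> a0; have e0 := expR_gt0 (- a).
have e1 : expR (- a) < 1 by rewrite expR_lt1 oppr_lt0.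
have p0 := pi_gt0 R.
have eE : expR a = (expR (- a))^-1 by rewrite expRN invrK.
pose e := expR (- a); rewrite -/e in e0 e1 eE.
pose k := (1 - e) / (1 + e).
have en0 : e != 0 by rewrite gt_eqF.
have e2 : 1 + e != 0 by rewrite gt_eqF//; lra.
have e3 : 1 - e != 0 by rewrite gt_eqF//; lra.
have e4 : 1 - e ^+ 2 != 0 by rewrite (_ : 1 - e ^+ 2 = (1 - e) * (1 + e)) ?mulf_neq0//; ring.
have cp b : 0 <= b <= pi / 2 -> 0 <= cos b /\ cosh a + cos b != 0.
  move=> /andP[b0 b1]; split; first by apply: cos_ge0_pihalf; rewrite b1 andbT; lra.
  by rewrite gt_eqF// cosh_cos_gt0//; lra.
(* [sin b / (1 + cos b)] is the tangent of [b / 2] and [k] is [tanh (a / 2)], so [2 atan] of their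
   product is the classical primitive of [sinh a / (cosh a + cos b)]. *)
pose G b := cosh a / sinh a * (sin b / (cosh a + cos b)) -
  (sinh a)^-1 ^+ 2 * (2 * atan (k * (sin b / (1 + cos b)))).
have sn0 : sinh a != 0.
  rewrite -/e eE (_ : _ / 2 = (1 - e ^+ 2) / (2 * e)); last by field.
  by rewrite mulf_neq0// invr_neq0// mulf_neq0.
have dG b : 0 <= b <= pi / 2 -> is_derive b (1 : R) G (sinh a * cos b / (cosh a + cos b) ^+ 2).
  move=> bI; have [c0 d0] := cp b bI.
  have c1 : 1 + cos b != 0 by rewrite gt_eqF//; lra.
  have sc : sin b ^+ 2 = 1 - cos b ^+ 2 by have := cos2Dsin2 b; lra.
  have dA : is_derive b (1 : R) (fun b => 2 * atan (k * (sin b / (1 + cos b)))) (sinh a / (cosh a + cos b)).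
    der_by.
    have -> : 1 + (k * (sin b / (1 + cos b))) ^+ 2 = 4 * e * (cosh a + cos b) / ((1 + e) ^+ 2 * (1 + cos b)).
      rewrite -/e eE /k; field: sc.
      by rewrite en0 e2 c1.
    move: d0; rewrite -/e eE /k => d0.
    have d1 : 1 + e ^+ 2 + 2 * e * cos b != 0.
      have : e * ((e^-1 + e) / 2 + cos b) * 2 != 0 by rewrite !mulf_neq0.
      by apply: contra => /eqP h; apply/eqP; rewrite -h; field.
    field: sc.
    apply/and4P; split => //.
    by apply: contra d1 => /eqP h; apply/eqP; rewrite -h; ring.
  rewrite /G; der_by.
  move: (sinh_sqr a) sn0 d0; move: (sinh a) (cosh a) => sh ch s2 sn0 d0.
  have c2 : ch ^+ 2 = sh ^+ 2 + 1 by rewrite s2 subrK.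
  by field: sc c2; rewrite d0 sn0.
have cf b : 0 <= b <= pi / 2 -> {for b, continuous (fun b => sinh a * cos b / (cosh a + cos b) ^+ 2)}.
  by move=> bI; have [_ d0] := cp b bI; eapply is_derive_continuous; der; rewrite expf_neq0.
have p2 : 0 <= pi / 2 :> R by lra.
rewrite (integral_FTC_for p2 cf dG) /G sin0 cos0 sin_pihalf cos_pihalf.
rewrite !(mul0r, mulr0, addr0, atan0, subr0, divr1, mulr1) /tail_corr -/e.
have -> : atan k = pi / 4 - atan e by rewrite /k atan_onem.
congr (_%:E); have -> : sinh a = (1 - e ^+ 2) / (2 * e) by rewrite -/e eE; field.
have chn : cosh a != 0 by rewrite gt_eqF// (lt_le_trans _ (cosh_ge1 a)).
move: (cosh a) chn => ch chn; move: (atan e) => t; clearbody e; move: (pi : R) => p.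
by field; rewrite en0 e4.
Qed.

Lemma measurable_tail_corr_integrand a :
  measurable_fun setT (fun b => sinh a * cos b / (cosh a + cos b) ^+ 2).
Proof.
have mc := continuous_measurable_fun (@continuous_cos R).
rewrite (_ : (fun b => _) = (fun b => sinh a * cos b * powR (cosh a + cos b) (-1) ^+ 2)).
  apply: measurable_funM; first exact: measurable_funM.
  apply: measurable_funX; apply: (measurableT_comp (@measurable_powR R (-1))).
  exact: measurable_funD.
apply/funext => b; rewrite powR_inv1 ?exprVn//.
by have := cosh_ge1 a; have := cos_geN1 b; lra.
Qed.

Lemma tail_corr_ge0 a : 0 <= a -> 0 <= tail_corr a.
Proof.
rewrite le_eqVlt => /predU1P[<-|a0].
  by rewrite /tail_corr oppr0 expR0 expr1n subrr invr0 mulr0 expr0n mulr0 subrr.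
rewrite -lee_fin -integral_tail_corr//; apply: integral_ge0 => b; rewrite /= in_itv/= => /andP[b0 b1].
have p0 := pi_gt0 R.
rewrite lee_fin divr_ge0 ?sqr_ge0// mulr_ge0//; first exact/sinh_ge0/ltW.
by apply: cos_ge0_pihalf; rewrite b1 andbT; lra.
Qed.

Lemma tail_main_ge0 a : 0 <= tail_main a.
Proof. by rewrite /tail_main mulr_ge0// -atan0 le_atan// expR_ge0. Qed.

Lemma atan_le x : 0 <= x -> atan x <= x :> R.
Proof.
move=> x0; rewrite -subr_ge0.
have := @der_ge0_le R (fun x => x - atan x) (fun x => 1 - (1 + x ^+ 2)^-1) x x0.
rewrite atan0 subrr; apply => y y0.
by rewrite subr_ge0 invf_le1 ?ltr_pwDl ?sqr_ge0// lerDl sqr_ge0.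
Qed.

Lemma tail_main_le a : tail_main a <= 2 * expR (- a).
Proof. by rewrite /tail_main ler_pM2l// atan_le// expR_ge0. Qed.

Lemma tail_corr_le a : 0 <= a -> tail_corr a <= tail_main a.
Proof.
rewrite le_eqVlt => /predU1P[<-|a0].
  by rewrite {1}/tail_corr oppr0 expR0 expr1n subrr invr0 mulr0 expr0n mulr0 subrr tail_main_ge0.
by rewrite -subr_ge0 -lee_fin -area_logratio_gt.
Qed.

Lemma measurable_tail_main : measurable_fun half_line tail_main.
Proof.
apply: measurable_funTS; apply: continuous_measurable_fun => a; rewrite /tail_main.
by eapply is_derive_continuous; der.
Qed.

Lemma measurable_tail_corr : measurable_fun half_line tail_corr.
Proof.
pose e a : R := expR (- a).
have me : measurable_fun setT e.
  by apply: continuous_measurable_fun => a; rewrite /e; eapply is_derive_continuous; der.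
pose r a := 2 * e a * powR (1 - e a ^+ 2) (-1).
have mr : measurable_fun setT r.
  apply: measurable_funM; first exact: measurable_funM.
  apply: (measurableT_comp (@measurable_powR R (-1))).
  by apply: measurable_funB => //; exact: measurable_funX.
have mat : measurable_fun setT (fun a => pi / 2 - 2 * atan (e a)).
  by apply: continuous_measurable_fun => a; rewrite /e; eapply is_derive_continuous; der.
apply: (eq_measurable_fun (fun a => r a - (pi / 2 - 2 * atan (e a)) * r a ^+ 2)).
  move=> a /set_mem; rewrite /= in_itv/= andbT => a0; rewrite /tail_corr /r powR_inv1//.
  by rewrite subr_ge0 exprn_ile1 ?expR_ge0// expR_le1 oppr_le0.
by apply: measurable_funTS; apply: measurable_funB => //; apply: measurable_funM => //; exact: measurable_funX.
Qed.

(** Integration by parts, since [tail_main] has derivative [- 1 / cosh a]. *)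
Lemma has_integral_exprM_tail_main n v :
  has_integral leb half_line (fun a => a ^+ n.+1 / cosh a) v ->
  has_integral leb half_line (fun a => n.+1%:R * a ^+ n * tail_main a) v.
Proof.
move=> hv; have mH := @measurable_half_line R.
have ch0 a : cosh a != 0 by rewrite gt_eqF// (lt_le_trans _ (cosh_ge1 a)).
pose f a := n.+1%:R * a ^+ n * tail_main a - a ^+ n.+1 / cosh a.
have [L1 fL1] : exists L, forall a, 0 <= a -> `|n.+1%:R * a ^+ n * tail_main a| <= L / (1 + a ^+ 2).
  apply: (@dominated_expRN R _ (n.+1%:R * 2) n) => a a0.
  have t0 := tail_main_ge0 a.
  rewrite ger0_norm; last by apply: mulr_ge0 => //; rewrite mulr_ge0 ?exprn_ge0.
  have := ler_wpM2l (mulr_ge0 (ler0n R n.+1) (exprn_ge0 n a0)) (tail_main_le a).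
  by move=> /le_trans; apply; rewrite le_eqVlt; apply/orP; left; apply/eqP; ring.
have [L2 fL2] : exists L, forall a, 0 <= a -> `|a ^+ n.+1 / cosh a| <= L / (1 + a ^+ 2).
  apply: (@dominated_expRN R _ 2 n.+1) => a a0; have c1 := cosh_ge1 a.
  rewrite ger0_norm; last by rewrite divr_ge0 ?exprn_ge0//; lra.
  rewrite [leRHS]mulrCA ler_wpM2l ?exprn_ge0//.
  have eE : expR a * expR (- a) = 1 by rewrite -expRD subrr expR0.
  by rewrite -div1r ler_pdivrMr; [have := expR_gt0 (- a); nra|lra].
have fL a : 0 <= a -> `|f a| <= (L1 + L2) / (1 + a ^+ 2).
  by move=> a0; apply: le_trans (ler_normB _ _) _; rewrite [leRHS]mulrDl lerD ?fL1 ?fL2.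
have cf : continuous f.
  by move=> a; rewrite /f /tail_main; eapply is_derive_continuous; der.
have dF a : 0 <= a -> is_derive a (1 : R) (fun a => a ^+ n.+1 * tail_main a) (f a).
  move=> a0; rewrite /f /tail_main; der_by; rewrite /= expRN exprS.
  have e0 : expR a != 0 by rewrite gt_eqF// expR_gt0.
  have e2 : 1 + expR a ^+ 2 != 0 by exact: oneDsqr_neq0.
  move: (atan (expR a)^-1) (a ^+ n) e0 e2 => t p; move: (expR a) => E e0 e2.
  have e3 : 1 + E^-1 ^+ 2 != 0 by exact: oneDsqr_neq0.
  have e4 : E + E^-1 != 0.
    by rewrite (_ : E + E^-1 = (1 + E ^+ 2) / E) ?mulf_neq0 ?invr_neq0//; field.
  field.
  by rewrite e0/= addrC -expr2.
have lF : (a ^+ n.+1 * tail_main a) @[a --> +oo] --> 0.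
  apply: (@cvgy_exprM_dominated R _ 2 n.+1) => a a0.
  have t0 := tail_main_ge0 a.
  rewrite ger0_norm; last by apply: mulr_ge0 => //; rewrite exprn_ge0.
  by rewrite [leRHS]mulrCA ler_wpM2l ?exprn_ge0// tail_main_le.
have := has_integralD mH (has_integral_FTCy fL cf dF lF) hv.
rewrite expr0n/= mul0r subrr add0r => h.
by apply: (has_integral_eq mH h) => a _; rewrite /f subrK.
Qed.

(** After exchanging the integrals, an integration by parts in [a] leaves [a^n / (cosh a + cos b)],
    which is the strip kernel moment divided by [sin b]; with the factor [cos b] this produces the
    cotangent. *)
Lemma has_integral_exprM_tail_corr n (P : R -> R) V :
  (forall b, 0 <= b < pi -> has_integral leb half_line (fun a => a ^+ n * strip_kernel b a) (P b)) ->
  has_integral leb I (fun b => cos b / sin b * P b) V ->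
  has_integral leb half_line (fun a => a ^+ n.+1 * tail_corr a) (n.+1%:R * V).
Proof.
move=> hP hV; have mH := @measurable_half_line R; have p0 := pi_gt0 R.
(* [b = 0] is excluded because of the division by [sin b]. *)
pose W : set (measurableTypeR R) := [set` `]0, pi / 2]].
have mW : measurable W by exact: measurable_itv.
have WE b : W b = (0 < b <= pi / 2) :> Prop by rewrite /W/= in_itv.
have cs b : 0 < b <= pi / 2 -> [/\ 0 <= cos b, 0 < sin b & 0 <= b < pi].
  move=> /andP[b0 b1]; split; first by apply: cos_ge0_pihalf; rewrite b1 andbT; lra.
    by rewrite sin_gt0_pi// b0/=; lra.
  by rewrite ltW//=; lra.
pose g b a := a ^+ n.+1 * (sinh a / (cosh a + cos b) ^+ 2).
pose f (p : measurableTypeR R * measurableTypeR R) : \bar R := (cos p.2 * g p.2 p.1)%:E.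
have d0 a b : 0 < b <= pi / 2 -> cosh a + cos b != 0.
  by move=> /cs[_ _ /andP[b0 bp]]; rewrite gt_eqF// cosh_cos_gt0.
have f0 a b : half_line a -> W b -> (0 <= f (a, b))%E.
  rewrite WE /f /g/= in_itv/= andbT => a0 /cs[c0 _ _].
  by rewrite lee_fin mulr_ge0// mulr_ge0 ?exprn_ge0// divr_ge0 ?sqr_ge0// sinh_ge0.
have mf : measurable_fun (half_line `*` W) f.
  have my : measurable_fun setT (fun p : measurableTypeR R * measurableTypeR R => p.2) by exact: measurable_snd.
  have mc : measurable_fun setT (fun p : measurableTypeR R * measurableTypeR R => cos p.2).
    by apply: measurableT_comp my; exact: (continuous_measurable_fun (@continuous_cos R)).
  have m1 (h : R -> R) : continuous h -> measurable_fun setT (fun p : measurableTypeR R * measurableTypeR R => h p.1).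
    by move=> ch; apply: measurableT_comp; [exact: continuous_measurable_fun|exact: measurable_fst].
  apply: (eq_measurable_fun (fun p : measurableTypeR R * measurableTypeR R => (cos p.2 * (p.1 ^+ n.+1 * (sinh p.1 * powR (cosh p.1 + cos p.2) (-1) ^+ 2)))%:E)).
    move=> [a b] /set_mem[/= _]; rewrite WE => bW.
    rewrite /f /g/= powR_inv1 ?exprVn//; apply: ltW.
    by have [_ _ /andP[b0 bp]] := cs b bW; exact: cosh_cos_gt0.
  apply: measurable_funTS; apply/measurable_EFinP; apply: measurable_funM => //.
  apply: measurable_funM; first by apply: (m1 (fun a => a ^+ n.+1)) => a; eapply is_derive_continuous; der.
  apply: measurable_funM; first by apply: (m1 (fun a => sinh a)) => a; eapply is_derive_continuous; der.
  apply: measurable_funX; apply: (measurableT_comp (@measurable_powR R (-1))).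
  by apply: measurable_funD => //; apply: (m1 (fun a => cosh a)) => a; eapply is_derive_continuous; der.
have inner_a b : 0 < b <= pi / 2 ->
    (\int[leb]_(a in half_line) f (a, b) = (n.+1%:R * (cos b / sin b * P b))%:E)%E.
  move=> bW; have [c0 s0 bp] := cs b bW; have dn a := d0 a b bW.
  have sn0 : sin b != 0 by rewrite gt_eqF.
  have h0 : has_integral leb half_line (fun a => a ^+ n / (cosh a + cos b)) (P b / sin b).
    have := has_integralZ mH (sin b)^-1 (hP b bp); rewrite mulrC => h.
    apply: (has_integral_eq mH h) => a _; rewrite /strip_kernel; field.
    rewrite sn0 andbT; apply: contra (dn a) => /eqP h'; apply/eqP; lra.
  have iv a : 0 <= a -> (cosh a + cos b)^-1 <= 2 * expR (- a).
    move=> a0; have eE : expR a * expR (- a) = 1 by rewrite -expRD subrr expR0.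
    have c1 := cosh_ge1 a.
    by rewrite -div1r ler_pdivrMr; [have := expR_gt0 (- a); nra|lra].
  have iv0 a : 0 <= (cosh a + cos b)^-1 by rewrite invr_ge0; have c1 := cosh_ge1 a; lra.
  pose F a := - (a ^+ n.+1 / (cosh a + cos b)).
  pose k a := g b a - n.+1%:R * (a ^+ n / (cosh a + cos b)).
  have [L1 fL1] : exists L, forall a, 0 <= a -> `|g b a| <= L / (1 + a ^+ 2).
    apply: (@dominated_expRN R _ 2 n.+1) => a a0.
    have sh0 := sinh_ge0 a0; have c1 := cosh_ge1 a; have dp : 0 < cosh a + cos b by lra.
    rewrite /g ger0_norm; last by nonneg.
    rewrite [leRHS]mulrCA ler_wpM2l ?exprn_ge0//; apply: le_trans (iv a a0).
    rewrite expr2 invfM mulrA -[leRHS]mul1r ler_wpM2r// ler_pdivrMr// mul1r.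
    by have := expR_gt0 (- a); lra.
  have [L2 fL2] : exists L, forall a, 0 <= a -> `|a ^+ n / (cosh a + cos b)| <= L / (1 + a ^+ 2).
    apply: (@dominated_expRN R _ 2 n) => a a0.
    by rewrite ger0_norm ?mulr_ge0 ?exprn_ge0// [leRHS]mulrCA ler_wpM2l ?exprn_ge0// iv.
  have fL a : 0 <= a -> `|k a| <= (L1 + n.+1%:R * L2) / (1 + a ^+ 2).
    move=> a0; apply: le_trans (ler_normB _ _) _; rewrite [leRHS]mulrDl lerD ?fL1//.
    by rewrite normrM ger0_norm// -[leRHS]mulrA ler_wpM2l// fL2.
  have ck : continuous k.
    move=> a; rewrite /k /g; eapply is_derive_continuous; der; rewrite ?expf_neq0//; exact: dn.
  have dF a : 0 <= a -> is_derive a (1 : R) F (k a).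
    move=> _; rewrite /F /k /g; der_by; first exact: dn.
    rewrite /=; have dna := dn a; move: dna; set d := _ + cos b => dna.
    by field.
  have lF : F a @[a --> +oo] --> 0.
    apply: (@cvgy_exprM_dominated R _ 2 n.+1) => a a0.
    by rewrite normrN ger0_norm ?mulr_ge0 ?exprn_ge0// [leRHS]mulrCA ler_wpM2l ?exprn_ge0// iv.
  have h := has_integralD mH (has_integral_FTCy fL ck dF lF) (has_integralZ mH n.+1%:R h0).
  have [_ E] := has_integralZ mH (cos b) h.
  rewrite {1}/F expr0n/= mul0r oppr0 subrr add0r in E.
  rewrite (_ : n.+1%:R * _ = cos b * (n.+1%:R * (P b / sin b))); last by ring.
  by rewrite -E; apply: eq_integral => a _; rewrite /f /k/= subrK.
have inner_b a : 0 <= a -> (\int[leb]_(b in W) f (a, b) = (a ^+ n.+1 * tail_corr a)%:E)%E.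
  rewrite le_eqVlt => /predU1P[<-|a0].
    rewrite exprS !mul0r; apply: integral0_eq => b _.
    by rewrite /f /g/= exprS !mul0r mulr0.
  rewrite EFinM -integral_tail_corr// -ge0_integralZl//=; last 3 first.
  - by apply/measurable_EFinP; apply: measurable_funTS; exact: measurable_tail_corr_integrand.
  - move=> b; rewrite in_itv/= => /andP[b0 b1].
    rewrite lee_fin divr_ge0 ?sqr_ge0// mulr_ge0//; first exact/sinh_ge0/ltW.
    by apply: cos_ge0_pihalf; rewrite b1 andbT; lra.
  - by rewrite lee_fin exprn_ge0// ltW.
  rewrite -[RHS]integral_itv_obnd_cbnd; last first.
    apply: measurable_funTS; apply/measurable_EFinP; apply: measurable_funM => //.
    exact: measurable_tail_corr_integrand.
  by apply: eq_integral => b _; rewrite /f /g/= -EFinM; congr (_%:E); ring.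
apply: (@ge0_has_integral _ _ _ leb half_line).
- apply: measurable_funM; last exact: measurable_tail_corr.
  apply: measurable_funTS; exact: measurable_funX.
- by move=> a; rewrite /= in_itv/= andbT => a0; rewrite mulr_ge0 ?exprn_ge0 ?tail_corr_ge0.
- have mI : measurable (I : set (measurableTypeR R)) by exact: measurable_itv.
  have [_ <-] := has_integralZ mI n.+1%:R hV.
  transitivity (\int[leb]_(a in half_line) \int[leb]_(b in W) f (a, b))%E.
    by apply: eq_integral => a; rewrite mem_itv_set/= andbT => a0; rewrite inner_b.
  rewrite (ge0_integral_swap leb leb mH mW mf f0) -[RHS]integral_itv_obnd_cbnd; last first.
    apply/measurable_EFinP; apply: measurable_funM => //.
    apply: (measurable_funS _ _ (has_integral_measurable hV)); first exact: measurable_itv.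
    by move=> b; rewrite /= !in_itv/= => /andP[/ltW -> ->].
  by apply: eq_integral => b; rewrite mem_itv_set/= => bW; rewrite inner_a.
Qed.

Let pos (z : plane) : R := Num.max (logratio z) 0.

Lemma has_integral_pos_logratio n v : (0 < n)%N ->
  has_integral leb half_line (fun a => n.+1%:R * a ^+ n * (tail_main a - tail_corr a)) v ->
  has_integral area disc (fun z => pos z ^+ n.+1) v.
Proof.
move=> n0 [_ hv]; have mD := @measurable_unit_disc R.
have mV : measurable_fun disc pos.
  by apply: measurable_maxr => //; exact: measurable_funTS (@measurable_logratio R).
have V0 z : disc z -> 0 <= pos z by move=> _; rewrite /pos le_max lexx orbT.
have k0 a : 0 <= a -> 0 <= n.+1%:R * a ^+ n by move=> a0; rewrite mulr_ge0 ?exprn_ge0.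
have ck : continuous (fun a : R => n.+1%:R * a ^+ n).
  by move=> a; eapply is_derive_continuous; der.
have dK (a : R) : is_derive a (1 : R) (fun a => a ^+ n.+1) (n.+1%:R * a ^+ n).
  by der_by; rewrite mulr1.
have K0 : (0 : R) ^+ n.+1 = 0 by rewrite expr0n.
apply: ge0_has_integral => //; first exact: measurable_funX.
  by move=> z Dz; rewrite exprn_ge0// V0.
rewrite (layer_cake area mD mV V0 k0 ck dK K0) -hv.
(* The area formula holds for [a > 0]; at [a = 0] the factor [a^n] vanishes. *)
apply: eq_integral => a; rewrite mem_itv_set/= andbT le_eqVlt => /predU1P[<-|a0].
  by rewrite expr0n eqn0Ngt n0/= mulr0 mul0r mul0e.
rewrite [RHS]EFinM -area_logratio_gt//; congr (_ * area _)%E.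
apply/seteqP; split => z /= [Dz h]; split => //; move: h; rewrite /pos lt_max ?(ltNge a 0) ?(ltW a0) ?orbF//.
Qed.

(** The positive and negative parts of [Y] are exchanged by the half-turn, so they contribute
    equally. *)
Lemma has_integral_even_logratio n v : (0 < n)%N -> odd n ->
  has_integral leb half_line (fun a => n.+1%:R * a ^+ n * (tail_main a - tail_corr a)) v ->
  has_integral area disc (fun z => logratio z ^+ n.+1) (2 * v).
Proof.
move=> n0 on hv; have mD := @measurable_unit_disc R.
have h1 := has_integral_pos_logratio n0 hv.
have m1 := has_integral_measurable h1.
have p0 z : disc z -> 0 <= pos z ^+ n.+1 by move=> Dz; rewrite exprn_ge0// /pos le_max lexx orbT.
pose neg (z : plane) : R := Num.max (- logratio z) 0.
have h2 : has_integral area disc (fun z => neg z ^+ n.+1) v.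
  apply: ge0_has_integral => //.
  - apply: measurable_funX; apply: measurable_maxr => //.
    by apply: measurable_funN; exact: measurable_funTS (@measurable_logratio R).
  - by move=> z Dz; rewrite exprn_ge0// /neg le_max lexx orbT.
  - have [_ <-] := h1; rewrite -(@ge0_integral_disc_opp R (fun z => (pos z ^+ n.+1)%:E)).
    + by apply: eq_integral => z _; rewrite /pos /neg logratio_opp.
    + exact/measurable_EFinP.
    + by move=> z Dz; rewrite lee_fin p0.
have := has_integralD mD h1 h2; rewrite (_ : v + v = 2 * v); last by ring.
move=> h; apply: (has_integral_eq mD h) => z _; rewrite /pos /neg.
have [y0|y0] := leP 0 (logratio z).
  by rewrite (max_idPr _) ?oppr_le0// expr0n addr0.
rewrite (max_idPl _) ?oppr_ge0 ?(ltW y0)// expr0n add0r.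
by rewrite exprNn -signr_odd/= on/= expr0 mul1r.
Qed.

Let tail_combine n m (v w : R) :
  has_integral leb half_line (fun a => n.+1%:R * a ^+ n * tail_main a) v ->
  has_integral leb half_line (fun a => a ^+ n * tail_corr a) w -> m = v - n.+1%:R * w ->
  has_integral leb half_line (fun a => n.+1%:R * a ^+ n * (tail_main a - tail_corr a)) m.
Proof.
move=> hv hw ->; have mH := @measurable_half_line R.
have h := has_integralB mH hv (has_integralZ mH n.+1%:R hw).
by apply: (has_integral_eq mH h) => a _; ring.
Qed.

Lemma has_integral_logratio2 :
  has_integral area disc (fun z => logratio z ^+ 2) (pi * (pi ^+ 2 / 4 - 2 * ln 2)).
Proof.
rewrite (_ : pi * _ = 2 * (pi ^+ 3 / 8 - 2 * (1 * (pi / 2 * ln 2)))); last by field.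
apply: has_integral_even_logratio => //; apply: tail_combine.
- exact: has_integral_exprM_tail_main has_integral_sqr_cosh.
- apply: (has_integral_exprM_tail_corr (P := id)) has_integral_cot_id => b /andP[b0 bp].
  exact: has_integral_strip_kernel0.
- by [].
Qed.

Lemma has_integral_logratio4 :
  has_integral area disc (fun z => logratio z ^+ 4)
    (pi * (5 / 16 * pi ^+ 4 - 3 * pi ^+ 2 * ln 2 - 9 / 2 * zeta 3)).
Proof.
rewrite (_ : pi * _ = 2 * (5 * pi ^+ 5 / 32 - 4 * (3 *
  (3^-1 * (3 / 8 * pi ^+ 3 * ln 2 + 9 / 16 * pi * zeta 3))))); last by field.
apply: has_integral_even_logratio => //; apply: tail_combine.
- exact: has_integral_exprM_tail_main has_integral_pow4_cosh.
- apply: (has_integral_exprM_tail_corr (P := fun b => (pi ^+ 2 * b - b ^+ 3) / 3)).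
    exact: has_integral_strip_kernel2.
  have mI : measurable (I : set (measurableTypeR R)) by exact: measurable_itv.
  have h := has_integralZ mI 3^-1 (@has_integral_cot_cubic R).
  by apply: (has_integral_eq mI h) => b _; ring.
- by [].
Qed.

Lemma has_integral_logratio6 :
  exists m, has_integral area disc (fun z => logratio z ^+ 6) m.
Proof.
have mH := @measurable_half_line R.
(* The tail lies between 0 and [tail_main a <= 2 exp (- a)]. *)
have [|a|v hv _] := dominated_has_integral mH _ (has_integralZ mH 12 (has_integral_exprM_expRN 5))
   (f := fun a => 6 * a ^+ 5 * (tail_main a - tail_corr a)).
- apply: measurable_funM; first by apply: measurable_funTS; apply: measurable_funM => //; exact: measurable_funX.
  by apply: measurable_funB; [exact: measurable_tail_main|exact: measurable_tail_corr].
- rewrite /= in_itv/= andbT => a0.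
  have h1 := tail_corr_le a0; have h2 := tail_corr_ge0 a0; have h3 := tail_main_le a.
  have p0 : 0 <= 6 * a ^+ 5 by rewrite mulr_ge0 ?exprn_ge0.
  rewrite ger0_norm; last by rewrite mulr_ge0// subr_ge0.
  rewrite (_ : 12 * _ = 6 * a ^+ 5 * (2 * expR (- a))); last by ring.
  by rewrite ler_wpM2l//; lra.
by exists (2 * v); apply: has_integral_even_logratio.
Qed.

End tail.

(** * The characteristic function of [Y] *)

Section characteristic_function.
Context {R : realType}.
Notation leb := (@lebesgue_measure R).
Notation plane := (measurableTypeR R * measurableTypeR R)%type.
Notation area := (@planar_measure R).
Notation disc := (@unit_disc R).

Let mD : measurable (disc : set plane) := @measurable_unit_disc R.

Let cos_logratio_ge0 (t : R) z : 0 <= 1 - cos (t * logratio z).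
Proof. by rewrite subr_ge0 cos_le1. Qed.

(** Written through the nonnegative [1 - cos], so that measurability in [t] is part of Tonelli's
    theorem. *)
Definition charfun (t : R) : R :=
  1 - pi^-1 * fine (\int[area]_(z in disc) (1 - cos (t * logratio z))%:E)%E.

Lemma has_integral_cos_logratio t :
  has_integral area disc (fun z => cos (t * logratio z)) (pi * charfun t).
Proof.
have p0 := pi_gt0 R.
have mc : measurable_fun disc (fun z => cos (t * logratio z)).
  apply: (measurable_comp_logratio (h := fun y => cos (t * y))) => y.
  by eapply is_derive_continuous; der.
have cB z : disc z -> `|cos (t * logratio z)| <= 1 by rewrite ler_norml cos_geN1 cos_le1.
have [v hv] := bounded_has_integral mD (@area_unit_disc R) mc cB.
rewrite /charfun; have [_ ->] := has_integralB mD (has_integral_cst mD (@area_unit_disc R) 1) hv.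
rewrite /= (_ : pi * _ = v)//.
by move: (pi : R) p0 => p p0; field; rewrite gt_eqF.
Qed.

Lemma measurable_charfun : measurable_fun setT charfun.
Proof.
apply: measurable_funB => //; apply: measurable_funM => //.
apply: measurableT_comp => //.
pose f (p : measurableTypeR R * plane) : \bar R := (1 - cos (p.1 * logratio p.2))%:E.
have mf : measurable_fun (setT `*` disc) f.
  apply: measurable_funTS; apply/measurable_EFinP; apply: measurable_funB => //.
  apply: measurableT_comp; first exact: (continuous_measurable_fun (@continuous_cos R)).
  apply: measurable_funM; first exact: measurable_fst.
  by apply: measurableT_comp; [exact: measurable_logratio|exact: measurable_snd].
have f0 t z : setT t -> disc z -> (0 <= f (t, z))%E by move=> _ _; rewrite lee_fin.
exact: (measurable_integral_prod1 area measurableT mD mf f0).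
Qed.

Lemma charfun_taylor : exists M, forall t : R, 0 <= t ->
  `|charfun t - (1 - (pi ^+ 2 / 4 - 2 * ln 2) * t ^+ 2 / 2 +
    (5 / 16 * pi ^+ 4 - 3 * pi ^+ 2 * ln 2 - 9 / 2 * zeta 3) / 24 * t ^+ 4)| <= M * t ^+ 6.
Proof.
have [m h6] := @has_integral_logratio6 R; have p0 := pi_gt0 R; have pn0 : pi != 0 :> R by rewrite gt_eqF.
set s2 := pi ^+ 2 / 4 - 2 * ln 2; set m4 := 5 / 16 * pi ^+ 4 - _ - _.
exists (m / 720 / pi) => t t0.
have h := has_integralB mD (has_integral_cos_logratio t) (has_integralD mD (has_integralB mD
   (has_integral_cst mD (@area_unit_disc R) 1) (has_integralZ mD (t ^+ 2 / 2) (@has_integral_logratio2 R)))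
   (has_integralZ mD (t ^+ 4 / 24) (@has_integral_logratio4 R))).
have hb := has_integralZ mD (t ^+ 6 / 720) h6.
have le z : disc z -> `|cos (t * logratio z) - (1 - t ^+ 2 / 2 * logratio z ^+ 2 + t ^+ 4 / 24 * logratio z ^+ 4)| <=
    t ^+ 6 / 720 * logratio z ^+ 6.
  move=> _; have := cos_taylor4 (t * logratio z); rewrite !exprMn => H.
  rewrite (_ : t ^+ 6 / 720 * _ = t ^+ 6 * logratio z ^+ 6 / 720); last by ring.
  rewrite (_ : 1 - t ^+ 2 / 2 * logratio z ^+ 2 + t ^+ 4 / 24 * logratio z ^+ 4 =
     1 - t ^+ 2 * logratio z ^+ 2 / 2 + t ^+ 4 * logratio z ^+ 4 / 24) //; by ring.
have [w hw wB] := dominated_has_integral mD (has_integral_measurable h) hb le.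
have e := has_integral_unique h hw.
rewrite (_ : charfun t - _ = w / pi); last first.
  by rewrite -e -/s2 -/m4; move: (charfun t) s2 m4 => c a b; move: (pi : R) pn0 => p pn0; field.
rewrite normrM normfV (gtr0_norm p0) (_ : m / 720 / pi * t ^+ 6 = t ^+ 6 / 720 * m / pi); last by ring.
by rewrite ler_pM2r ?invr_gt0.
Qed.

(** For [u <= 2] the fifth-order Taylor bound gives [sin u <= (1 - u^2 / 8) u]; beyond 2, already
    [1 <= u / 2]. *)
Lemma norm_sin_le (u u0 : R) : 0 < u0 -> u0 <= u ->
  `|sin u| <= (1 - Num.min (u0 ^+ 2 / 8) 2^-1) * u.
Proof.
move=> u00 uu; have u_0 : 0 <= u by lra.
have [u2|u2] := leP u 2.
  have s3 := sin_ge3 u_0; have s5 := sin_le5 u_0.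
  have uu2 : u ^+ 2 <= 4 by nra.
  have h3 : u ^+ 3 = u ^+ 2 * u by ring.
  have h5 : u ^+ 5 = u ^+ 2 * u ^+ 2 * u by ring.
  have s0 : 0 <= sin u by apply: le_trans s3; rewrite h3; nra.
  have le : sin u <= (1 - u ^+ 2 / 8) * u.
    apply: le_trans s5 _; rewrite h3 h5; have := sqr_ge0 u; set w := u ^+ 2 in uu2 * => w0.
    have : 0 <= w * u by rewrite mulr_ge0.
    nra.
  rewrite ger0_norm//; apply: le_trans le _; rewrite ler_wpM2r// lerD2l lerN2 ge_min.
  by rewrite ler_pM2r ?invr_gt0// lerXn2r// nnegrE ltW.
apply: (@le_trans _ _ 1); first by rewrite ler_norml sin_geN1 sin_le1.
apply: (@le_trans _ _ ((1 - 2^-1) * u)); first by lra.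
by rewrite ler_wpM2r// lerD2l lerN2 ge_min lexx orbT.
Qed.

Let halfsq : set (measurableTypeR R) := [set` `[0, 2^-1]].

Let mhalf : measurable halfsq. Proof. exact: measurable_itv. Qed.

Let sub_disc (x y : R) : halfsq x -> halfsq y -> disc (x, y).
Proof.
rewrite /halfsq/= !in_itv/= => /andP[x0 x1] /andP[y0 y1].
by rewrite /unit_disc/= -[X in _ < X]sqrtr1 ltr_sqrt//; nra.
Qed.

(* On a horizontal slice [Y] increases with derivative at most [3], so the integral
   is at least a third of that of the exact derivative of [Y + s sin (t Y) / t]. *)
Lemma slice_lower_bound (t s d y : R) : 0 < d -> d <= t -> `|s| <= 1 -> halfsq y ->
  (((ln 5 / 2 * Num.min ((d * (ln 5 / 2)) ^+ 2 / 8) 2^-1) / 3)%:E <=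
   \int[leb]_(x in halfsq) (1 + s * cos (t * logratio (x, y)))%:E)%E.
Proof.
move=> d0 dt s1 hy; have t0 : 0 < t := lt_le_trans d0 dt; set a := ln 5 / 2.
have := hy; rewrite /halfsq/= in_itv/= => /andP[y0 y1].
pose w1 x := (1 + x) ^+ 2 + y ^+ 2 : R; pose w2 x := (1 - x) ^+ 2 + y ^+ 2 : R.
pose Y x := (ln (w1 x) - ln (w2 x)) / 2.
pose Y' x := (1 + x) / w1 x + (1 - x) / w2 x.
have ww x : 0 <= x <= 2^-1 -> 0 < w1 x /\ 0 < w2 x.
  by move=> /andP[x0 x1]; split; rewrite /w1 /w2; have := sqr_ge0 y; nra.
have YE x : halfsq x -> logratio (x, y) = Y x.
  by move=> hx; have [_ _ ->] := logratioE (sub_disc hx hy).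
have Y'3 x : 0 <= x <= 2^-1 -> Y' x <= 3.
  move=> xI; have [h1 h2] := ww x xI; have /andP[x0 x1] := xI.
  have y2 := sqr_ge0 y.
  have : (1 + x) / w1 x <= 1 by rewrite ler_pdivrMr// /w1; nra.
  have : (1 - x) / w2 x <= 2 by rewrite ler_pdivrMr// /w2; nra.
  by rewrite /Y'; lra.
have f0 x : 0 <= 1 + s * cos (t * Y x).
  have : `|s * cos (t * Y x)| <= 1.
    by rewrite normrM mulr_ile1// ler_norml cos_geN1 cos_le1.
  by rewrite ler_norml; lra.
pose G x := (Y x + s * sin (t * Y x) / t) / 3.
have dY (x : R) : 0 <= x <= 2^-1 -> is_derive x (1 : R) Y (Y' x).
  move=> xI; have [h1 h2] := ww x xI; rewrite /Y /Y' /w1 /w2; rewrite /w1 in h1; rewrite /w2 in h2.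
  by der_by; field; rewrite !gt_eqF.
have dG (x : R) : 0 <= x <= 2^-1 -> is_derive x (1 : R) G ((1 + s * cos (t * Y x)) * (Y' x / 3)).
  move=> xI; have dYx := dY x xI; rewrite /G; der_by.
  by field; rewrite gt_eqF.
have cg (x : R) : 0 <= x <= 2^-1 -> {for x, continuous (fun x : R => (1 + s * cos (t * Y x)) * (Y' x / 3))}.
  move=> xI; have [h1 h2] := ww x xI; have dYx := dY x xI.
  rewrite /Y' /w1 /w2; rewrite /w1 in h1; rewrite /w2 in h2.
  by eapply is_derive_continuous; der; rewrite gt_eqF.
have h20 : 0 <= 2^-1 :> R by lra.
apply: (@le_trans _ _ (\int[leb]_(x in halfsq) ((1 + s * cos (t * Y x)) * (Y' x / 3))%:E)%E); last first.
  apply: ge0_le_integral_nonmeasurable => x hx; have := hx; rewrite /halfsq/= in_itv/= => xI.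
    have [h1 h2] := ww x xI; have /andP[x0 x1] := xI.
    by rewrite lee_fin mulr_ge0// divr_ge0// /Y' addr_ge0// divr_ge0 ?ltW//; lra.
  rewrite lee_fin YE// ler_piMr// ler_pdivrMr// mul1r; exact: Y'3.
rewrite (integral_FTC_for h20 cg dG) lee_fin.
have Y0 : Y 0 = 0 by rewrite /Y /w1 /w2 addr0 subr0 subrr mul0r.
rewrite /G Y0 mulr0 sin0 mulr0 mul0r addr0 mul0r subr0 ler_wpM2r//.
have xI : 0 <= (2^-1 : R) <= 2^-1 by lra.
have [h1 h2] := ww _ xI.
(* At [x = 1/2] the ratio [(9/4 + y^2) / (1/4 + y^2)] decreases in [y] and equals 5 at [y = 1/2]. *)
have aY : a <= Y 2^-1.
  rewrite /a /Y ler_wpM2r// -ln_div ?posrE// ler_ln ?posrE ?divr_gt0// ler_pdivlMr//.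
  by rewrite /w1 /w2; nra.
have a0 : 0 < a by rewrite divr_gt0// ln_gt0//; lra.
set b := Y 2^-1 in aY *; set q := Num.min _ _.
have q0 : 0 < q by rewrite lt_min invr_gt0 ltr0n andbT divr_gt0// exprn_gt0// mulr_gt0.
have ub : d * a <= t * b by rewrite ler_pM// ltW.
have := norm_sin_le (mulr_gt0 d0 a0) ub; rewrite -/q => sb.
have : `|s * sin (t * b) / t| <= (1 - q) * b.
  rewrite !normrM normfV (gtr0_norm t0) ler_pdivrMr// -mulrA (mulrC b).
  apply: le_trans sb; rewrite ler_piMl//.
rewrite ler_norml => /andP[h _].
have : a * q <= b * q by rewrite ler_pM2r.
by lra.
Qed.

(** For [s = 1] and [s = -1] the function [1 + s cos (t Y)] is nonnegative, so its integral over the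
    disc is at least the one over a square of side [1/2]. The slices bound the latter below by
    [e / 2] for all [t >= d]; the two signs bound [|charfun t|]. *)
Lemma charfun_gap (d : R) : 0 < d ->
  exists q, [/\ 0 <= q, q < 1 & forall t, d <= t -> `|charfun t| <= q].
Proof.
move=> d0; have p0 := pi_gt0 R; pose a := ln 5 / 2 : R.
pose e := (a * Num.min ((d * a) ^+ 2 / 8) 2^-1) / 3.
have a0 : 0 < a by rewrite divr_gt0// ln_gt0//; lra.
have e0 : 0 < e.
  by rewrite divr_gt0// mulr_gt0// lt_min invr_gt0 ltr0n andbT divr_gt0// exprn_gt0// mulr_gt0.
have key t s : d <= t -> `|s| <= 1 -> e / 2 <= pi + s * (pi * charfun t).
  move=> dt s1; have h := has_integralD mD (has_integral_cst mD (@area_unit_disc R) 1)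
    (has_integralZ mD s (has_integral_cos_logratio t)).
  rewrite mul1r in h; rewrite -lee_fin; have [_ <-] := h.
  pose f (z : plane) : \bar R := (1 + s * cos (t * logratio z))%:E.
  have f0 z : (0 <= f z)%E.
    rewrite lee_fin; have : `|s * cos (t * logratio z)| <= 1.
      by rewrite normrM mulr_ile1// ler_norml cos_geN1 cos_le1.
    by rewrite ler_norml; lra.
  have mf : measurable_fun setT f.
    apply/measurable_EFinP; apply: measurable_funD => //; apply: measurable_funM => //.
    apply: measurableT_comp; first exact: (continuous_measurable_fun (@continuous_cos R)).
    by apply: measurable_funM => //; exact: measurable_logratio.
  have mB : measurable (halfsq `*` halfsq) by exact: measurableX.
  apply: (@le_trans _ _ (\int[area]_(z in halfsq `*` halfsq) f z)%E); last first.
    apply: ge0_subset_integral => //; first exact: measurable_funTS.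
    by move=> [x y] [/= hx hy]; exact: sub_disc.
  rewrite (ge0_integral_prod2 leb leb mhalf mhalf (measurable_funTS mf)) => [|x y _ _]; last exact: f0.
  apply: (@le_trans _ _ (\int[leb]_(y in halfsq) e%:E)%E).
    have -> : (\int[leb]_(y in halfsq) e%:E = e%:E * leb halfsq)%E by exact: integral_cst.
    rewrite /halfsq lebesgue_measure_itv/= lte_fin invr_gt0 ltr0n/= sube0.
    by rewrite -EFinM lee_fin.
  apply: ge0_le_integral_nonmeasurable => y hy; first by rewrite lee_fin ltW.
  exact: slice_lower_bound.
clearbody e; pose q := Num.max 0 (1 - e / 2 / pi); exists q; split.
- by rewrite le_max lexx.
- rewrite gt_max ltr01/=; have : 0 < e / 2 / pi by rewrite !divr_gt0.
  by move: (e / 2 / pi) => x; lra.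
move=> t dt; apply: (@le_trans _ _ (1 - e / 2 / pi)); last by rewrite le_max lexx orbT.
have k1 := key t 1 dt; have k2 := key t (-1) dt; rewrite normrN normr1 in k1 k2.
have {}k1 := k1 (lexx _); have {}k2 := k2 (lexx _).
rewrite -(ler_pM2l p0) mulrBr mulr1 [pi * (_ / pi)]mulrCA divff ?gt_eqF// mulr1.
by rewrite -[X in X * `|_|](gtr0_norm p0) -normrM ler_norml; apply/andP; split; lra.
Qed.

(* Otherwise [cos y >= 1 - y^2 / 2] would give [charfun 1 >= 1]. *)
Lemma variance_gt0 : 0 < pi ^+ 2 / 4 - 2 * ln 2 :> R.
Proof.
have p0 := pi_gt0 R; have [q [_ q1 hq]] := charfun_gap ltr01.
have h1 := has_integral_cos_logratio 1.
have hb := has_integralB mD (has_integral_cst mD (@area_unit_disc R) 1)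
  (has_integralZ mD (1 / 2) (@has_integral_logratio2 R)).
have := has_integral_le mD hb h1 => H.
have {H} : 1 * pi - 1 / 2 * (pi * (pi ^+ 2 / 4 - 2 * ln 2)) <= pi * charfun 1.
  apply: H => z _; rewrite !mul1r.
  have [y0|y0] := leP 0 (logratio z); first by have := cos_ge2 y0; lra.
  have y1 : 0 <= - logratio z by lra.
  by have := cos_ge2 y1; rewrite cosN sqrrN; lra.
set v := _ - 2 * ln 2; rewrite (_ : _ - _ = pi * (1 - v / 2)); last by field.
rewrite ler_pM2l// => le.
by have := hq 1 (lexx _); have := ler_norm (charfun 1); lra.
Qed.

End characteristic_function.

(** * Assembly of the expansion *)

Lemma main_termE (R : realType) (v k : R) (m : nat) : 0 < v -> (0 < m)%N ->
  pi^-1 * (Num.sqrt pi * Num.sqrt (m%:R * v / 2)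
    - m%:R * k * (Num.sqrt (pi / (m%:R * v / 2)) / (4 * (m%:R * v / 2)))
    + Num.sqrt (pi / (m%:R * v / 2)) / 8) =
  Num.sqrt v / Num.sqrt (2 * pi) * Num.sqrt m%:R +
  1 / Num.sqrt (2 * pi * m%:R) * (1 / (4 * Num.sqrt v) - k / Num.sqrt v ^+ 3).
Proof.
move=> v0 m0; have p0 := pi_gt0 R; have n0 : (0 : R) < m%:R by rewrite ltr0n.
have t0 : (0 : R) < 2 by rewrite ltr0n.
have nv0 : 0 <= m%:R * v by rewrite mulr_ge0// ltW.
have e1 : Num.sqrt (m%:R * v / 2) = Num.sqrt m%:R * Num.sqrt v / Num.sqrt 2.
  by rewrite sqrtrM// sqrtrM ?(ltW n0)// sqrtrV ?(ltW t0).
have -> : Num.sqrt (pi / (m%:R * v / 2)) = Num.sqrt pi / (Num.sqrt m%:R * Num.sqrt v / Num.sqrt 2).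
  by rewrite sqrtrM ?(ltW p0)// sqrtrV ?divr_ge0 ?(ltW t0)// e1.
have -> : Num.sqrt (2 * pi * m%:R) = Num.sqrt 2 * Num.sqrt pi * Num.sqrt m%:R :> R.
  by rewrite sqrtrM ?mulr_ge0 ?(ltW p0)// sqrtrM.
have -> : Num.sqrt (2 * pi) = Num.sqrt 2 * Num.sqrt pi :> R by rewrite sqrtrM.
rewrite e1.
(* Every square root is replaced by a positive variable, which turns the identity into a rational
   one modulo [q^2 = 2]. *)
have sq (x : R) : 0 < x -> exists2 y, 0 < y & x = y ^+ 2 /\ Num.sqrt x = y.
  by move=> x0; exists (Num.sqrt x); rewrite ?sqrtr_gt0// sqr_sqrtr// ltW.
have [p pp [-> ->]] := sq _ p0; have [w w0 [-> ->]] := sq _ v0.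
have [n nn [-> ->]] := sq _ n0; have [q q0 [hq ->]] := sq _ t0.
have {}hq : q ^+ 2 = 2 by [].
field: hq.
by rewrite !gt_eqF.
Qed.

Theorem theorem1p4 (R : realType) :
  exists e : nat -> R,
    e =o_\oo (fun m : nat => (Num.sqrt m%:R)^-1) /\
    forall m : nat, (0 < m)%N ->
      areal_mahler (mahler_poly R m) =
      (sigma R / Num.sqrt (2 * pi) * Num.sqrt m%:R - 1 / 4
       + 1 / Num.sqrt (2 * pi * m%:R)
         * (1 / (4 * sigma R) - kappa4 R / (24 * sigma R ^+ 3))
       + e m)%:E.
Proof.
have p0 := pi_gt0 R; pose v : R := pi ^+ 2 / 4 - 2 * ln 2.
have v0 : 0 < v := @variance_gt0 R.
have [M hM] := @charfun_taylor R.
(* The fourth moment is [kappa4 + 3 v^2], as [kappa4] is the fourth cumulant; over 24 this is the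
   coefficient [v^2 / 8 + k] with [k = kappa4 / 24]. *)
have k4 : v ^+ 2 / 8 + kappa4 R / 24 =
    (5 / 16 * pi ^+ 4 - 3 * pi ^+ 2 * ln 2 - 9 / 2 * zeta 3) / 24.
  by rewrite /kappa4 /v; move: (pi : R) (ln 2 : R) (zeta 3 : R) => x y z; field.
have phi4 t : 0 <= t -> `|charfun t - (1 - v * t ^+ 2 / 2 + (v ^+ 2 / 8 + kappa4 R / 24) * t ^+ 4)| <= M * t ^+ 6.
  by rewrite k4; exact: hM.
have [C hC] := has_integral_fourier_asymptotics v0 phi4 (@charfun_gap R) (@measurable_charfun R).
pose main (m : nat) : R := sigma R / Num.sqrt (2 * pi) * Num.sqrt m%:R - 1 / 4
  + 1 / Num.sqrt (2 * pi * m%:R) * (1 / (4 * sigma R) - kappa4 R / (24 * sigma R ^+ 3)).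
have key m : (0 < m)%N -> exists2 r, areal_mahler (mahler_poly R m) = (main m + r)%:E & `|r| <= C / pi / m%:R.
  move=> m0; have [J hJ JB] := hC m m0.
  exists (pi^-1 * J - 4^-1 - main m).
    rewrite (areal_mahler_fourier (phi := charfun) (J := J)) ?(addrC (main m)) ?subrK//.
    by move=> t _; exact: has_integral_cos_logratio.
  rewrite (_ : _ - main m = pi^-1 * (J - (Num.sqrt pi * Num.sqrt (m%:R * v / 2)
    - m%:R * (kappa4 R / 24) * (Num.sqrt (pi / (m%:R * v / 2)) / (4 * (m%:R * v / 2)))
    + Num.sqrt (pi / (m%:R * v / 2)) / 8))); last first.
    rewrite mulrBr main_termE// /main -[Num.sqrt v]/(sigma R).
    rewrite (_ : kappa4 R / (24 * _) = kappa4 R / 24 / sigma R ^+ 3); last by rewrite invfM mulrA.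
    by ring.
  rewrite normrM gtr0_norm ?invr_gt0// [leRHS]mulrAC mulrC.
  by rewrite ler_pM2r ?invr_gt0.
exists (fun m => fine (areal_mahler (mahler_poly R m)) - main m); split; last first.
  by move=> m m0; have [r -> _] := key m m0; rewrite /= [_ + r]addrC addrK addrC.
apply/eqoP => e e0; near=> m.
have m0 : (0 < m)%N by near: m; exact: nbhs_infty_gt.
have [r -> rB] := key m m0; rewrite /= [_ + r]addrC addrK; apply: le_trans rB _.
have n0 : (0 : R) < m%:R by rewrite ltr0n.
have s0 : 0 < Num.sqrt (m%:R : R) by rewrite sqrtr_gt0.
(* With [1 / m] split as the square of [1 / sqrt m], what remains is that [sqrt m] eventually
   exceeds a constant. *)
rewrite gtr0_norm ?invr_gt0// -[X in _ / X](sqr_sqrtr (ltW n0)) expr2 invfM mulrA.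
rewrite ler_pM2r ?invr_gt0// ler_pdivrMr//.
rewrite -ler_pdivrMl//; apply: le_trans (ler_norm _) _.
rewrite -(@ler_pXn2r _ 2)// ?nnegrE ?(ltW s0)// sqr_sqrtr ?(ltW n0)//.
by near: m; exact: nbhs_infty_ger.
Unshelve. all: by end_near.
Qed.
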